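(* For arbitrary points $x,y\in K$ one has $$ s_K(x,y)\le \tanh\frac{\rho_K(x,y)}{2}\le C(\lambda_0)\, s_K(x,y), $$ where $C(\lambda_0)=\mathcal{K}(\sqrt2/2)=1.854074677\ldots$, and the inequality is sharp: the constant $1$ in the left inequality cannot be replaced by a larger constant, and the constant $C(\lambda_0)$ in the right inequality cannot be replaced by a smaller constant (in each case with the inequality required for all $x,y\in K$).
   Context: Identify the plane with $\mathbb{C}$. $K$ is the square $[-1,1]\times[-1,1]$, regarded as a planar domain (i.e. its interior $\{|\mathrm{Re}\, z|<1,\ |\mathrm{Im}\, z|<1\}$), with boundary $\partial K$. $\rho_K$ is the hyperbolic distance in $K$, normalized so that in the unit disc $U=\{|z|<1\}$ one has $\tanh\frac{\rho_U(z_1,z_2)}{2}=\frac{|z_1-z_2|}{|1-z_1\overline{z_2}|}$; thus for a conformal bijection $g:K\to U$ one has $\rho_K(x,y)=\rho_U(g(x),g(y))$. The triangular ratio metric in $K$ is $s_K(x,y)=\dfrac{|x-y|}{\inf_{z\in\partial K}(|x-z|+|z-y|)}$ for $x\ne y$ and $s_K(x,x)=0$. $\mathcal{K}(\lambda)=\int_0^1\frac{dt}{\sqrt{(1-t^2)(1-\lambda^2t^2)}}$ is the complete elliptic integral of the first kind. *)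

(* Defs.v *)
From Stdlib Require Import Reals ClassicalEpsilon.
From Coquelicot Require Import Coquelicot.
Open Scope R_scope.

Definition square (z : C) : Prop := Rabs (Re z) < 1 /\ Rabs (Im z) < 1.

Definition unit_disc (z : C) : Prop := Cmod z < 1.

Definition boundary (D : C -> Prop) (z : C) : Prop :=
  ~ locally z D /\ ~ locally z (fun w => ~ D w).

Definition holomorphic_on (D : C -> Prop) (f : C -> C) : Prop :=
  forall z : C, D z -> ex_derive (K := C_AbsRing) (V := C_NormedModule) f z.

Definition conformal_bijection (D E : C -> Prop) (g : C -> C) : Prop :=
  holomorphic_on D g /\
  (forall z : C, D z -> E (g z)) /\
  (forall z w : C, D z -> D w -> g z = g w -> z = w) /\
  (forall w : C, E w -> exists z : C, D z /\ g z = w).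

Definition artanh (t : R) : R := ln ((1 + t) / (1 - t)) / 2.

(** Curvature -1 normalization:
    tanh (rho / 2) = |z1 - z2| / |1 - z1 conj(z2)|. *)
Definition disc_dist (z1 z2 : C) : R :=
  2 * artanh (Cmod (z1 - z2) / Cmod (1 - z1 * Cconj z2)).

(** Some conformal bijection of [D] onto the unit disc; one exists for every
    simply connected domain [D <> C] (Riemann mapping theorem). *)
Definition riemann_map (D : C -> Prop) : C -> C :=
  epsilon (inhabits (fun z : C => z)) (conformal_bijection D unit_disc).

(** Independent of the bijection chosen in [riemann_map], because [disc_dist] is
    invariant under the conformal automorphisms of the disc. *)
Definition hyperbolic_dist (D : C -> Prop) (x y : C) : R :=
  disc_dist (riemann_map D x) (riemann_map D y).

(** At [x = y] the numerator vanishes, so the value is 0. *)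
Definition triangular_ratio (D : C -> Prop) (x y : C) : R :=
  Cmod (x - y) /
  real (Glb_Rbar (fun r : R =>
    exists z : C, boundary D z /\ r = Cmod (x - z) + Cmod (z - y))).

(** The integrand is unbounded at 1, hence the improper integral. *)
Definition ellipticK (k : R) : R :=
  RInt_gen (fun t : R => / sqrt ((1 - t ^ 2) * (1 - k ^ 2 * t ^ 2)))
    (at_point 0) (at_left 1).

(* Main.v *)
Require Import Defs.
From Stdlib Require Import Reals Lra Lia Psatz ClassicalEpsilon.
From Coquelicot Require Import Coquelicot.
Open Scope R_scope.

(** Both metrics are explicit, and the theorem is a comparison of two
    cross-ratios of real numbers.

    Heron's reflection argument turns the infimum in [s] into the distance from
    [x] to the nearest reflection of [y] in a side ([triangular_ratio_square]).
    With [a], [b] the coordinate differences of [x] and [y], and [P], [Q] those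
    between [x] and the nearer vertical, respectively horizontal, reflection,
      [s ^ 2 = (a ^ 2 + b ^ 2) / min (P ^ 2 + b ^ 2) (a ^ 2 + Q ^ 2)].

    For the hyperbolic metric, [1 / wp] for the square lattice maps a quarter of
    the period square onto a half plane, where [tanh (rho / 2)] is
    [|W - V| / |W - conj V|].  Writing [wp X - wp Y] as a quotient of sigma
    functions, and [|sigma (u + i v)| ^ 2] through [wp u] and [wp v], one finds
      [tanh (rho / 2) ^ 2 = (f a + f b) (f P + f Q) / ((f P + f b) (f a + f Q))],
    where [f = sl ^ 2] is the squared lemniscate sine and lengths are scaled so
    that the side of the square is the first point [w] where [sl = 1].  The proof
    below derives this from the addition theorem of [f] on the real line
    ([lem_addition], [disc_ratio_square_map]).

    The two inequalities then rest mainly on the concavity of [sl], by which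
    [f u / u ^ 2] decreases from [1] to [1 / w ^ 2] on [(0, w]].  This gives the
    constant [1] on the left ([lem_cross_ratio_ge]) and, for the squares, the
    constant [2 w ^ 2] on the right ([lem_cross_ratio_le]), where [sqrt 2 * w] is
    the complete elliptic integral.  Equality is approached at the boundary on
    the left and at the centre on the right.  The decimals come from the Taylor
    series of the inverse of [sl], because [sl ^ 2 = sqrt 2 - 1] at half of [w].

    The hyperbolic distance is defined by an unspecified conformal bijection, so
    it must be shown that all of them give the same distance
    ([disc_ratio_conformally_invariant]).  For this Goursat's lemma, applied to
    [u |-> f (z0 + exp u)] on a rectangle, gives the mean value property at
    points where [f] need only be continuous; hence a maximum principle and,
    applied to the quotient of two disc automorphisms, the Schwarz--Pick lemma.
    The maximum principle also shows that the explicit map is onto. *)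

(** * Complex differentiability *)

Lemma Rlt_Rmin (a b c : R) : a < Rmin b c -> a < b /\ a < c.
Proof. intros H; pose proof (Rmin_l b c); pose proof (Rmin_r b c); lra. Qed.

(** [C] carries two normed-module structures over itself; the explicit form of
    differentiability does not depend on which of them is meant. *)
Definition complex_derivative (f : C -> C) (z l : C) : Prop :=
  forall eps : R, 0 < eps -> exists d : R, 0 < d /\ forall w : C,
    Cmod (w - z) < d -> Cmod (f w - f z - l * (w - z)) <= eps * Cmod (w - z).

Definition complex_continuous (f : C -> C) (z : C) : Prop :=
  forall eps : R, 0 < eps -> exists d : R, 0 < d /\ forall w : C,
    Cmod (w - z) < d -> Cmod (f w - f z) < eps.

Lemma Cmod_sq (z : C) : Cmod z ^ 2 = Re z ^ 2 + Im z ^ 2.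
Proof. apply Cmod2_alt. Qed.

Lemma Cmod_le_sq (z : C) (r : R) : 0 <= r -> Re z ^ 2 + Im z ^ 2 <= r ^ 2 -> Cmod z <= r.
Proof.
  intros Hr H; rewrite <- Cmod_sq in H; pose proof (Cmod_ge_0 z); nra.
Qed.

Lemma im_le_Cmod (z : C) : Rabs (Im z) <= Cmod z.
Proof.
  pose proof (Rmax_Cmod z) as H.
  eapply Rle_trans; [apply Rmax_r | exact H].
Qed.

Lemma Cmod_le_sum (z : C) : Cmod z <= Rabs (Re z) + Rabs (Im z).
Proof.
  apply Cmod_le_sq.
  - pose proof (Rabs_pos (Re z)); pose proof (Rabs_pos (Im z)); lra.
  - pose proof (Rabs_pos (Re z)); pose proof (Rabs_pos (Im z)).
    rewrite <- (pow2_abs (Re z)), <- (pow2_abs (Im z)); nra.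
Qed.

Lemma Cmod_minus_sym (z w : C) : Cmod (z - w) = Cmod (w - z).
Proof. rewrite <- Cmod_opp; f_equal; ring. Qed.

Lemma Cmod_rev_triangle (z w : C) : Cmod z - Cmod w <= Cmod (z - w).
Proof.
  pose proof (Cmod_triangle (z - w) w) as H.
  replace (z - w + w)%C with z in H by ring; lra.
Qed.

Lemma ex_derive_complex_derivative (f : C -> C) (z : C) :
  ex_derive (K := C_AbsRing) (V := C_NormedModule) f z <->
  exists l, complex_derivative f z l.
Proof.
  split.
  - intros [l [_ H]]; exists l; intros eps He.
    specialize (H z (fun P HP => HP) (mkposreal eps He)).
    destruct H as [d Hd]; exists d; split; [apply cond_pos|].
    intros w Hw; specialize (Hd w Hw).
    change (Cmod (minus (minus (f w) (f z)) (scal (minus w z) l)) <= eps * Cmod (w - z)) in Hd.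
    replace (f w - f z - l * (w - z))%C with (minus (minus (f w) (f z)) (scal (minus w z) l) : C);
      [exact Hd|].
    change (f w - f z - (w - z) * l = f w - f z - l * (w - z))%C; ring.
  - intros [l H]; exists l; split.
    + apply is_linear_scal_l.
    + intros x Hx eps.
      assert (Hxz : z = x).
      { apply (@is_filter_lim_locally_unique C_AbsRing (AbsRing_NormedModule C_AbsRing)). exact Hx. }
      subst x.
      destruct (H eps (cond_pos eps)) as [d [Hd0 Hd]].
      exists (mkposreal d Hd0); intros w Hw; specialize (Hd w Hw).
      change (Cmod (minus (minus (f w) (f z)) (scal (minus w z) l)) <= eps * Cmod (w - z)).
      replace (minus (minus (f w) (f z)) (scal (minus w z) l) : C)
        with (f w - f z - l * (w - z))%C; [exact Hd|].
      change (f w - f z - l * (w - z) = f w - f z - (w - z) * l)%C; ring.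
Qed.

Lemma complex_derivative_continuous (f : C -> C) (z l : C) :
  complex_derivative f z l -> complex_continuous f z.
Proof.
  intros H eps He.
  destruct (H 1 Rlt_0_1) as [d [Hd0 Hd]].
  pose proof (Cmod_ge_0 l) as Hl.
  exists (Rmin d (eps / (2 + Cmod l))).
  assert (0 < eps / (2 + Cmod l)) by (apply Rdiv_lt_0_compat; lra).
  split; [apply Rmin_glb_lt; lra|].
  intros w Hw.
  destruct (Rlt_Rmin _ _ _ Hw) as [H1 H2].
  specialize (Hd w H1).
  pose proof (Cmod_triangle (f w - f z - l * (w - z)) (l * (w - z))) as Ht.
  replace (f w - f z - l * (w - z) + l * (w - z))%C with (f w - f z)%C in Ht by ring.
  rewrite Cmod_mult in Ht.
  pose proof (Cmod_ge_0 (w - z)).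
  assert (Cmod (w - z) * (2 + Cmod l) < eps).
  { replace eps with (eps / (2 + Cmod l) * (2 + Cmod l)) by (field; lra).
    apply Rmult_lt_compat_r; lra. }
  nra.
Qed.

Lemma complex_derivative_ext_loc (f g : C -> C) (z l : C) (r : R) :
  0 < r -> (forall w, Cmod (w - z) < r -> f w = g w) ->
  complex_derivative f z l -> complex_derivative g z l.
Proof.
  intros Hr He H eps Heps; destruct (H eps Heps) as [d [Hd0 Hd]].
  exists (Rmin d r); split; [apply Rmin_glb_lt; lra|].
  intros w Hw.
  destruct (Rlt_Rmin _ _ _ Hw) as [? ?].
  rewrite <- He, <- (He z); auto.
  replace (z - z)%C with (RtoC 0) by ring; rewrite Cmod_0; lra.
Qed.

Lemma complex_derivative_const (c z : C) : complex_derivative (fun _ => c) z 0.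
Proof.
  intros eps He; exists 1; split; [lra|]; intros w _.
  replace (c - c - 0 * (w - z))%C with (RtoC 0) by ring.
  rewrite Cmod_0; pose proof (Cmod_ge_0 (w - z)); nra.
Qed.

Lemma complex_derivative_id (z : C) : complex_derivative (fun w => w) z 1.
Proof.
  intros eps He; exists 1; split; [lra|]; intros w _.
  replace (w - z - 1 * (w - z))%C with (RtoC 0) by ring.
  rewrite Cmod_0; pose proof (Cmod_ge_0 (w - z)); nra.
Qed.

Lemma complex_continuous_Cmod (f : C -> C) (z : C) (eps : R) :
  complex_continuous f z -> 0 < eps ->
  exists d, 0 < d /\ forall w, Cmod (w - z) < d -> Rabs (Cmod (f w) - Cmod (f z)) < eps.
Proof.
  intros H He; destruct (H eps He) as [d [Hd0 Hd]]; exists d; split; [exact Hd0|].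
  intros w Hw; specialize (Hd w Hw).
  pose proof (Cmod_rev_triangle (f w) (f z)) as H1.
  pose proof (Cmod_rev_triangle (f z) (f w)) as H2; rewrite Cmod_minus_sym in H2.
  apply Rabs_lt_between; lra.
Qed.

Lemma complex_continuous_mult (f g : C -> C) (z : C) :
  complex_continuous f z -> complex_continuous g z ->
  complex_continuous (fun w => f w * g w)%C z.
Proof.
  intros Hf Hg eps He.
  pose proof (Cmod_ge_0 (f z)); pose proof (Cmod_ge_0 (g z)).
  set (M := 1 + Cmod (f z) + Cmod (g z)).
  assert (HM : 1 <= M) by (unfold M; lra).
  assert (He' : 0 < eps / (2 * M)) by (apply Rdiv_lt_0_compat; lra).
  set (e := Rmin 1 (eps / (2 * M))).
  assert (He0 : 0 < e) by (apply Rmin_glb_lt; lra).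
  assert (He1 : e <= 1) by apply Rmin_l.
  assert (HeM : e * M < eps).
  { apply Rle_lt_trans with (eps / (2 * M) * M); [apply Rmult_le_compat_r; [lra | apply Rmin_r]|].
    replace (eps / (2 * M) * M) with (eps / 2) by (field; lra); lra. }
  destruct (Hf e He0) as [d1 [Hd1 H1]]; destruct (Hg e He0) as [d2 [Hd2 H2]].
  exists (Rmin d1 d2); split; [apply Rmin_glb_lt; lra|].
  intros w Hw.
  destruct (Rlt_Rmin _ _ _ Hw) as [Hw1 Hw2].
  specialize (H1 w Hw1); specialize (H2 w Hw2).
  replace (f w * g w - f z * g z)%C
    with ((f w - f z) * (g w - g z) + ((f w - f z) * g z + f z * (g w - g z)))%C by ring.
  eapply Rle_lt_trans; [apply Cmod_triangle|].
  eapply Rle_lt_trans; [apply Rplus_le_compat_l, Cmod_triangle|].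
  rewrite !Cmod_mult.
  pose proof (Cmod_ge_0 (f w - f z)); pose proof (Cmod_ge_0 (g w - g z)).
  assert (Cmod (f w - f z) * Cmod (g w - g z) <= e * 1) by (apply Rmult_le_compat; lra).
  assert (Cmod (f w - f z) * Cmod (g z) <= e * Cmod (g z)) by (apply Rmult_le_compat_r; lra).
  assert (Cmod (f z) * Cmod (g w - g z) <= Cmod (f z) * e) by (apply Rmult_le_compat_l; lra).
  unfold M in HeM; lra.
Qed.

Lemma complex_continuous_comp (f g : C -> C) (z : C) :
  complex_continuous f z -> complex_continuous g (f z) ->
  complex_continuous (fun w => g (f w)) z.
Proof.
  intros Hf Hg eps He; destruct (Hg eps He) as [d [Hd H]].
  destruct (Hf d Hd) as [d' [Hd' H']]; exists d'; split; auto.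
Qed.

Lemma complex_continuous_plus (f g : C -> C) (z : C) :
  complex_continuous f z -> complex_continuous g z ->
  complex_continuous (fun w => f w + g w)%C z.
Proof.
  intros Hf Hg eps He.
  destruct (Hf (eps / 2)) as [d1 [Hd1 H1]]; [lra|].
  destruct (Hg (eps / 2)) as [d2 [Hd2 H2]]; [lra|].
  exists (Rmin d1 d2); split; [apply Rmin_glb_lt; lra|].
  intros w Hw; destruct (Rlt_Rmin _ _ _ Hw) as [Hw1 Hw2].
  specialize (H1 w Hw1); specialize (H2 w Hw2).
  replace (f w + g w - (f z + g z))%C with ((f w - f z) + (g w - g z))%C by ring.
  eapply Rle_lt_trans; [apply Cmod_triangle | lra].
Qed.

Lemma complex_continuous_const (c z : C) : complex_continuous (fun _ => c) z.
Proof. apply (complex_derivative_continuous _ _ _ (complex_derivative_const c z)). Qed.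

Definition slope (f : C -> C) (a l x : C) : C :=
  if Ceq_dec x a then l else ((f x - f a) / (x - a))%C.

Lemma Cminus_neq_0 (x a : C) : x <> a -> (x - a)%C <> 0.
Proof.
  intros H E; apply H; replace x with (x - a + a)%C by ring; rewrite E; ring.
Qed.

Lemma slope_continuous (f : C -> C) (a l : C) :
  complex_derivative f a l -> complex_continuous (slope f a l) a.
Proof.
  intros H eps He; destruct (H (eps / 2)) as [d [Hd0 Hd]]; [lra|].
  exists d; split; [exact Hd0|]; intros w Hw.
  unfold slope at 2; destruct (Ceq_dec a a) as [_|Hn]; [|congruence].
  unfold slope; destruct (Ceq_dec w a) as [E|E].
  - replace (l - l)%C with (RtoC 0) by ring; rewrite Cmod_0; exact He.
  - specialize (Hd w Hw).
    pose proof (Cminus_neq_0 w a E) as Hn.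
    assert (Hp : 0 < Cmod (w - a)) by (apply Cmod_gt_0, Hn).
    replace ((f w - f a) / (w - a) - l)%C with ((f w - f a - l * (w - a)) / (w - a))%C
      by (field; exact Hn).
    rewrite Cmod_div by exact Hn.
    apply Rle_lt_trans with (eps / 2); [|lra].
    apply Rle_div_l; [exact Hp | exact Hd].
Qed.

(** Caratheodory's form of differentiability: all the rules below become
    identities between continuous difference quotients. *)
Lemma complex_derivative_slope (f : C -> C) (z l : C) :
  complex_derivative f z l <->
  exists F, complex_continuous F z /\ F z = l /\ forall w, f w = (f z + F w * (w - z))%C.
Proof.
  split.
  - intros H; exists (slope f z l); split; [apply slope_continuous, H|]; unfold slope; split.
    + destruct (Ceq_dec z z); [reflexivity | congruence].
    + intros w; destruct (Ceq_dec w z) as [->|E]; [ring|].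
      field; apply Cminus_neq_0, E.
  - intros [F [HF [<- E]]] eps He; destruct (HF eps He) as [d [Hd0 Hd]].
    exists d; split; [exact Hd0|]; intros w Hw; rewrite (E w).
    replace (f z + F w * (w - z) - f z - F z * (w - z))%C with ((F w - F z) * (w - z))%C by ring.
    rewrite Cmod_mult; apply Rmult_le_compat_r; [apply Cmod_ge_0 | apply Rlt_le, Hd, Hw].
Qed.

Lemma complex_derivative_plus (f g : C -> C) (z l m : C) :
  complex_derivative f z l -> complex_derivative g z m ->
  complex_derivative (fun w => f w + g w)%C z (l + m).
Proof.
  intros Hf Hg; apply complex_derivative_slope in Hf; apply complex_derivative_slope in Hg.
  destruct Hf as [F [HF [<- EF]]], Hg as [G [HG [<- EG]]]; apply complex_derivative_slope.
  exists (fun w => F w + G w)%C; split; [apply complex_continuous_plus; assumption|].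
  split; [reflexivity | intros w; rewrite (EF w), (EG w); ring].
Qed.

Lemma complex_derivative_mult (f g : C -> C) (z l m : C) :
  complex_derivative f z l -> complex_derivative g z m ->
  complex_derivative (fun w => f w * g w)%C z (l * g z + f z * m).
Proof.
  intros Hf Hg; pose proof (complex_derivative_continuous _ _ _ Hg) as Cg.
  apply complex_derivative_slope in Hf; apply complex_derivative_slope in Hg.
  destruct Hf as [F [HF [<- EF]]], Hg as [G [HG [<- EG]]]; apply complex_derivative_slope.
  exists (fun w => F w * g w + f z * G w)%C; split.
  - apply complex_continuous_plus; apply complex_continuous_mult;
      auto using complex_continuous_const.
  - split; [reflexivity | intros w; rewrite (EF w), (EG w); ring].
Qed.

Lemma complex_derivative_opp (f : C -> C) (z l : C) :
  complex_derivative f z l -> complex_derivative (fun w => - f w)%C z (- l).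
Proof.
  intros Hf; apply complex_derivative_slope in Hf; destruct Hf as [F [HF [<- EF]]].
  apply complex_derivative_slope; exists (fun w => - (1) * F w)%C; split.
  - apply complex_continuous_mult; auto using complex_continuous_const.
  - split; [ring | intros w; rewrite (EF w); ring].
Qed.

Lemma complex_derivative_minus (f g : C -> C) (z l m : C) :
  complex_derivative f z l -> complex_derivative g z m ->
  complex_derivative (fun w => f w - g w)%C z (l - m).
Proof.
  intros Hf Hg; apply complex_derivative_plus; [|apply complex_derivative_opp]; assumption.
Qed.

Lemma complex_derivative_comp (f g : C -> C) (z l m : C) :
  complex_derivative f z l -> complex_derivative g (f z) m ->
  complex_derivative (fun w => g (f w)) z (m * l).
Proof.
  intros Hf Hg; pose proof (complex_derivative_continuous _ _ _ Hf) as Cf.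
  apply complex_derivative_slope in Hf; apply complex_derivative_slope in Hg.
  destruct Hf as [F [HF [<- EF]]], Hg as [G [HG [<- EG]]]; apply complex_derivative_slope.
  exists (fun w => G (f w) * F w)%C; split.
  - apply complex_continuous_mult; [apply complex_continuous_comp|]; assumption.
  - split; [reflexivity|]; intros w; rewrite (EG (f w)).
    replace (f w - f z)%C with (F w * (w - z))%C by (rewrite (EF w); ring); ring.
Qed.

Lemma complex_derivative_inv (z : C) :
  z <> 0 -> complex_derivative Cinv z (- / (z * z)).
Proof.
  intros Hz eps He.
  assert (Hm : 0 < Cmod z) by (apply Cmod_gt_0; exact Hz).
  set (M := Cmod z) in *.
  exists (Rmin (M / 2) (eps * M ^ 3 / 2)).
  assert (0 < M ^ 3) by (apply pow_lt; lra).
  split; [apply Rmin_glb_lt; [lra|]; nra|].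
  intros w Hw.
  destruct (Rlt_Rmin _ _ _ Hw) as [Hw1 Hw2].
  assert (HwM : M / 2 < Cmod w).
  { pose proof (Cmod_rev_triangle z w); rewrite Cmod_minus_sym in H0; fold M in H0; lra. }
  assert (Hw0 : w <> 0) by (apply Cmod_gt_0; lra).
  replace (/ w - / z - - / (z * z) * (w - z))%C
    with ((w - z) * (w - z) / (w * (z * z)))%C by (field; auto).
  rewrite Cmod_div by (repeat apply Cmult_neq_0; auto).
  rewrite !Cmod_mult; fold M.
  pose proof (Cmod_ge_0 (w - z)) as Hwz.
  apply Rle_div_l; [apply Rmult_lt_0_compat; nra|].
  apply Rle_trans with (eps * Cmod (w - z) * (M / 2 * (M * M))).
  - replace (eps * Cmod (w - z) * (M / 2 * (M * M)))
      with (Cmod (w - z) * (eps * M ^ 3 / 2)) by field.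
    apply Rmult_le_compat_l; lra.
  - apply Rmult_le_compat_l; [nra|]; apply Rmult_le_compat_r; nra.
Qed.

Lemma complex_derivative_div (f g : C -> C) (z l m : C) :
  complex_derivative f z l -> complex_derivative g z m -> g z <> 0 ->
  exists k, complex_derivative (fun w => f w / g w)%C z k.
Proof.
  intros Hf Hg H0; eexists.
  apply complex_derivative_mult; [exact Hf|].
  apply (complex_derivative_comp g Cinv); [exact Hg|].
  apply complex_derivative_inv; exact H0.
Qed.

Lemma complex_continuous_div (f g : C -> C) (z : C) :
  complex_continuous f z -> complex_continuous g z -> g z <> 0 ->
  complex_continuous (fun w => f w / g w)%C z.
Proof.
  intros Hf Hg H0; apply complex_continuous_mult; [exact Hf|].
  apply (complex_continuous_comp g Cinv); [exact Hg|].
  eapply complex_derivative_continuous, complex_derivative_inv, H0.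
Qed.

Lemma continuous_along_path (f : C -> C) (a b : R -> R) (t : R) :
  continuity_pt a t -> continuity_pt b t -> complex_continuous f (a t, b t) ->
  continuous (fun s => Re (f (a s, b s))) t /\ continuous (fun s => Im (f (a s, b s))) t.
Proof.
  intros Ha Hb Hf; apply continuity_pt_filterlim in Ha; apply continuity_pt_filterlim in Hb.
  pose proof (proj1 (filterlim_locally a (a t)) Ha) as La.
  pose proof (proj1 (filterlim_locally b (b t)) Hb) as Lb.
  assert (H : forall eps, 0 < eps ->
            locally t (fun s => Cmod (f (a s, b s) - f (a t, b t)) < eps)).
  { intros eps He; destruct (Hf eps He) as [d [Hd0 Hd]].
    assert (Hd2 : 0 < d / 2) by lra.
    generalize (filter_and _ _ (La (mkposreal _ Hd2)) (Lb (mkposreal _ Hd2))).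
    apply filter_imp; intros s [H1 H2]; apply Hd.
    change (Rabs (a s - a t) < d / 2) in H1; change (Rabs (b s - b t) < d / 2) in H2.
    eapply Rle_lt_trans; [apply Cmod_le_sum|].
    change (Rabs (a s - a t) + Rabs (b s - b t) < d); lra. }
  split; apply filterlim_locally; intros eps; generalize (H eps (cond_pos eps));
    apply filter_imp; intros s Hs; eapply Rle_lt_trans; [|exact Hs| |exact Hs].
  - apply (re_le_Cmod (f (a s, b s) - f (a t, b t))).
  - apply (im_le_Cmod (f (a s, b s) - f (a t, b t))).
Qed.

(** * Compactness of rectangles by repeated quartering *)

Lemma nested_intervals_point (x : nat -> R) (L : R) :
  0 <= L -> (forall n, x n <= x (S n)) ->
  (forall n, x (S n) + L / 2 ^ S n <= x n + L / 2 ^ n) ->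
  exists z, forall n, x n <= z <= x n + L / 2 ^ n.
Proof.
  intros HL Hinc Hdec.
  assert (Hp : forall n, 0 <= L / 2 ^ n).
  { intros n; apply Rdiv_le_0_compat; [exact HL | apply pow_lt; lra]. }
  assert (Hmono : forall n k, x n <= x (n + k)%nat).
  { intros n k; induction k as [|k IH]; [rewrite Nat.add_0_r; lra|].
    rewrite Nat.add_succ_r; specialize (Hinc (n + k)%nat); lra. }
  assert (Hdecr : forall n k, x (n + k)%nat + L / 2 ^ (n + k) <= x n + L / 2 ^ n).
  { intros n k; induction k as [|k IH]; [rewrite Nat.add_0_r; lra|].
    rewrite Nat.add_succ_r; specialize (Hdec (n + k)%nat); lra. }
  assert (Hub : forall n m, x m <= x n + L / 2 ^ n).
  { intros n m; destruct (Nat.le_gt_cases n m) as [H|H].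
    - replace m with (n + (m - n))%nat by lia.
      specialize (Hdecr n (m - n)%nat); specialize (Hp (n + (m - n))%nat); lra.
    - replace n with (m + (n - m))%nat by lia.
      specialize (Hmono m (n - m)%nat); specialize (Hp (m + (n - m))%nat); lra. }
  destruct (completeness (fun r => exists n, r = x n)) as [z [Hz1 Hz2]].
  - exists (x 0%nat + L / 2 ^ 0); intros r [n ->]; apply Hub.
  - exists (x 0%nat), 0%nat; reflexivity.
  - exists z; intros n; split.
    + apply Hz1; exists n; reflexivity.
    + apply Hz2; intros r [m ->]; apply Hub.
Qed.

Lemma small_dyadic (L d : R) : 0 < d -> exists n : nat, L / 2 ^ n < d.
Proof.
  intros Hd.
  destruct (pow_lt_1_zero (/ 2)) with (y := d / (Rabs L + 1)) as [n Hn].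
  - rewrite Rabs_pos_eq; lra.
  - apply Rdiv_lt_0_compat; [lra|]; pose proof (Rabs_pos L); lra.
  - exists n; specialize (Hn n (Nat.le_refl n)).
    rewrite Rabs_pos_eq in Hn by (apply pow_le; lra).
    rewrite pow_inv in Hn.
    pose proof (Rabs_pos L); pose proof (Rle_abs L).
    assert (0 < / 2 ^ n) by (apply Rinv_0_lt_compat, pow_lt; lra).
    apply Rle_lt_trans with ((Rabs L + 1) * / 2 ^ n).
    + unfold Rdiv; apply Rmult_le_compat_r; lra.
    + replace d with ((Rabs L + 1) * (d / (Rabs L + 1))) by (field; lra).
      apply Rmult_lt_compat_l; lra.
Qed.

(** Heine--Borel in the form of a Cousin lemma.  [G n x y] speaks of the
    rectangle with lower left corner [(x, y)] and sides [L / 2 ^ n], [M / 2 ^ n]: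
    a property that passes from the four quarters to the whole, and that holds
    for all small rectangles around each point, holds for the whole rectangle. *)
Lemma quartering_induction (a c L M : R) (G : nat -> R -> R -> Prop) :
  0 <= L -> 0 <= M ->
  (forall n x y,
     G (S n) x y -> G (S n) (x + L / 2 ^ S n) y ->
     G (S n) x (y + M / 2 ^ S n) -> G (S n) (x + L / 2 ^ S n) (y + M / 2 ^ S n) ->
     G n x y) ->
  (forall x y, a <= x <= a + L -> c <= y <= c + M ->
     exists d, 0 < d /\ forall n x' y',
       a <= x' -> x' + L / 2 ^ n <= a + L -> c <= y' -> y' + M / 2 ^ n <= c + M ->
       x' <= x <= x' + L / 2 ^ n -> y' <= y <= y' + M / 2 ^ n ->
       L / 2 ^ n < d -> M / 2 ^ n < d -> G n x' y') ->
  G 0%nat a c.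
Proof.
  intros HL HM Hmerge Hloc; apply NNPP; intros HnG.
  assert (Hhalf : forall K n, K / 2 ^ n = 2 * (K / 2 ^ S n)).
  { intros K n; simpl; field; apply pow_nonzero; lra. }
  set (child := fun n (p q : R * R) =>
    (fst q = fst p \/ fst q = fst p + L / 2 ^ S n) /\
    (snd q = snd p \/ snd q = snd p + M / 2 ^ S n) /\ ~ G (S n) (fst q) (snd q)).
  assert (Hchild : forall n p, ~ G n (fst p) (snd p) -> exists q, child n p q).
  { intros n [x y] Hn; apply NNPP; intros Hno; apply Hn; simpl in *.
    apply Hmerge; apply NNPP; intros Hg; apply Hno.
    - exists (x, y); unfold child; simpl; auto.
    - exists (x + L / 2 ^ S n, y); unfold child; simpl; auto.
    - exists (x, y + M / 2 ^ S n); unfold child; simpl; auto.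
    - exists (x + L / 2 ^ S n, y + M / 2 ^ S n); unfold child; simpl; auto. }
  set (p := fix p n := match n with
    | O => (a, c)
    | S n => epsilon (inhabits (a, c)) (child n (p n)) end).
  assert (Hp : forall n, ~ G n (fst (p n)) (snd (p n))).
  { induction n as [|n IH]; [exact HnG|].
    apply (epsilon_spec (inhabits (a, c)) (child n (p n)) (Hchild n (p n) IH)). }
  assert (Hc : forall n, child n (p n) (p (S n))).
  { intros n; apply (epsilon_spec (inhabits (a, c)) (child n (p n)) (Hchild n (p n) (Hp n))). }
  assert (Hpos : forall K n, 0 <= K -> 0 <= K / 2 ^ n).
  { intros K n HK; apply Rdiv_le_0_compat; [exact HK | apply pow_lt; lra]. }
  assert (Hx1 : forall n, fst (p n) <= fst (p (S n))).
  { intros n; specialize (Hpos L (S n) HL); destruct (Hc n) as [[->| ->] _]; lra. }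
  assert (Hx2 : forall n, fst (p (S n)) + L / 2 ^ S n <= fst (p n) + L / 2 ^ n).
  { intros n; rewrite (Hhalf L n); specialize (Hpos L (S n) HL);
      destruct (Hc n) as [[->| ->] _]; lra. }
  assert (Hy1 : forall n, snd (p n) <= snd (p (S n))).
  { intros n; specialize (Hpos M (S n) HM); destruct (Hc n) as [_ [[->| ->] _]]; lra. }
  assert (Hy2 : forall n, snd (p (S n)) + M / 2 ^ S n <= snd (p n) + M / 2 ^ n).
  { intros n; rewrite (Hhalf M n); specialize (Hpos M (S n) HM);
      destruct (Hc n) as [_ [[->| ->] _]]; lra. }
  destruct (nested_intervals_point _ L HL Hx1 Hx2) as [x Hx].
  destruct (nested_intervals_point _ M HM Hy1 Hy2) as [y Hy].
  assert (Hin : forall n, a <= fst (p n) /\ fst (p n) + L / 2 ^ n <= a + L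
                       /\ c <= snd (p n) /\ snd (p n) + M / 2 ^ n <= c + M).
  { induction n as [|n IH].
    - simpl; lra.
    - specialize (Hx1 n); specialize (Hx2 n); specialize (Hy1 n); specialize (Hy2 n); lra. }
  destruct (Hloc x y) as [d [Hd0 Hd]].
  - pose proof (Hx 0%nat) as H; simpl in H; lra.
  - pose proof (Hy 0%nat) as H; simpl in H; lra.
  - destruct (small_dyadic (L + M) d Hd0) as [n Hn].
    apply (Hp n), Hd; try apply Hin; auto.
    + specialize (Hpos M n HM); unfold Rdiv in *; lra.
    + specialize (Hpos L n HL); unfold Rdiv in *; lra.
Qed.

Lemma rectangle_split (L M : R) (n : nat) (x y s t : R) :
  x <= s <= x + L / 2 ^ n -> y <= t <= y + M / 2 ^ n ->
  (x <= s <= x + L / 2 ^ S n \/ x + L / 2 ^ S n <= s <= x + L / 2 ^ S n + L / 2 ^ S n) /\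
  (y <= t <= y + M / 2 ^ S n \/ y + M / 2 ^ S n <= t <= y + M / 2 ^ S n + M / 2 ^ S n).
Proof.
  intros Hs Ht.
  assert (Hhalf : forall K, K / 2 ^ n = 2 * (K / 2 ^ S n)).
  { intros K; simpl; field; apply pow_nonzero; lra. }
  rewrite Hhalf in Hs, Ht.
  split; [destruct (Rle_dec s (x + L / 2 ^ S n)) | destruct (Rle_dec t (y + M / 2 ^ S n))];
    [left|right|left|right]; lra.
Qed.

Lemma square_compact_induction (r : R) (A : (C -> Prop) -> Prop) :
  let Q := fun z => Rabs (Re z) <= r /\ Rabs (Im z) <= r in
  0 <= r ->
  (forall S T : C -> Prop, (forall z, S z -> T z) -> A T -> A S) ->
  (forall S T, A S -> A T -> A (fun z => S z \/ T z)) ->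
  (forall z, Q z -> exists d, 0 < d /\ A (fun w => Q w /\ Cmod (w - z) < d)) ->
  A Q.
Proof.
  intros Q Hr Hsub Hunion Hloc.
  set (G := fun (n : nat) x y => A (fun z => Q z /\
    x <= Re z <= x + 2 * r / 2 ^ n /\ y <= Im z <= y + 2 * r / 2 ^ n)).
  assert (Hin : forall u, - r <= u <= - r + 2 * r <-> Rabs u <= r).
  { intros u; split; intros H; [apply Rabs_le; lra|].
    apply Rabs_le_between in H; lra. }
  assert (H : G 0%nat (- r) (- r)).
  { apply (quartering_induction (- r) (- r) (2 * r) (2 * r)); try lra.
    - intros n x y H1 H2 H3 H4.
      refine (Hsub _ _ _ (Hunion _ _ (Hunion _ _ H1 H2) (Hunion _ _ H3 H4))).
      intros z [Hz [Hx Hy]].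
      destruct (rectangle_split _ _ n x y _ _ Hx Hy) as [[Ha|Ha] [Hb|Hb]]; tauto.
    - intros x y Hx Hy; apply Hin in Hx; apply Hin in Hy.
      destruct (Hloc (x, y) (conj Hx Hy)) as [d [Hd H]].
      exists (d / 2); split; [lra|].
      intros n x' y' _ _ _ _ Hx' Hy' Hsm _; refine (Hsub _ _ _ H).
      intros z [Hz [Ha Hb]]; split; [exact Hz|].
      eapply Rle_lt_trans; [apply Cmod_le_sum|].
      change (Rabs (Re z - x) + Rabs (Im z - y) < d).
      assert (Rabs (Re z - x) <= 2 * r / 2 ^ n) by (apply Rabs_le; lra).
      assert (Rabs (Im z - y) <= 2 * r / 2 ^ n) by (apply Rabs_le; lra).
      lra. }
  refine (Hsub _ _ _ H); intros z Hz; split; [exact Hz|]; simpl; rewrite !Rdiv_1_r.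
  split; apply Hin, Hz.
Qed.

(** If every value were exceeded by another one, finitely many of these would
    dominate [u] on the whole square, and their largest would exceed itself. *)
Lemma continuous_max_on_square (r : R) (u : C -> R) :
  0 <= r ->
  (forall z, Rabs (Re z) <= r -> Rabs (Im z) <= r -> forall eps, 0 < eps ->
     exists d, 0 < d /\ forall w, Cmod (w - z) < d -> u w < u z + eps) ->
  exists z, Rabs (Re z) <= r /\ Rabs (Im z) <= r /\
    forall w, Rabs (Re w) <= r -> Rabs (Im w) <= r -> u w <= u z.
Proof.
  intros Hr Hu; apply NNPP; intros Hno.
  set (Q := fun z : C => Rabs (Re z) <= r /\ Rabs (Im z) <= r).
  destruct (square_compact_induction r
    (fun S => exists v, Q v /\ forall z, S z -> u z < u v)) as [v [Hv H]]; auto.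
  - intros S T HST [v [Hv H]]; exists v; auto.
  - intros S T [v [Hv H1]] [w [Hw H2]].
    destruct (Rle_dec (u v) (u w)); [exists w | exists v]; (split; [assumption|]);
      intros z [Hz|Hz]; try specialize (H1 z Hz); try specialize (H2 z Hz); lra.
  - intros z [Hz1 Hz2].
    assert (Hlarger : exists w, Q w /\ u z < u w).
    { apply NNPP; intros H; apply Hno; exists z; repeat split; auto.
      intros w H3 H4; apply Rnot_lt_le; intros H5; apply H; exists w; split; [split|]; auto. }
    destruct Hlarger as [v [Hv Hzv]].
    destruct (Hu z Hz1 Hz2 (u v - u z)) as [d [Hd H]]; [lra|].
    exists d; split; [exact Hd|]; exists v; split; [exact Hv|].
    intros w [_ Hw]; specialize (H w Hw); lra.
  - specialize (H v Hv); lra.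
Qed.

(** * Goursat's lemma on rectangles *)

(** The imaginary part of the integral of [f dz] around the boundary of
    [[a, b] x [c, d]]; for the mean value property this half is enough. *)
Definition rectangle_integral (f : C -> C) (a b c d : R) : R :=
  RInt (fun y => Re (f (b, y))) c d - RInt (fun y => Re (f (a, y))) c d
  + RInt (fun x => Im (f (x, c))) a b - RInt (fun x => Im (f (x, d))) a b.

Definition continuous_on_rectangle (f : C -> C) (a b c d : R) : Prop :=
  forall x y, a <= x <= b -> c <= y <= d -> complex_continuous f (x, y).

Lemma ex_RInt_vertical (f : C -> C) (a b c d x : R) :
  continuous_on_rectangle f a b c d -> a <= x <= b -> c <= d ->
  ex_RInt (fun y => Re (f (x, y))) c d.
Proof.
  intros Hf Hx Hcd; apply (ex_RInt_continuous (V := R_CompleteNormedModule)).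
  rewrite Rmin_left, Rmax_right by assumption; intros y Hy.
  apply (continuous_along_path f (fun _ => x) (fun y => y)); [reg | reg | apply Hf; assumption].
Qed.

Lemma ex_RInt_horizontal (f : C -> C) (a b c d y : R) :
  continuous_on_rectangle f a b c d -> c <= y <= d -> a <= b ->
  ex_RInt (fun x => Im (f (x, y))) a b.
Proof.
  intros Hf Hy Hab; apply (ex_RInt_continuous (V := R_CompleteNormedModule)).
  rewrite Rmin_left, Rmax_right by assumption; intros x Hx.
  apply (continuous_along_path f (fun x => x) (fun _ => y)); [reg | reg | apply Hf; assumption].
Qed.

Lemma RInt_Chasles_R (u : R -> R) (a m b : R) :
  ex_RInt u a m -> ex_RInt u m b -> RInt u a b = RInt u a m + RInt u m b.
Proof. intros H1 H2; symmetry; apply (RInt_Chasles u a m b H1 H2). Qed.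

Lemma rectangle_integral_split_x (f : C -> C) (a m b c d : R) :
  continuous_on_rectangle f a b c d -> a <= m <= b -> c <= d ->
  rectangle_integral f a b c d
  = rectangle_integral f a m c d + rectangle_integral f m b c d.
Proof.
  intros Hf Hm Hcd.
  assert (H1 : continuous_on_rectangle f a m c d) by (intros x y Hx Hy; apply Hf; lra).
  assert (H2 : continuous_on_rectangle f m b c d) by (intros x y Hx Hy; apply Hf; lra).
  unfold rectangle_integral.
  rewrite (RInt_Chasles_R (fun x => Im (f (x, c))) a m b);
    [| eapply (ex_RInt_horizontal f a m c d) | eapply (ex_RInt_horizontal f m b c d)];
    try lra; auto.
  rewrite (RInt_Chasles_R (fun x => Im (f (x, d))) a m b);
    [| eapply (ex_RInt_horizontal f a m c d) | eapply (ex_RInt_horizontal f m b c d)];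
    try lra; auto.
Qed.

Lemma rectangle_integral_split_y (f : C -> C) (a b c m d : R) :
  continuous_on_rectangle f a b c d -> c <= m <= d -> a <= b ->
  rectangle_integral f a b c d
  = rectangle_integral f a b c m + rectangle_integral f a b m d.
Proof.
  intros Hf Hm Hab.
  assert (H1 : continuous_on_rectangle f a b c m) by (intros x y Hx Hy; apply Hf; lra).
  assert (H2 : continuous_on_rectangle f a b m d) by (intros x y Hx Hy; apply Hf; lra).
  unfold rectangle_integral.
  rewrite (RInt_Chasles_R (fun y => Re (f (a, y))) c m d);
    [| eapply (ex_RInt_vertical f a b c m) | eapply (ex_RInt_vertical f a b m d)];
    try lra; auto.
  rewrite (RInt_Chasles_R (fun y => Re (f (b, y))) c m d);
    [| eapply (ex_RInt_vertical f a b c m) | eapply (ex_RInt_vertical f a b m d)];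
    try lra; auto.
Qed.

Lemma is_RInt_affine (p q a b : R) :
  is_RInt (fun t => p + q * t) a b (p * (b - a) + q * (b ^ 2 - a ^ 2) / 2).
Proof.
  replace (p * (b - a) + q * (b ^ 2 - a ^ 2) / 2)
    with (minus (p * b + q * b ^ 2 / 2) (p * a + q * a ^ 2 / 2))
    by (unfold minus, plus, opp; simpl; field).
  apply (is_RInt_derive (fun t => p * t + q * t ^ 2 / 2) (fun t => p + q * t)).
  - intros t _; auto_derive; [exact I | field].
  - intros t _; apply (ex_derive_continuous (K := R_AbsRing) (V := R_NormedModule));
      auto_derive; exact I.
Qed.

Lemma is_RInt_minus_R (u v : R -> R) (a b I J : R) :
  is_RInt u a b I -> is_RInt v a b J -> is_RInt (fun t => u t - v t) a b (I - J).
Proof. intros Hu Hv; exact (is_RInt_minus u v a b I J Hu Hv). Qed.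

Lemma is_RInt_const_R (c a b : R) : is_RInt (fun _ => c) a b ((b - a) * c).
Proof. exact (is_RInt_const a b c). Qed.

(** Subtracting the affine part of [f], whose integral vanishes, leaves an
    integrand that is small compared with the size of the rectangle. *)
Lemma rectangle_integral_near_affine (f : C -> C) (z0 l : C) (eps a b c d : R) :
  continuous_on_rectangle f a b c d -> a <= b -> c <= d -> 0 <= eps ->
  a <= Re z0 <= b -> c <= Im z0 <= d ->
  (forall x y, a <= x <= b -> c <= y <= d ->
     Cmod (f (x, y) - f z0 - l * ((x, y) - z0)) <= eps * Cmod ((x, y) - z0)) ->
  Rabs (rectangle_integral f a b c d) <= 2 * eps * (b - a + (d - c)) ^ 2.
Proof.
  intros Hf Hab Hcd Heps Hx0 Hy0 Hd.
  set (S := b - a + (d - c)).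
  assert (HE : forall x y, a <= x <= b -> c <= y <= d ->
     Cmod (f (x, y) - f z0 - l * ((x, y) - z0)) <= eps * S).
  { intros x y Hx Hy; eapply Rle_trans; [apply Hd; assumption|].
    apply Rmult_le_compat_l; [exact Heps|].
    eapply Rle_trans; [apply Cmod_le_sum|].
    change (Rabs (x - Re z0) + Rabs (y - Im z0) <= S).
    assert (Rabs (x - Re z0) <= b - a) by (apply Rabs_le; lra).
    assert (Rabs (y - Im z0) <= d - c) by (apply Rabs_le; lra).
    unfold S; lra. }
  assert (Hv : forall x, a <= x <= b ->
    Rabs (RInt (fun y => Re (f (x, y))) c d
      - ((Re (f z0) + Re l * (x - Re z0) + Im l * Im z0) * (d - c)
         + - Im l * (d ^ 2 - c ^ 2) / 2)) <= (d - c) * (eps * S)).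
  { intros x Hx.
    pose proof (is_RInt_affine (Re (f z0) + Re l * (x - Re z0) + Im l * Im z0) (- Im l) c d) as HA.
    pose proof (RInt_correct _ _ _ (ex_RInt_vertical f a b c d x Hf Hx Hcd)) as HF.
    pose proof (is_RInt_minus_R _ _ _ _ _ _ HF HA) as HM.
    rewrite <- (is_RInt_unique _ _ _ _ HM).
    apply abs_RInt_le_const; [exact Hcd | eexists; exact HM|].
    intros y Hy; eapply Rle_trans; [|apply (HE x y Hx Hy)].
    eapply Rle_trans; [|apply re_le_Cmod].
    apply Req_le; f_equal.
    change (Re (f (x, y)) - (Re (f z0) + Re l * (x - Re z0) + Im l * Im z0 + - Im l * y)
      = Re (f (x, y)) + - Re (f z0) + - (Re l * (x + - Re z0) - Im l * (y + - Im z0))); ring. }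
  assert (Hh : forall y, c <= y <= d ->
    Rabs (RInt (fun x => Im (f (x, y))) a b
      - ((Im (f z0) + Re l * (y - Im z0) - Im l * Re z0) * (b - a)
         + Im l * (b ^ 2 - a ^ 2) / 2)) <= (b - a) * (eps * S)).
  { intros y Hy.
    pose proof (is_RInt_affine (Im (f z0) + Re l * (y - Im z0) - Im l * Re z0) (Im l) a b) as HA.
    pose proof (RInt_correct _ _ _ (ex_RInt_horizontal f a b c d y Hf Hy Hab)) as HF.
    pose proof (is_RInt_minus_R _ _ _ _ _ _ HF HA) as HM.
    rewrite <- (is_RInt_unique _ _ _ _ HM).
    apply abs_RInt_le_const; [exact Hab | eexists; exact HM|].
    intros x Hx; eapply Rle_trans; [|apply (HE x y Hx Hy)].
    eapply Rle_trans; [|apply im_le_Cmod].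
    apply Req_le; f_equal.
    change (Im (f (x, y)) - (Im (f z0) + Re l * (y - Im z0) - Im l * Re z0 + Im l * x)
      = Im (f (x, y)) + - Im (f z0) + - (Re l * (y + - Im z0) + Im l * (x + - Re z0))); ring. }
  pose proof (Hv a ltac:(lra)) as V1; pose proof (Hv b ltac:(lra)) as V2.
  pose proof (Hh c ltac:(lra)) as V3; pose proof (Hh d ltac:(lra)) as V4.
  apply Rabs_le_between in V1; apply Rabs_le_between in V2.
  apply Rabs_le_between in V3; apply Rabs_le_between in V4.
  assert (HS : 2 * eps * S ^ 2 = 2 * ((b - a) * (eps * S)) + 2 * ((d - c) * (eps * S)))
    by (unfold S; ring).
  apply Rabs_le; unfold rectangle_integral; rewrite HS; split; nra.
Qed.

Lemma Rabs_le_all_eps (x K : R) : (forall eps, 0 < eps -> Rabs x <= K * eps) -> x = 0.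
Proof.
  intros H; apply NNPP; intros Hx; apply Rabs_pos_lt in Hx.
  assert (HK : 0 < Rabs K + 1) by (pose proof (Rabs_pos K); lra).
  specialize (H (Rabs x / (2 * (Rabs K + 1))) ltac:(apply Rdiv_lt_0_compat; lra)).
  assert (K * (Rabs x / (2 * (Rabs K + 1))) <= (Rabs K + 1) * (Rabs x / (2 * (Rabs K + 1)))).
  { apply Rmult_le_compat_r; [apply Rdiv_le_0_compat; lra | pose proof (Rle_abs K); lra]. }
  replace ((Rabs K + 1) * (Rabs x / (2 * (Rabs K + 1)))) with (Rabs x / 2) in H0 by (field; lra).
  lra.
Qed.

(** Differentiability at a point bounds the integral over small rectangles around
    it by [eps] times their squared size, and such bounds add up under quartering. *)
Theorem goursat_rectangle (f : C -> C) (a b c d : R) :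
  a <= b -> c <= d ->
  (forall x y, a <= x <= b -> c <= y <= d -> exists l, complex_derivative f (x, y) l) ->
  rectangle_integral f a b c d = 0.
Proof.
  intros Hab Hcd Hf.
  assert (Hc : continuous_on_rectangle f a b c d).
  { intros x y Hx Hy; destruct (Hf x y Hx Hy) as [l Hl].
    apply (complex_derivative_continuous _ _ _ Hl). }
  set (L := b - a); set (M := d - c).
  assert (HL : 0 <= L) by (unfold L; lra); assert (HM : 0 <= M) by (unfold M; lra).
  assert (Hpos : forall K n, 0 <= K -> 0 <= K / 2 ^ n).
  { intros K n HK; apply Rdiv_le_0_compat; [exact HK | apply pow_lt; lra]. }
  assert (Hhalf : forall K n, K / 2 ^ n = 2 * (K / 2 ^ S n)).
  { intros K n; simpl; field; apply pow_nonzero; lra. }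
  assert (Hsmall : forall eps, 0 < eps ->
            Rabs (rectangle_integral f a b c d) <= 2 * eps * (L + M) ^ 2).
  { intros eps Heps.
    set (G := fun (n : nat) x y =>
      a <= x -> x + L / 2 ^ n <= a + L -> c <= y -> y + M / 2 ^ n <= c + M ->
      Rabs (rectangle_integral f x (x + L / 2 ^ n) y (y + M / 2 ^ n))
        <= 2 * eps * (L / 2 ^ n + M / 2 ^ n) ^ 2).
    assert (HG : G 0%nat a c).
    { apply (quartering_induction a c L M); auto.
      - intros n x y H1 H2 H3 H4 Hx1 Hx2 Hy1 Hy2.
        unfold G in H1, H2, H3, H4; rewrite !(Hhalf _ n) in *.
        set (p := L / 2 ^ S n) in *; set (q := M / 2 ^ S n) in *.
        assert (Hp : 0 <= p) by (apply Hpos; exact HL).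
        assert (Hq : 0 <= q) by (apply Hpos; exact HM).
        assert (Hcn : continuous_on_rectangle f x (x + 2 * p) y (y + 2 * q)).
        { intros s t Hs Ht; apply Hc; unfold L, M in *; lra. }
        rewrite (rectangle_integral_split_x f x (x + p) (x + 2 * p)) by (auto; lra).
        rewrite (rectangle_integral_split_y f x (x + p) y (y + q) (y + 2 * q)),
                (rectangle_integral_split_y f (x + p) (x + 2 * p) y (y + q) (y + 2 * q)); try lra;
          try (intros s t Hs Ht; apply Hcn; lra).
        replace (x + 2 * p) with (x + p + p) by ring.
        replace (y + 2 * q) with (y + q + q) by ring.
        assert (B1 := H1 ltac:(lra) ltac:(lra) ltac:(lra) ltac:(lra)).
        assert (B2 := H2 ltac:(lra) ltac:(lra) ltac:(lra) ltac:(lra)).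
        assert (B3 := H3 ltac:(lra) ltac:(lra) ltac:(lra) ltac:(lra)).
        assert (B4 := H4 ltac:(lra) ltac:(lra) ltac:(lra) ltac:(lra)).
        replace (2 * eps * (2 * p + 2 * q) ^ 2) with (4 * (2 * eps * (p + q) ^ 2)) by ring.
        apply Rabs_le_between in B1; apply Rabs_le_between in B2.
        apply Rabs_le_between in B3; apply Rabs_le_between in B4.
        apply Rabs_le; lra.
      - intros x y Hx Hy.
        destruct (Hf x y) as [l Hl]; [unfold L in *; lra | unfold M in *; lra|].
        destruct (Hl eps Heps) as [e [He0 He]].
        exists (e / 2); split; [lra|].
        intros n x' y' Hx1 Hx2 Hy1 Hy2 Hx3 Hy3 Hs1 Hs2 _ _ _ _.
        specialize (Hpos L n HL) as HpL; specialize (Hpos M n HM) as HpM.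
        replace (L / 2 ^ n + M / 2 ^ n)
          with (x' + L / 2 ^ n - x' + (y' + M / 2 ^ n - y')) by ring.
        apply (rectangle_integral_near_affine f (x, y) l); simpl; try lra.
        + intros s t Hs Ht; apply Hc; unfold L, M in *; lra.
        + intros s t Hs Ht; apply He.
          eapply Rle_lt_trans; [apply Cmod_le_sum|].
          change (Rabs (s - x) + Rabs (t - y) < e).
          assert (Rabs (s - x) <= L / 2 ^ n) by (apply Rabs_le; lra).
          assert (Rabs (t - y) <= M / 2 ^ n) by (apply Rabs_le; lra).
          lra. }
    unfold G in HG; simpl in HG; rewrite !Rdiv_1_r in HG.
    replace (a + L) with b in HG by (unfold L; ring).
    replace (c + M) with d in HG by (unfold M; ring).
    apply HG; lra. }
  apply (Rabs_le_all_eps _ (2 * (L + M) ^ 2)); intros eps Heps.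
  specialize (Hsmall eps Heps); lra.
Qed.

(** * The mean value property and the maximum principle *)

Lemma differentiable_pt_lim_partials (u ux : R -> R -> R) (x y uy : R) :
  locally_2d (fun s t => is_derive (fun s' => u s' t) s (ux s t)) x y ->
  is_derive (fun t => u x t) y uy -> continuity_2d_pt ux x y ->
  differentiable_pt_lim u x y (ux x y) uy.
Proof.
  intros Hx Hy Hc; apply filterdiff_differentiable_pt_lim.
  apply (is_derive_filterdiff u x y ux uy).
  - apply locally_2d_locally in Hx; exact Hx.
  - exact Hy.
  - apply continuity_2d_pt_filterlim; exact Hc.
Qed.

Lemma cauchy_riemann_complex_derivative (u v : R -> R -> R) (x y p q : R) :
  differentiable_pt_lim u x y p (- q) -> differentiable_pt_lim v x y q p ->
  complex_derivative (fun z => (u (Re z) (Im z), v (Re z) (Im z))) (x, y) (p, q).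
Proof.
  intros Hu Hv eps He.
  assert (He2 : 0 < eps / 2) by lra.
  destruct (Hu (mkposreal _ He2)) as [d1 H1]; destruct (Hv (mkposreal _ He2)) as [d2 H2].
  exists (Rmin d1 d2); split; [apply Rmin_glb_lt; apply cond_pos|].
  intros [s t] Hw.
  assert (Hw1 : Cmod ((s, t) - (x, y)) < d1) by (eapply Rlt_le_trans; [exact Hw | apply Rmin_l]).
  assert (Hw2 : Cmod ((s, t) - (x, y)) < d2) by (eapply Rlt_le_trans; [exact Hw | apply Rmin_r]).
  set (m := Cmod ((s, t) - (x, y))) in *.
  assert (Hs : Rabs (s - x) <= m) by apply (re_le_Cmod ((s, t) - (x, y))).
  assert (Ht : Rabs (t - y) <= m) by apply (im_le_Cmod ((s, t) - (x, y))).
  assert (Hm : Rmax (Rabs (s - x)) (Rabs (t - y)) <= m) by (apply Rmax_lub; assumption).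
  specialize (H1 s t ltac:(lra) ltac:(lra)); specialize (H2 s t ltac:(lra) ltac:(lra)).
  simpl in H1, H2.
  eapply Rle_trans; [apply Cmod_le_sum|].
  replace (Re ((fun z : C => (u (Re z) (Im z), v (Re z) (Im z))) (s, t) -
     (fun z : C => (u (Re z) (Im z), v (Re z) (Im z))) (x, y) - (p, q) * ((s, t) - (x, y))))
    with (u s t - u x y - (p * (s - x) + - q * (t - y)))
    by (simpl; ring).
  replace (Im ((fun z : C => (u (Re z) (Im z), v (Re z) (Im z))) (s, t) -
     (fun z : C => (u (Re z) (Im z), v (Re z) (Im z))) (x, y) - (p, q) * ((s, t) - (x, y))))
    with (v s t - v x y - (q * (s - x) + p * (t - y)))
    by (simpl; ring).
  assert (eps / 2 * Rmax (Rabs (s - x)) (Rabs (t - y)) <= eps / 2 * m)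
    by (apply Rmult_le_compat_l; lra).
  lra.
Qed.

Lemma continuity_2d_pt_fst (u : R -> R) (x y : R) :
  continuity_pt u x -> continuity_2d_pt (fun s _ => u s) x y.
Proof.
  intros H; apply (continuity_1d_2d_pt_comp u (fun s _ => s)); [exact H | apply continuity_2d_pt_id1].
Qed.

Lemma continuity_2d_pt_snd (u : R -> R) (x y : R) :
  continuity_pt u y -> continuity_2d_pt (fun _ t => u t) x y.
Proof.
  intros H; apply (continuity_1d_2d_pt_comp u (fun _ t => t)); [exact H | apply continuity_2d_pt_id2].
Qed.

Definition complex_exp (z : C) : C := (exp (Re z) * cos (Im z), exp (Re z) * sin (Im z)).

Lemma complex_derivative_exp (z : C) : complex_derivative complex_exp z (complex_exp z).
Proof.
  destruct z as [x y].
  assert (Hexp : continuity_2d_pt (fun s _ => exp s) x y)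
    by apply continuity_2d_pt_fst, derivable_continuous_pt, derivable_pt_exp.
  assert (Hc : continuity_2d_pt (fun s t => exp s * cos t) x y).
  { apply continuity_2d_pt_mult; [exact Hexp | apply continuity_2d_pt_snd, continuity_cos]. }
  assert (Hs : continuity_2d_pt (fun s t => exp s * sin t) x y).
  { apply continuity_2d_pt_mult; [exact Hexp | apply continuity_2d_pt_snd, continuity_sin]. }
  apply (cauchy_riemann_complex_derivative
    (fun s t => exp s * cos t) (fun s t => exp s * sin t)).
  - apply (differentiable_pt_lim_partials _ (fun s t => exp s * cos t)); [| |exact Hc].
    + exists posreal_one; intros s t _ _; auto_derive; [exact I | ring].
    + simpl; auto_derive; [exact I | ring].
  - apply (differentiable_pt_lim_partials _ (fun s t => exp s * sin t)); [| |exact Hs].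
    + exists posreal_one; intros s t _ _; auto_derive; [exact I | ring].
    + simpl; auto_derive; [exact I | ring].
Qed.

Definition circle (z0 : C) (r t : R) : C := (Re z0 + r * cos t, Im z0 + r * sin t).

Lemma Cmod_circle (z0 : C) (r t : R) : 0 <= r -> Cmod (circle z0 r t - z0) = r.
Proof.
  intros Hr.
  assert (H : Cmod (circle z0 r t - z0) ^ 2 = r ^ 2).
  { rewrite Cmod_sq.
    change ((Re z0 + r * cos t - Re z0) ^ 2 + (Im z0 + r * sin t - Im z0) ^ 2 = r ^ 2).
    pose proof (sin2_cos2 t) as H; unfold Rsqr in H.
    transitivity (r ^ 2 * (sin t * sin t + cos t * cos t)); [ring | rewrite H; ring]. }
  pose proof (Cmod_ge_0 (circle z0 r t - z0)); nra.
Qed.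

Lemma continuous_along_circle (f : C -> C) (z0 : C) (r t : R) :
  complex_continuous f (circle z0 r t) -> continuous (fun s => Re (f (circle z0 r s))) t.
Proof.
  intros Hf; apply (continuous_along_path f (fun s => Re z0 + r * cos s)
    (fun s => Im z0 + r * sin s)); [reg | reg | exact Hf].
Qed.

Lemma ex_RInt_circle (f : C -> C) (z0 : C) (r : R) :
  0 <= r -> (forall w, Cmod (w - z0) = r -> complex_continuous f w) ->
  ex_RInt (fun t => Re (f (circle z0 r t))) 0 (2 * PI).
Proof.
  intros Hr Hf; apply (ex_RInt_continuous (V := R_CompleteNormedModule)); intros t _.
  apply continuous_along_circle, Hf, Cmod_circle, Hr.
Qed.

(** Goursat's lemma for [w |-> f (z0 + exp w)] on [[ln rho, ln r] x [0, 2 PI]]: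
    the horizontal sides cancel by periodicity, so the circle means of radii
    [rho] and [r] agree.  The centre is never touched, which is why mere
    continuity of [f] there suffices to let [rho] tend to [0]. *)
Lemma circle_mean_independent_of_radius (f : C -> C) (z0 : C) (rho r : R) :
  0 < rho <= r ->
  (forall w, 0 < Cmod (w - z0) <= r -> exists l, complex_derivative f w l) ->
  RInt (fun t => Re (f (circle z0 rho t))) 0 (2 * PI)
  = RInt (fun t => Re (f (circle z0 r t))) 0 (2 * PI).
Proof.
  intros Hrho Hf.
  pose proof PI_RGT_0 as Hpi.
  assert (Hln : ln rho <= ln r) by (apply ln_le; lra).
  assert (Hexp : forall x y, (z0 + complex_exp (x, y))%C = circle z0 (exp x) y).
  { intros x y; reflexivity. }
  set (F := fun w => f (z0 + complex_exp w)%C).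
  assert (HG : rectangle_integral F (ln rho) (ln r) 0 (2 * PI) = 0).
  { apply goursat_rectangle; [exact Hln | lra|].
    intros x y Hx _; destruct (Hf (z0 + complex_exp (x, y))%C) as [l Hl].
    - rewrite Hexp, Cmod_circle by (apply Rlt_le, exp_pos).
      split; [apply exp_pos|]; rewrite <- (exp_ln r) by lra.
      destruct (Rle_lt_or_eq_dec x (ln r)) as [Hlt| ->]; [lra | | lra].
      apply Rlt_le, exp_increasing, Hlt.
    - exists (l * (0 + complex_exp (x, y)))%C.
      apply (complex_derivative_comp (fun w => z0 + complex_exp w)%C f); [|exact Hl].
      apply complex_derivative_plus; [apply complex_derivative_const | apply complex_derivative_exp]. }
  unfold rectangle_integral in HG.
  assert (Hper : RInt (fun x => Im (F (x, 2 * PI))) (ln rho) (ln r)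
               = RInt (fun x => Im (F (x, 0))) (ln rho) (ln r)).
  { apply RInt_ext; intros x _; unfold F, complex_exp; simpl.
    rewrite cos_2PI, sin_2PI, cos_0, sin_0; reflexivity. }
  rewrite Hper in HG.
  assert (Hvert : forall s, 0 < s -> RInt (fun y => Re (F (ln s, y))) 0 (2 * PI)
               = RInt (fun t => Re (f (circle z0 s t))) 0 (2 * PI)).
  { intros s Hs; apply RInt_ext; intros y _; unfold F.
    rewrite Hexp, exp_ln by exact Hs; reflexivity. }
  rewrite !Hvert in HG by lra.
  lra.
Qed.

Theorem mean_value_property (f : C -> C) (z0 : C) (r : R) :
  0 < r -> complex_continuous f z0 ->
  (forall w, 0 < Cmod (w - z0) <= r -> exists l, complex_derivative f w l) ->
  RInt (fun t => Re (f (circle z0 r t))) 0 (2 * PI) = 2 * PI * Re (f z0).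
Proof.
  intros Hr Hc Hf.
  pose proof PI_RGT_0 as Hpi.
  set (I := RInt (fun t => Re (f (circle z0 r t))) 0 (2 * PI)).
  assert (Hsmall : forall eps, 0 < eps -> Rabs (I - 2 * PI * Re (f z0)) <= 2 * PI * eps).
  { intros eps He; destruct (Hc eps He) as [d [Hd0 Hd]].
    set (rho := Rmin r (d / 2)).
    assert (Hrho : 0 < rho <= r) by (split; [apply Rmin_glb_lt; lra | apply Rmin_l]).
    assert (Hrd : rho < d) by (apply Rle_lt_trans with (d / 2); [apply Rmin_r | lra]).
    unfold I; rewrite <- (circle_mean_independent_of_radius f z0 rho r Hrho Hf).
    assert (Hex : ex_RInt (fun t => Re (f (circle z0 rho t))) 0 (2 * PI)).
    { apply ex_RInt_circle; [lra|]; intros w Hw.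
      destruct (Hf w) as [l Hl]; [lra|].
      apply (complex_derivative_continuous _ _ _ Hl). }
    pose proof (RInt_correct _ _ _ Hex) as H1.
    pose proof (is_RInt_const_R (Re (f z0)) 0 (2 * PI)) as H2.
    pose proof (is_RInt_minus_R _ _ _ _ _ _ H1 H2) as H3.
    rewrite Rminus_0_r in H3.
    rewrite <- (is_RInt_unique _ _ _ _ H3).
    replace (2 * PI * eps) with ((2 * PI - 0) * eps) by ring.
    apply abs_RInt_le_const; [lra | eexists; exact H3|].
    intros t _.
    eapply Rle_trans; [apply (re_le_Cmod (f (circle z0 rho t) - f z0))|].
    apply Rlt_le, Hd; rewrite Cmod_circle; lra. }
  apply Rminus_diag_uniq, (Rabs_le_all_eps _ (2 * PI)), Hsmall.
Qed.

Lemma Re_conj_mult (z w : C) : Re (Cconj z * w) = Re z * Re w + Im z * Im w.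
Proof.
  change (Re z * Re w - - Im z * Im w = Re z * Re w + Im z * Im w); ring.
Qed.

Lemma Re_conj_mult_le (z w : C) : Re (Cconj z * w) <= Cmod z * Cmod w.
Proof.
  eapply Rle_trans; [apply Rle_abs|].
  eapply Rle_trans; [apply re_le_Cmod|].
  rewrite Cmod_mult, Cmod_conj; lra.
Qed.

(** The mean value property of [conj (f z0) * f], in the form used below: an
    upper bound for its real part on a circle, averaged, bounds [|f z0| ^ 2]. *)
Lemma mean_value_upper_bound (f : C -> C) (z0 : C) (r : R) (b : R -> R) (B : R) :
  0 < r -> complex_continuous f z0 ->
  (forall w, 0 < Cmod (w - z0) <= r -> exists l, complex_derivative f w l) ->
  (forall t, 0 <= t <= 2 * PI -> Re (Cconj (f z0) * f (circle z0 r t)) <= b t) ->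
  is_RInt b 0 (2 * PI) B ->
  2 * PI * Cmod (f z0) ^ 2 <= B.
Proof.
  intros Hr Hc Hf Hb HB.
  pose proof PI_RGT_0 as Hpi.
  set (g := fun w => (Cconj (f z0) * f w)%C).
  assert (Hg : forall w, 0 < Cmod (w - z0) <= r -> exists l, complex_derivative g w l).
  { intros w Hw; destruct (Hf w Hw) as [l Hl]; eexists.
    apply complex_derivative_mult; [apply complex_derivative_const | exact Hl]. }
  assert (Hgc : complex_continuous g z0).
  { apply (complex_continuous_comp f (fun z => (Cconj (f z0) * z)%C)); [exact Hc|].
    eapply complex_derivative_continuous.
    apply complex_derivative_mult; [apply complex_derivative_const | apply complex_derivative_id]. }
  pose proof (mean_value_property g z0 r Hr Hgc Hg) as HM.
  replace (Cmod (f z0) ^ 2) with (Re (g z0)).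
  2:{ unfold g; rewrite Re_conj_mult, Cmod_sq; ring. }
  rewrite <- HM, <- (is_RInt_unique _ _ _ _ HB).
  apply RInt_le; [lra | | eexists; exact HB | intros t Ht; apply Hb; lra].
  apply ex_RInt_circle; [lra|]; intros w Hw.
  destruct (Hg w) as [l Hl]; [lra|]; apply (complex_derivative_continuous _ _ _ Hl).
Qed.

Lemma maximum_principle_disc (f : C -> C) (z0 : C) (r B : R) :
  0 < r -> 0 <= B ->
  (forall w, Cmod (w - z0) <= r -> exists l, complex_derivative f w l) ->
  (forall t, 0 <= t <= 2 * PI -> Cmod (f (circle z0 r t)) <= B) ->
  Cmod (f z0) <= B.
Proof.
  intros Hr HB Hf Hb.
  pose proof PI_RGT_0 as Hpi.
  assert (H : 2 * PI * Cmod (f z0) ^ 2 <= 2 * PI * (Cmod (f z0) * B)).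
  { apply (mean_value_upper_bound f z0 r (fun _ => Cmod (f z0) * B)).
    - exact Hr.
    - destruct (Hf z0) as [l Hl].
      + replace (z0 - z0)%C with (RtoC 0) by ring; rewrite Cmod_0; lra.
      + apply (complex_derivative_continuous _ _ _ Hl).
    - intros w Hw; apply Hf; lra.
    - intros t Ht; eapply Rle_trans; [apply Re_conj_mult_le|].
      apply Rmult_le_compat_l; [apply Cmod_ge_0 | apply Hb, Ht].
    - replace (2 * PI * (Cmod (f z0) * B)) with ((2 * PI - 0) * (Cmod (f z0) * B)) by ring.
      apply is_RInt_const_R. }
  apply Rmult_le_reg_l in H; [|lra].
  pose proof (Cmod_ge_0 (f z0)).
  destruct (Rle_dec (Cmod (f z0)) B); [assumption | nra].
Qed.

Lemma square_iff (z : C) : square z <-> -1 < Re z < 1 /\ -1 < Im z < 1.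
Proof.
  unfold square; split; intros [H1 H2].
  - apply Rabs_lt_between in H1; apply Rabs_lt_between in H2; lra.
  - split; apply Rabs_lt_between; lra.
Qed.

Lemma square_ball (z : C) : square z ->
  exists d s, 0 < d /\ s < 1 /\
    forall w, Cmod (w - z) <= d -> Rabs (Re w) <= s /\ Rabs (Im w) <= s.
Proof.
  intros [H1 H2]; set (m := Rmin (1 - Rabs (Re z)) (1 - Rabs (Im z))).
  assert (Hm : 0 < m) by (apply Rmin_glb_lt; lra).
  assert (m <= 1 - Rabs (Re z)) by apply Rmin_l; assert (m <= 1 - Rabs (Im z)) by apply Rmin_r.
  exists (m / 2), (1 - m / 2); split; [lra|]; split; [lra|]; intros w Hw.
  pose proof (re_le_Cmod (w - z)) as Hr; pose proof (im_le_Cmod (w - z)) as Hi.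
  change (Rabs (Re w - Re z) <= Cmod (w - z)) in Hr.
  change (Rabs (Im w - Im z) <= Cmod (w - z)) in Hi.
  pose proof (Rabs_triang_inv (Re w) (Re z)); pose proof (Rabs_triang_inv (Im w) (Im z)); lra.
Qed.

Lemma square_open (z : C) :
  square z -> exists d, 0 < d /\ forall w, Cmod (w - z) <= d -> square w.
Proof.
  intros Hz; destruct (square_ball z Hz) as [d [s [Hd [Hs H]]]].
  exists d; split; [exact Hd|]; intros w Hw; specialize (H w Hw); split; lra.
Qed.

(** If [|Q|] exceeded [1] somewhere, then for small [eta] the function
    [|Q z| ^ 2 + eta |z| ^ 2] would have an interior maximum; but its mean over
    small circles exceeds its value at the centre by at least [eta r ^ 2].
    Isolated points where only continuity is known do no harm. *)
Theorem maximum_principle_square (Q : C -> C) :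
  (forall z, square z -> complex_continuous Q z /\
     exists r, 0 < r /\ forall w, 0 < Cmod (w - z) < r -> exists l, complex_derivative Q w l) ->
  (forall B, 1 < B -> exists s, s < 1 /\ forall z, square z ->
     s < Rabs (Re z) \/ s < Rabs (Im z) -> Cmod (Q z) <= B) ->
  forall z, square z -> Cmod (Q z) <= 1.
Proof.
  intros HQ Hbd z1 Hz1; apply Rnot_lt_le; intros Hgt.
  pose proof PI_RGT_0 as Hpi.
  set (M := Cmod (Q z1) ^ 2).
  assert (HM : 1 < M) by (unfold M; nra).
  set (eta := (M - 1) / 4).
  assert (Heta : 0 < eta) by (unfold eta; lra).
  set (u := fun z => Cmod (Q z) ^ 2 + eta * Cmod z ^ 2).
  assert (HB : 1 < sqrt ((M + 1) / 2)) by (rewrite <- sqrt_1 at 1; apply sqrt_lt_1; lra).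
  destruct (Hbd _ HB) as [s [Hs Hout]].
  assert (Hout' : forall z, square z -> s < Rabs (Re z) \/ s < Rabs (Im z) -> u z < u z1).
  { intros z Hz Ho; specialize (Hout z Hz Ho).
    assert (H1 : Cmod (Q z) ^ 2 <= (M + 1) / 2).
    { rewrite <- (pow2_sqrt ((M + 1) / 2)) by lra.
      apply pow_incr; split; [apply Cmod_ge_0 | exact Hout]. }
    assert (H2 : Cmod z ^ 2 < 2).
    { rewrite Cmod_sq; destruct Hz as [Ha Hb].
      rewrite <- (pow2_abs (Re z)), <- (pow2_abs (Im z)).
      pose proof (Rabs_pos (Re z)); pose proof (Rabs_pos (Im z)); nra. }
    assert (0 <= Cmod z1 ^ 2) by apply pow2_ge_0.
    unfold u; fold M; unfold eta in *; nra. }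
  assert (Hin1 : Rabs (Re z1) <= s /\ Rabs (Im z1) <= s).
  { split; apply Rnot_lt_le; intros Hc.
    - specialize (Hout' z1 Hz1 (or_introl Hc)); lra.
    - specialize (Hout' z1 Hz1 (or_intror Hc)); lra. }
  assert (Hs0 : 0 <= s) by (pose proof (Rabs_pos (Re z1)); lra).
  destruct (continuous_max_on_square s u Hs0) as [z0 [Hr0 [Hi0 Hmax]]].
  { intros z Hr Hi eps He.
    destruct (HQ z) as [Hc _]; [split; lra|].
    assert (Hsq : forall f, complex_continuous f z -> forall e, 0 < e -> exists d, 0 < d /\
              forall w, Cmod (w - z) < d -> Cmod (f w) ^ 2 < Cmod (f z) ^ 2 + e).
    { intros f Hf e He'.
      destruct (complex_continuous_Cmod _ z e (complex_continuous_mult f f z Hf Hf) He')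
        as [d [Hd0 Hd]].
      exists d; split; [exact Hd0|]; intros w Hw; specialize (Hd w Hw).
      rewrite !Cmod_mult in Hd; apply Rabs_lt_between in Hd; lra. }
    destruct (Hsq Q Hc (eps / 2)) as [d1 [Hd1 H1]]; [lra|].
    destruct (Hsq (fun w => w) (complex_derivative_continuous _ _ _ (complex_derivative_id z))
      (eps / (2 * eta))) as [d2 [Hd2 H2]]; [apply Rdiv_lt_0_compat; lra|].
    exists (Rmin d1 d2); split; [apply Rmin_glb_lt; lra|].
    intros w Hw; destruct (Rlt_Rmin _ _ _ Hw) as [Hw1 Hw2].
    specialize (H1 w Hw1); specialize (H2 w Hw2).
    apply Rmult_lt_compat_l with (r := eta) in H2; [|exact Heta].
    replace (eta * (Cmod z ^ 2 + eps / (2 * eta))) with (eta * Cmod z ^ 2 + eps / 2) in H2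
      by (field; lra).
    unfold u; lra. }
  assert (Hz0 : square z0) by (split; lra).
  assert (Hglob : forall z, square z -> u z <= u z0).
  { intros z Hz.
    destruct (Rlt_dec s (Rabs (Re z))) as [H|H].
    - pose proof (Hout' z Hz (or_introl H)).
      pose proof (Hmax z1 (proj1 Hin1) (proj2 Hin1)); lra.
    - destruct (Rlt_dec s (Rabs (Im z))) as [H'|H'].
      + pose proof (Hout' z Hz (or_intror H')).
        pose proof (Hmax z1 (proj1 Hin1) (proj2 Hin1)); lra.
      + apply Hmax; lra. }
  destruct (HQ z0 Hz0) as [Hc [r1 [Hr1 Hd]]].
  destruct (square_open z0 Hz0) as [r2 [Hr2 Hsq]].
  set (r := Rmin (r1 / 2) r2).
  assert (Hr : 0 < r) by (apply Rmin_glb_lt; lra).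
  assert (Hrr1 : r <= r1 / 2) by apply Rmin_l.
  assert (Hrr2 : r <= r2) by apply Rmin_r.
  set (q := Cmod (Q z0) ^ 2).
  assert (H : 2 * PI * q <= 2 * PI * (q - eta * r ^ 2 / 2)).
  { apply (mean_value_upper_bound Q z0 r
      (fun t => q - eta * r ^ 2 / 2 - eta * r * (Re z0 * cos t + Im z0 * sin t))).
    - exact Hr.
    - exact Hc.
    - intros w Hw; apply Hd; lra.
    - intros t _.
      assert (Hsqt : square (circle z0 r t)) by (apply Hsq; rewrite Cmod_circle; lra).
      specialize (Hglob _ Hsqt); unfold u in Hglob.
      assert (Hcs : Cmod (circle z0 r t) ^ 2
        = Cmod z0 ^ 2 + r ^ 2 + 2 * r * (Re z0 * cos t + Im z0 * sin t)).
      { rewrite !Cmod_sq; unfold circle; simpl Re; simpl Im.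
        pose proof (sin2_cos2 t) as Hsc; unfold Rsqr in Hsc.
        replace (r ^ 2) with (r ^ 2 * (sin t * sin t + cos t * cos t)) by (rewrite Hsc; ring).
        ring. }
      rewrite Hcs in Hglob; fold q in Hglob.
      rewrite Re_conj_mult.
      assert (Hsq2 : 2 * (Re (Q z0) * Re (Q (circle z0 r t)) + Im (Q z0) * Im (Q (circle z0 r t)))
        <= q + Cmod (Q (circle z0 r t)) ^ 2).
      { unfold q; rewrite !Cmod_sq.
        pose proof (pow2_ge_0 (Re (Q z0) - Re (Q (circle z0 r t)))).
        pose proof (pow2_ge_0 (Im (Q z0) - Im (Q (circle z0 r t)))). lra. }
      lra.
    - replace (2 * PI * (q - eta * r ^ 2 / 2)) with
        (minus ((q - eta * r ^ 2 / 2) * (2 * PI)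
                 - eta * r * (Re z0 * sin (2 * PI) - Im z0 * cos (2 * PI)))
               ((q - eta * r ^ 2 / 2) * 0
                 - eta * r * (Re z0 * sin 0 - Im z0 * cos 0))).
      2:{ rewrite sin_2PI, cos_2PI, sin_0, cos_0.
          unfold minus, plus, opp; simpl; ring. }
      apply (is_RInt_derive (fun t => (q - eta * r ^ 2 / 2) * t
        - eta * r * (Re z0 * sin t - Im z0 * cos t))).
      + intros t _; auto_derive; [exact I | field].
      + intros t _; apply (ex_derive_continuous (K := R_AbsRing) (V := R_NormedModule));
          auto_derive; exact I. }
  apply Rmult_le_reg_l in H; [|lra].
  assert (0 < eta * r ^ 2) by (apply Rmult_lt_0_compat; [lra | apply pow_lt; lra]).
  lra.
Qed.

(** * Conformal bijections of the square onto the disc *)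

(** The pseudo-hyperbolic distance, [tanh] of half the hyperbolic distance. *)
Definition disc_ratio (z w : C) : R := Cmod (z - w) / Cmod (1 - z * Cconj w).

Lemma disc_denominator_pos (z w : C) :
  Cmod z < 1 -> Cmod w < 1 -> 0 < Cmod (1 - z * Cconj w).
Proof.
  intros Hz Hw.
  pose proof (Cmod_rev_triangle 1 (z * Cconj w)) as H.
  rewrite Cmod_1, Cmod_mult, Cmod_conj in H.
  pose proof (Cmod_ge_0 z); pose proof (Cmod_ge_0 w); nra.
Qed.

Lemma disc_denominator_neq (z w : C) :
  Cmod z < 1 -> Cmod w < 1 -> (1 - z * Cconj w)%C <> 0.
Proof. intros Hz Hw; apply Cmod_gt_0, disc_denominator_pos; assumption. Qed.

Lemma disc_ratio_sym (z w : C) : disc_ratio z w = disc_ratio w z.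
Proof.
  unfold disc_ratio; rewrite (Cmod_minus_sym z w); f_equal.
  rewrite <- (Cmod_conj (1 - w * Cconj z)); f_equal.
  rewrite Cminus_conj, Cmult_conj, Cconj_conj.
  replace (Cconj 1) with (RtoC 1) by (unfold Cconj, RtoC; simpl; f_equal; ring).
  ring.
Qed.

Lemma disc_denominator_sq (z w : C) :
  Cmod (1 - z * Cconj w) ^ 2 = Cmod (z - w) ^ 2 + (1 - Cmod z ^ 2) * (1 - Cmod w ^ 2).
Proof. rewrite !Cmod_sq; destruct z as [a b], w as [c d]; simpl; ring. Qed.

Lemma disc_ratio_nonneg (z w : C) :
  Cmod z < 1 -> Cmod w < 1 -> 0 <= disc_ratio z w.
Proof.
  intros Hz Hw; apply Rdiv_le_0_compat; [apply Cmod_ge_0 | apply disc_denominator_pos; assumption].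
Qed.

Lemma disc_ratio_lt_1 (z w : C) :
  Cmod z < 1 -> Cmod w < 1 -> disc_ratio z w < 1.
Proof.
  intros Hz Hw; pose proof (disc_denominator_pos z w Hz Hw) as H.
  apply Rlt_div_l; [exact H|]; rewrite Rmult_1_l.
  pose proof (disc_denominator_sq z w) as H2.
  pose proof (Cmod_ge_0 z); pose proof (Cmod_ge_0 w); pose proof (Cmod_ge_0 (z - w)).
  assert (0 < (1 - Cmod z ^ 2) * (1 - Cmod w ^ 2)) by (apply Rmult_lt_0_compat; nra).
  nra.
Qed.

(** Properness: the preimages of the compact discs stay away from the boundary. *)
Definition exhausts_square (g : C -> C) : Prop :=
  forall rho, rho < 1 -> exists s, s < 1 /\ forall z, square z ->
    Cmod (g z) <= rho -> Rabs (Re z) <= s /\ Rabs (Im z) <= s.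

Definition holomorphic_to_disc (g : C -> C) : Prop :=
  (forall z, square z -> exists l, complex_derivative g z l) /\
  (forall z, square z -> Cmod (g z) < 1).

(** Near the boundary of the square [g] is near the unit circle, all of whose
    points are at pseudo-hyperbolic distance [1] from a fixed [w]. *)
Lemma disc_ratio_near_boundary (g : C -> C) (w : C) (B : R) :
  (forall z, square z -> Cmod (g z) < 1) -> exhausts_square g ->
  Cmod w < 1 -> 1 < B ->
  exists s, s < 1 /\ forall z, square z -> s < Rabs (Re z) \/ s < Rabs (Im z) ->
    1 <= B * disc_ratio (g z) w.
Proof.
  intros Hg Hex Hw HB.
  set (c := Cmod w) in *; pose proof (Cmod_ge_0 w) as Hc; fold c in Hc.
  set (K := (1 + c) / (1 - c)).
  assert (HK : 0 < K) by (apply Rdiv_lt_0_compat; lra).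
  set (delta := (1 - / B ^ 2) / K).
  assert (HB2 : / B ^ 2 < 1).
  { rewrite <- Rinv_1; apply Rinv_lt_contravar; nra. }
  assert (Hdelta : 0 < delta) by (apply Rdiv_lt_0_compat; lra).
  destruct (Hex (1 - delta / 2)) as [s [Hs Hin]]; [lra|].
  exists s; split; [exact Hs|]; intros z Hz Hout.
  assert (Hgz : 1 - delta / 2 < Cmod (g z)).
  { apply Rnot_le_lt; intros H; destruct (Hin z Hz H); lra. }
  pose proof (Hg z Hz) as Hg1; pose proof (Cmod_ge_0 (g z)) as Hg0.
  pose proof (disc_denominator_pos (g z) w Hg1 Hw) as HD.
  pose proof (disc_denominator_sq (g z) w) as H2.
  set (D := Cmod (1 - g z * Cconj w)) in *.
  assert (HD1 : 1 - c <= D).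
  { pose proof (Cmod_rev_triangle 1 (g z * Cconj w)) as H.
    rewrite Cmod_1, Cmod_mult, Cmod_conj in H; fold c D in H; nra. }
  fold c in H2.
  assert (Hr : disc_ratio (g z) w ^ 2 = 1 - (1 - Cmod (g z) ^ 2) * (1 - c ^ 2) / D ^ 2).
  { unfold disc_ratio; fold D; apply Rmult_eq_reg_r with (D ^ 2); [|nra].
    field_simplify; [nra | lra | lra]. }
  assert (Hq : (1 - Cmod (g z) ^ 2) * (1 - c ^ 2) / D ^ 2 <= 1 - / B ^ 2).
  { apply Rle_trans with (delta * K).
    - apply Rle_div_l; [nra|].
      apply Rle_trans with (delta * K * (1 - c) ^ 2).
      + unfold K; replace (delta * ((1 + c) / (1 - c)) * (1 - c) ^ 2)
          with (delta * (1 - c ^ 2)) by (field; lra).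
        apply Rmult_le_compat_r; nra.
      + apply Rmult_le_compat_l; [nra|]; apply pow_incr; lra.
    - right; unfold delta; field; lra. }
  assert (Hrr : / B ^ 2 <= disc_ratio (g z) w ^ 2) by lra.
  pose proof (disc_ratio_nonneg (g z) w Hg1 Hw) as Hr0.
  assert (1 <= (B * disc_ratio (g z) w) ^ 2).
  { rewrite Rpow_mult_distr; replace 1 with (B ^ 2 * / B ^ 2) by (field; lra).
    apply Rmult_le_compat_l; nra. }
  assert (0 <= B * disc_ratio (g z) w) by (apply Rmult_le_pos; lra).
  nra.
Qed.

Lemma complex_derivative_denominator (g : C -> C) (w z l : C) :
  complex_derivative g z l ->
  complex_derivative (fun x => 1 - g x * Cconj w)%C z (0 - (l * Cconj w + g z * 0)).
Proof.
  intros Hl; apply complex_derivative_minus; [apply complex_derivative_const|].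
  apply (complex_derivative_mult g (fun _ => Cconj w)); [exact Hl | apply complex_derivative_const].
Qed.

Lemma holomorphic_mobius (g : C -> C) (w z l : C) :
  complex_derivative g z l -> Cmod (g z) < 1 -> Cmod w < 1 ->
  exists k, complex_derivative (fun x => (g x - w) / (1 - g x * Cconj w))%C z k.
Proof.
  intros Hl Hz Hw.
  apply (complex_derivative_div (fun x => g x - w)%C (fun x => 1 - g x * Cconj w)%C)
    with (l := (l - 0)%C) (m := (0 - (l * Cconj w + g z * 0))%C).
  - apply complex_derivative_minus; [exact Hl | apply complex_derivative_const].
  - apply complex_derivative_denominator, Hl.
  - apply disc_denominator_neq; assumption.
Qed.

(** A missed value [w] would make [1 / Phi_w (g z)], with [Phi_w] the disc
    automorphism vanishing at [w], violate the maximum principle. *)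
Theorem exhausting_map_surjective (g : C -> C) :
  holomorphic_to_disc g -> exhausts_square g ->
  forall w, Cmod w < 1 -> exists z, square z /\ g z = w.
Proof.
  intros [Hd Hg] Hex w Hw; apply NNPP; intros Hno.
  assert (Hneq : forall z, square z -> (g z - w)%C <> 0).
  { intros z Hz H; apply Hno; exists z; split; [exact Hz|].
    replace (g z) with (g z - w + w)%C by ring; rewrite H; ring. }
  set (Q := fun z => ((1 - g z * Cconj w) / (g z - w))%C).
  assert (HQd : forall z, square z -> exists l, complex_derivative Q z l).
  { intros z Hz; destruct (Hd z Hz) as [l Hl].
    apply (complex_derivative_div (fun x => 1 - g x * Cconj w)%C (fun x => g x - w)%C)
      with (l := (0 - (l * Cconj w + g z * 0))%C) (m := (l - 0)%C).
    - apply complex_derivative_denominator, Hl.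
    - apply complex_derivative_minus; [exact Hl | apply complex_derivative_const].
    - apply Hneq, Hz. }
  assert (HQ : forall z, square z -> Cmod (Q z) = / disc_ratio (g z) w).
  { intros z Hz; unfold Q, disc_ratio; rewrite Cmod_div by (apply Hneq, Hz).
    pose proof (disc_denominator_pos (g z) w (Hg z Hz) Hw).
    assert (0 < Cmod (g z - w)) by (apply Cmod_gt_0, Hneq, Hz).
    field; lra. }
  assert (Hpos : forall z, square z -> 0 < disc_ratio (g z) w).
  { intros z Hz; apply Rdiv_lt_0_compat; [apply Cmod_gt_0, Hneq, Hz|].
    apply disc_denominator_pos; auto. }
  assert (H0 : square 0) by (split; simpl; rewrite Rabs_R0; lra).
  assert (Hle : Cmod (Q 0) <= 1).
  { apply maximum_principle_square; [| |exact H0].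
    - intros z Hz; destruct (HQd z Hz) as [l Hl]; split.
      + apply (complex_derivative_continuous _ _ _ Hl).
      + destruct (square_open z Hz) as [r [Hr Hsq]]; exists r; split; [exact Hr|].
        intros x Hx; apply HQd, Hsq; lra.
    - intros B HB; destruct (disc_ratio_near_boundary g w B Hg Hex Hw HB) as [s [Hs H]].
      exists s; split; [exact Hs|]; intros z Hz Hout; rewrite HQ by exact Hz.
      specialize (H z Hz Hout); specialize (Hpos z Hz).
      apply Rmult_le_reg_r with (disc_ratio (g z) w); [exact Hpos|].
      rewrite Rinv_l; lra. }
  rewrite HQ in Hle by exact H0; specialize (Hpos _ H0).
  pose proof (disc_ratio_lt_1 (g 0) w (Hg _ H0) Hw).
  apply Rmult_le_compat_r with (r := disc_ratio (g 0) w) in Hle; [|lra].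
  rewrite Rinv_l in Hle; lra.
Qed.

Lemma conformal_bijection_square (g : C -> C) :
  conformal_bijection square unit_disc g <->
  holomorphic_to_disc g /\
  (forall z w, square z -> square w -> g z = g w -> z = w) /\
  (forall w, Cmod w < 1 -> exists z, square z /\ g z = w).
Proof.
  unfold conformal_bijection, holomorphic_to_disc, holomorphic_on, unit_disc.
  split.
  - intros [H1 [H2 [H3 H4]]]; repeat split; auto.
    intros z Hz; apply ex_derive_complex_derivative, H1, Hz.
  - intros [[H1 H2] [H3 H4]]; repeat split; auto.
    intros z Hz; apply ex_derive_complex_derivative, H1, Hz.
Qed.

(** Continuity of the inverse, without the open mapping theorem: for [w] near
    [w0 = h z0] with preimage far from [z0], the function [1 / (h - w)] would be
    holomorphic near [z0] and larger at the centre of a circle than on it. *)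
Lemma conformal_preimage_bounded (h : C -> C) (w0 : C) :
  conformal_bijection square unit_disc h -> Cmod w0 < 1 ->
  exists d s, 0 < d /\ s < 1 /\ forall z, square z -> Cmod (h z - w0) < d ->
    Rabs (Re z) <= s /\ Rabs (Im z) <= s.
Proof.
  intros Hh Hw0; apply conformal_bijection_square in Hh.
  destruct Hh as [[Hd Hdisc] [Hinj Hsurj]].
  destruct (Hsurj w0 Hw0) as [z0 [Hz0 Hhz0]].
  destruct (square_ball z0 Hz0) as [r0 [s [Hr0 [Hs Hball]]]].
  assert (Hsq : forall w, Cmod (w - z0) <= r0 -> square w)
    by (intros w Hw; specialize (Hball w Hw); split; lra).
  set (r := r0 / 2); assert (Hr : 0 < r < r0) by (unfold r; lra).
  pose proof PI_RGT_0 as Hpi.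
  destruct (continuity_ab_min (fun t => Cmod (h (circle z0 r t) - w0)) 0 (2 * PI))
    as [t0 [Hmin Ht0]]; [lra| |].
  { intros t _; apply continuity_pt_filterlim.
    apply (continuous_along_circle (fun z => RtoC (Cmod (h z - w0)))); intros eps He.
    destruct (Hd (circle z0 r t)) as [l Hl]; [apply Hsq; rewrite Cmod_circle; lra|].
    destruct (complex_continuous_Cmod (fun z => h z - w0)%C (circle z0 r t) eps)
      as [d [Hd0 Hd1]]; [|exact He|].
    - eapply complex_derivative_continuous, complex_derivative_minus;
        [exact Hl | apply complex_derivative_const].
    - exists d; split; [exact Hd0|]; intros w Hw; specialize (Hd1 w Hw).
      rewrite <- RtoC_minus, Cmod_R; exact Hd1. }
  set (m := Cmod (h (circle z0 r t0) - w0)) in *.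
  assert (Hm : 0 < m).
  { apply Cmod_gt_0; intros H.
    assert (E : circle z0 r t0 = z0).
    { apply Hinj; [apply Hsq; rewrite Cmod_circle; lra | exact Hz0|].
      rewrite Hhz0; replace (h (circle z0 r t0)) with (h (circle z0 r t0) - w0 + w0)%C by ring.
      rewrite H; ring. }
    pose proof (Cmod_circle z0 r t0 ltac:(lra)) as Hcm; rewrite E in Hcm.
    replace (z0 - z0)%C with (RtoC 0) in Hcm by ring; rewrite Cmod_0 in Hcm; lra. }
  exists (m / 2), s; split; [lra|]; split; [exact Hs|].
  intros z Hz Hzw.
  destruct (Rlt_le_dec (Cmod (z - z0)) r0) as [Hnear|Hfar].
  { apply Hball; lra. }
  exfalso.
  set (w := h z) in *.
  assert (Hw : Cmod (w - w0) < m / 2) by exact Hzw.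
  assert (Hcirc : forall t, 0 <= t <= 2 * PI -> m / 2 <= Cmod (h (circle z0 r t) - w)).
  { intros t Ht; specialize (Hmin t Ht).
    pose proof (Cmod_rev_triangle (h (circle z0 r t) - w0) (w - w0)) as A.
    replace (h (circle z0 r t) - w0 - (w - w0))%C with (h (circle z0 r t) - w)%C in A by ring.
    lra. }
  assert (Hnz : forall x, Cmod (x - z0) <= r -> (h x - w)%C <> 0).
  { intros x Hx H; assert (x = z).
    { apply Hinj; [apply Hsq; lra | exact Hz|].
      fold w; replace (h x) with (h x - w + w)%C by ring; rewrite H; ring. }
    subst x; lra. }
  assert (Hle : Cmod (/ (h z0 - w)) <= 2 / m).
  { apply (maximum_principle_disc (fun x => / (h x - w))%C z0 r (2 / m)); [lra| | |].
    - apply Rlt_le, Rdiv_lt_0_compat; lra.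
    - intros x Hx; destruct (Hd x (Hsq x ltac:(lra))) as [l Hl]; eexists.
      apply (complex_derivative_comp (fun x => h x - w)%C Cinv).
      + apply complex_derivative_minus; [exact Hl | apply complex_derivative_const].
      + apply complex_derivative_inv, Hnz, Hx.
    - intros t Ht; rewrite Cmod_inv by (apply Hnz; rewrite Cmod_circle; lra).
      replace (2 / m) with (/ (m / 2)) by (field; lra).
      apply Rinv_le_contravar; [lra | apply Hcirc, Ht]. }
  assert (Hz0z0 : Cmod (z0 - z0) <= r).
  { replace (z0 - z0)%C with (RtoC 0) by ring; rewrite Cmod_0; lra. }
  rewrite Cmod_inv in Hle by (apply Hnz, Hz0z0).
  rewrite Hhz0, Cmod_minus_sym in Hle.
  assert (Hw' : 0 < Cmod (w - w0)).
  { rewrite Cmod_minus_sym, <- Hhz0; apply Cmod_gt_0, Hnz, Hz0z0. }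
  assert (/ (m / 2) < / Cmod (w - w0)) by (apply Rinv_lt_contravar; [nra | lra]).
  replace (/ (m / 2)) with (2 / m) in H by (field; lra); lra.
Qed.

Lemma conformal_exhausts (h : C -> C) :
  conformal_bijection square unit_disc h -> exhausts_square h.
Proof.
  intros Hh rho Hrho.
  destruct (square_compact_induction 1 (fun S => exists s, s < 1 /\ forall z, square z ->
    S (h z) -> Cmod (h z) <= rho -> Rabs (Re z) <= s /\ Rabs (Im z) <= s)) as [s [Hs H]].
  - lra.
  - intros S T HST [s [Hs H]]; exists s; auto.
  - intros S T [s [Hs H1]] [t [Ht H2]]; exists (Rmax s t).
    split; [apply Rmax_lub_lt; assumption|]; intros z Hz Hw Hr.
    pose proof (Rmax_l s t); pose proof (Rmax_r s t).
    destruct Hw as [Hw|Hw]; [specialize (H1 z Hz Hw Hr) | specialize (H2 z Hz Hw Hr)]; lra.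
  - intros w0 _; destruct (Rlt_le_dec (Cmod w0) 1) as [Hin|Hout].
    + destruct (conformal_preimage_bounded h w0 Hh Hin) as [d [s [Hd [Hs H]]]].
      exists d; split; [exact Hd|]; exists s; split; [exact Hs|].
      intros z Hz [_ Hw] _; auto.
    + exists (Cmod w0 - rho); split; [lra|]; exists 0; split; [lra|].
      intros z _ [_ Hw] Hr; exfalso.
      pose proof (Cmod_rev_triangle w0 (h z)) as A; rewrite Cmod_minus_sym in A; lra.
  - exists s; split; [exact Hs|]; intros z Hz Hzr; apply (H z Hz); [|exact Hzr].
    pose proof (re_le_Cmod (h z)); pose proof (im_le_Cmod (h z)); lra.
Qed.

Lemma slope_derivative (f : C -> C) (a l x m : C) :
  x <> a -> complex_derivative f x m -> exists k, complex_derivative (slope f a l) x k.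
Proof.
  intros Hx Hf.
  destruct (complex_derivative_div (fun x => f x - f a)%C (fun x => x - a)%C x (m - 0) (1 - 0))
    as [k Hk].
  - apply complex_derivative_minus; [exact Hf | apply complex_derivative_const].
  - apply complex_derivative_minus; [apply complex_derivative_id | apply complex_derivative_const].
  - apply Cminus_neq_0, Hx.
  - exists k.
    assert (Hp : 0 < Cmod (x - a)) by (apply Cmod_gt_0, Cminus_neq_0, Hx).
    refine (complex_derivative_ext_loc _ _ _ _ _ Hp _ Hk).
    intros w Hw; unfold slope; destruct (Ceq_dec w a) as [E|E]; [|reflexivity].
    subst w; rewrite Cmod_minus_sym in Hw; lra.
Qed.

(** The Schwarz--Pick comparison.  In the quotient of the disc automorphisms
    [Phi_(h a) (h x) / Phi_(g a) (g x)] the zeros at [a] cancel, and its modulus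
    is at most [1] at the boundary, because [|Phi_(g a) (g x)|] tends to [1]. *)
Theorem disc_ratio_comparison (g h : C -> C) (a l : C) :
  holomorphic_to_disc g -> exhausts_square g ->
  (forall z w, square z -> square w -> g z = g w -> z = w) ->
  holomorphic_to_disc h ->
  square a -> complex_derivative g a l -> l <> 0 ->
  forall x, square x -> disc_ratio (h x) (h a) <= disc_ratio (g x) (g a).
Proof.
  intros [Hgd Hg] Hex Hinj [Hhd Hh] Ha Hl Hl0 x Hx.
  destruct (Hhd a Ha) as [m Hm].
  set (N := fun x => (slope h a m x * (1 - g x * Cconj (g a)))%C).
  set (D := fun x => (slope g a l x * (1 - h x * Cconj (h a)))%C).
  set (Q := fun x => (N x / D x)%C).
  assert (HD0 : forall x, square x -> D x <> 0).
  { intros z Hz; unfold D; apply Cmult_neq_0.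
    - unfold slope; destruct (Ceq_dec z a) as [E|E]; [exact Hl0|].
      apply Cmult_neq_0; [apply Cminus_neq_0; intros H; apply E, Hinj; auto|].
      apply Cmod_gt_0; rewrite Cmod_inv by (apply Cminus_neq_0, E).
      apply Rinv_0_lt_compat, Cmod_gt_0, Cminus_neq_0, E.
    - apply disc_denominator_neq; auto. }
  assert (HQ : forall x, square x -> x <> a ->
            Cmod (Q x) * disc_ratio (g x) (g a) = disc_ratio (h x) (h a)).
  { intros z Hz Hza; unfold Q, disc_ratio.
    pose proof (Cminus_neq_0 z a Hza) as Hn.
    pose proof (disc_denominator_neq (g z) (g a) (Hg z Hz) (Hg a Ha)) as N1.
    pose proof (disc_denominator_neq (h z) (h a) (Hh z Hz) (Hh a Ha)) as N2.
    assert (N3 : (g z - g a)%C <> 0) by (apply Cminus_neq_0; intros H; apply Hza, Hinj; auto).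
    rewrite <- !Cmod_div by assumption.
    rewrite <- Cmod_mult; f_equal.
    unfold N, D, slope; destruct (Ceq_dec z a) as [E|E]; [congruence|].
    field; auto. }
  assert (Hc : forall f z k, complex_derivative f z k -> complex_continuous f z)
    by (intros f z k; apply complex_derivative_continuous).
  assert (Hle : forall z, square z -> Cmod (Q z) <= 1).
  { apply maximum_principle_square.
    - intros z Hz.
      assert (Hoff : forall w, square w -> w <> a -> exists k, complex_derivative Q w k).
      { intros w Hw Hwa.
        destruct (Hgd w Hw) as [lg Hlg]; destruct (Hhd w Hw) as [lh Hlh].
        destruct (slope_derivative g a l w lg Hwa Hlg) as [k1 Hk1].
        destruct (slope_derivative h a m w lh Hwa Hlh) as [k2 Hk2].
        eapply complex_derivative_div; [| |apply HD0, Hw].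
        - apply (complex_derivative_mult (slope h a m) (fun x => 1 - g x * Cconj (g a))%C);
            [exact Hk2 | apply complex_derivative_denominator, Hlg].
        - apply (complex_derivative_mult (slope g a l) (fun x => 1 - h x * Cconj (h a))%C);
            [exact Hk1 | apply complex_derivative_denominator, Hlh]. }
      destruct (square_open z Hz) as [r [Hr Hsq]].
      destruct (Ceq_dec z a) as [E|E].
      + subst z; split.
        * apply complex_continuous_div; [| |apply HD0, Ha].
          -- apply complex_continuous_mult; [apply slope_continuous, Hm|].
             apply (Hc _ _ _ (complex_derivative_denominator g (g a) a l Hl)).
          -- apply complex_continuous_mult; [apply slope_continuous, Hl|].
             apply (Hc _ _ _ (complex_derivative_denominator h (h a) a m Hm)).
        * exists r; split; [exact Hr|]; intros w Hw; apply Hoff; [apply Hsq; lra|].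
          intros ->; replace (a - a)%C with (RtoC 0) in Hw by ring; rewrite Cmod_0 in Hw; lra.
      + split.
        * destruct (Hoff z Hz E) as [k Hk]; apply (Hc _ _ _ Hk).
        * assert (Hp : 0 < Cmod (z - a)) by (apply Cmod_gt_0, Cminus_neq_0, E).
          exists (Rmin r (Cmod (z - a))); split; [apply Rmin_glb_lt; lra|].
          intros w [_ Hw]; apply Hoff.
          -- apply Hsq; left; eapply Rlt_le_trans; [exact Hw | apply Rmin_l].
          -- intros ->; assert (Cmod (a - z) < Cmod (z - a))
               by (eapply Rlt_le_trans; [exact Hw | apply Rmin_r]).
             rewrite Cmod_minus_sym in H; lra.
    - intros B HB; destruct (disc_ratio_near_boundary g (g a) B Hg Hex (Hg a Ha) HB) as [s [Hs H]].
      exists (Rmax s (Rmax (Rabs (Re a)) (Rabs (Im a)))).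
      split; [destruct Ha; repeat apply Rmax_lub_lt; lra|].
      intros z Hz Hout.
      pose proof (Rmax_l s (Rmax (Rabs (Re a)) (Rabs (Im a)))) as M1.
      pose proof (Rmax_r s (Rmax (Rabs (Re a)) (Rabs (Im a)))) as M2.
      pose proof (Rmax_l (Rabs (Re a)) (Rabs (Im a))) as M3.
      pose proof (Rmax_r (Rabs (Re a)) (Rabs (Im a))) as M4.
      assert (Hza : z <> a) by (intros ->; destruct Hout; lra).
      assert (HB1 : 1 <= B * disc_ratio (g z) (g a)) by (apply H; [exact Hz|]; destruct Hout; lra).
      pose proof (disc_ratio_lt_1 (h z) (h a) (Hh z Hz) (Hh a Ha)) as H1.
      rewrite <- (HQ z Hz Hza) in H1.
      pose proof (disc_ratio_nonneg (g z) (g a) (Hg z Hz) (Hg a Ha)) as H0.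
      pose proof (Cmod_ge_0 (Q z)); nra. }
  destruct (Ceq_dec x a) as [->|Hxa].
  - unfold disc_ratio; replace (h a - h a)%C with (RtoC 0) by ring.
    replace (g a - g a)%C with (RtoC 0) by ring; rewrite Cmod_0; lra.
  - rewrite <- (HQ x Hx Hxa).
    pose proof (disc_ratio_nonneg (g x) (g a) (Hg x Hx) (Hg a Ha)) as H0.
    specialize (Hle x Hx); nra.
Qed.

Lemma is_derive_continuity_pt (u : R -> R) (t l : R) : is_derive u t l -> continuity_pt u t.
Proof.
  intros H; apply continuity_pt_filterlim.
  apply (ex_derive_continuous (K := R_AbsRing) (V := R_NormedModule)); exists l; exact H.
Qed.

Lemma is_derive_id_R (t : R) : is_derive (fun s : R => s) t 1.
Proof. exact (is_derive_id (K := R_AbsRing) t). Qed.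

Lemma mean_value_theorem (u du : R -> R) (a b : R) :
  a <= b -> (forall t, a <= t <= b -> is_derive u t (du t)) ->
  exists c, a <= c <= b /\ u b - u a = du c * (b - a).
Proof.
  intros Hab H.
  destruct (MVT_gen u a b du) as [c [Hc E]].
  - rewrite Rmin_left, Rmax_right by exact Hab; intros t Ht; apply H; lra.
  - rewrite Rmin_left, Rmax_right by exact Hab; intros t Ht.
    apply (is_derive_continuity_pt u t (du t)), H, Ht.
  - rewrite Rmin_left, Rmax_right in Hc by exact Hab; exists c; split; assumption.
Qed.

Lemma zero_derivative_constant (f : C -> C) (x y b : R) :
  0 < b -> (forall t, 0 <= t <= b -> complex_derivative f (x + t, y) 0) ->
  f (x, y) = f (x + b, y).
Proof.
  intros Hb Hf.
  assert (Hd : forall t eps, 0 <= t <= b -> 0 < eps -> exists d, 0 < d /\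
     forall k, Rabs k < d -> Cmod (f (x + (t + k), y) - f (x + t, y)) <= eps * Rabs k).
  { intros t eps Ht He; destruct (Hf t Ht eps He) as [d [Hd0 Hd]].
    exists d; split; [exact Hd0|]; intros k Hk.
    assert (E : Cmod ((x + (t + k), y) - (x + t, y)) = Rabs k).
    { rewrite <- Cmod_R; f_equal; apply injective_projections; simpl; ring. }
    specialize (Hd (x + (t + k), y)); rewrite E in Hd; specialize (Hd Hk).
    replace (f ((x + (t + k))%R, y) - f ((x + t)%R, y))%C
      with (f ((x + (t + k))%R, y) - f ((x + t)%R, y)
            - 0 * (((x + (t + k))%R, y) - ((x + t)%R, y)))%C by ring.
    exact Hd. }
  assert (Hconst : forall p : C -> R,
    (forall z w, Rabs (p z - p w) <= Cmod (z - w)) -> p (f (x, y)) = p (f (x + b, y))).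
  { intros p Hp.
    assert (Hder : forall t, 0 <= t <= b -> is_derive (fun t => p (f (x + t, y))) t 0).
    { intros t Ht; apply is_derive_Reals; intros eps He.
      destruct (Hd t (eps / 2) Ht) as [d [Hd0 Hd1]]; [lra|].
      exists (mkposreal d Hd0); intros k Hk0 Hk; simpl in Hk; specialize (Hd1 k Hk).
      rewrite Rminus_0_r; unfold Rdiv; rewrite Rabs_mult, Rabs_inv.
      pose proof (Rabs_pos_lt k Hk0).
      apply Rle_lt_trans with (eps / 2); [|lra].
      apply (Rle_div_l _ (eps / 2) (Rabs k)); [assumption|].
      eapply Rle_trans; [apply Hp | exact Hd1]. }
    destruct (mean_value_theorem (fun t => p (f (x + t, y))) (fun _ => 0) 0 b) as [c [_ Hc]];
      [lra | exact Hder | rewrite Rplus_0_r in Hc; lra]. }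
  apply injective_projections.
  - apply (Hconst Re); intros z w; apply (re_le_Cmod (z - w)).
  - apply (Hconst Im); intros z w; apply (im_le_Cmod (z - w)).
Qed.

(** Otherwise [h] would be constant on a horizontal segment. *)
Lemma injective_derivative_dense (h : C -> C) (a : C) (r : R) :
  (forall z, square z -> exists l, complex_derivative h z l) ->
  (forall z w, square z -> square w -> h z = h w -> z = w) ->
  square a -> 0 < r ->
  exists b l, square b /\ Cmod (b - a) < r /\ complex_derivative h b l /\ l <> 0.
Proof.
  intros Hd Hinj Ha Hr; apply NNPP; intros Hno.
  destruct (square_open a Ha) as [r0 [Hr0 Hsq]].
  set (b := Rmin (r / 2) r0).
  assert (Hb : 0 < b) by (apply Rmin_glb_lt; lra).
  assert (Hb1 : b <= r / 2) by apply Rmin_l; assert (Hb2 : b <= r0) by apply Rmin_r.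
  destruct a as [x y].
  assert (Hdist : forall t, 0 <= t -> Cmod ((x + t, y) - (x, y)) = t).
  { intros t Ht; rewrite <- (Rabs_pos_eq t Ht) at 2; rewrite <- Cmod_R; f_equal.
    apply injective_projections; simpl; ring. }
  assert (E : h (x, y) = h (x + b, y)).
  { apply zero_derivative_constant; [exact Hb|]; intros t Ht.
    assert (Hst : square (x + t, y)) by (apply Hsq; rewrite Hdist; lra).
    destruct (Hd _ Hst) as [l Hl].
    destruct (Ceq_dec l 0) as [->|Hl0]; [exact Hl|].
    exfalso; apply Hno; exists (x + t, y), l; repeat split; auto; try apply Hst.
    rewrite Hdist; lra. }
  apply Hinj in E; [|exact Ha | apply Hsq; rewrite Hdist; lra].
  injection E; lra.
Qed.

(** Where [g' <> 0] this is the Schwarz--Pick comparison; those points are dense,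
    and both sides are continuous in [a]. *)
Lemma disc_ratio_conformal_le (g h : C -> C) :
  conformal_bijection square unit_disc g -> conformal_bijection square unit_disc h ->
  forall x a, square x -> square a -> disc_ratio (h x) (h a) <= disc_ratio (g x) (g a).
Proof.
  intros Hg Hh x a Hx Ha.
  pose proof (conformal_exhausts g Hg) as Exg.
  apply conformal_bijection_square in Hg; destruct Hg as [Holg [Injg _]].
  apply conformal_bijection_square in Hh; destruct Hh as [Holh _].
  apply Rnot_lt_le; intros Hlt.
  set (eps := (disc_ratio (h x) (h a) - disc_ratio (g x) (g a)) / 2).
  assert (Heps : 0 < eps) by (unfold eps; lra).
  assert (Hcont : forall f, holomorphic_to_disc f -> exists d, 0 < d /\ forall b, square b ->
     Cmod (b - a) < d -> Rabs (disc_ratio (f x) (f b) - disc_ratio (f x) (f a)) < eps).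
  { intros f [Hd Hf]; destruct (Hd a Ha) as [l Hl].
    destruct (holomorphic_mobius f (f x) a l Hl (Hf a Ha) (Hf x Hx)) as [k Hk].
    destruct (complex_continuous_Cmod _ a eps (complex_derivative_continuous _ _ _ Hk) Heps)
      as [d [Hd0 Hd1]].
    exists d; split; [exact Hd0|]; intros b Hb Hba; specialize (Hd1 b Hba).
    rewrite !Cmod_div in Hd1 by (apply disc_denominator_neq; auto).
    rewrite (disc_ratio_sym (f x) (f b)), (disc_ratio_sym (f x) (f a)); exact Hd1. }
  destruct (Hcont g Holg) as [d1 [Hd1 H1]]; destruct (Hcont h Holh) as [d2 [Hd2 H2]].
  destruct (injective_derivative_dense g a (Rmin d1 d2)) as [b [l [Hb [Hba [Hl Hl0]]]]]; auto.
  { apply Holg. } { apply Rmin_glb_lt; lra. }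
  destruct (Rlt_Rmin _ _ _ Hba) as [Hb1 Hb2].
  specialize (H1 b Hb Hb1); specialize (H2 b Hb Hb2).
  apply Rabs_lt_between in H1; apply Rabs_lt_between in H2.
  pose proof (disc_ratio_comparison g h b l Holg Exg Injg Holh Hb Hl Hl0 x Hx).
  unfold eps in *; lra.
Qed.

Theorem disc_ratio_conformally_invariant (g h : C -> C) :
  conformal_bijection square unit_disc g -> conformal_bijection square unit_disc h ->
  forall x a, square x -> square a -> disc_ratio (h x) (h a) = disc_ratio (g x) (g a).
Proof.
  intros Hg Hh x a Hx Ha; apply Rle_antisym; apply disc_ratio_conformal_le; assumption.
Qed.

(** * The lemniscate sine on the real line *)

Lemma nonneg_derivative_increasing (u du : R -> R) (a b : R) :
  a <= b -> (forall t, a <= t <= b -> is_derive u t (du t)) ->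
  (forall t, a <= t <= b -> 0 <= du t) -> u a <= u b.
Proof.
  intros Hab H Hp; destruct (mean_value_theorem u du a b Hab H) as [c [Hc E]].
  specialize (Hp c Hc); nra.
Qed.

Lemma zero_derivative_constant_R (u : R -> R) (a b : R) :
  (forall t, is_derive u t 0) -> u a = u b.
Proof.
  intros H; destruct (MVT_gen u a b (fun _ => 0)) as [c [_ E]].
  - intros t _; apply H.
  - intros t _; apply (is_derive_continuity_pt u t 0), H.
  - lra.
Qed.

Definition lemniscate_speed (th : R) : R := sqrt (1 + sin th ^ 2).

Lemma lemniscate_speed_bounds (th : R) : 1 <= lemniscate_speed th <= 2.
Proof.
  unfold lemniscate_speed; pose proof (SIN_bound th); split.
  - rewrite <- sqrt_1 at 1; apply sqrt_le_1_alt; nra.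
  - rewrite <- (sqrt_pow2 2) by lra; apply sqrt_le_1_alt; nra.
Qed.

Lemma lemniscate_speed_sq (th : R) : lemniscate_speed th ^ 2 = 1 + sin th ^ 2.
Proof. unfold lemniscate_speed; apply pow2_sqrt; pose proof (pow2_ge_0 (sin th)); lra. Qed.

Lemma is_derive_lemniscate_speed (th : R) :
  is_derive lemniscate_speed th (sin th * cos th / lemniscate_speed th).
Proof.
  assert (0 < 1 + sin th ^ 2) by (pose proof (pow2_ge_0 (sin th)); lra).
  pose proof (lemniscate_speed_bounds th) as Hb.
  unfold lemniscate_speed in *; auto_derive; [exact H|].
  replace (sin th * (sin th * 1)) with (sin th ^ 2) by ring.
  field; lra.
Qed.

(** With [s = sin th], the integral of [1 / sqrt (1 - s ^ 4)] becomes that of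
    [1 / sqrt (1 + sin th ^ 2)], which is regular on the whole line: this makes
    the lemniscate sine smooth on the whole line from the start. *)
Definition lemniscate_time (th : R) : R := RInt (fun t => / lemniscate_speed t) 0 th.

Lemma is_derive_lemniscate_time (th : R) :
  is_derive lemniscate_time th (/ lemniscate_speed th).
Proof.
  assert (Hc : forall t, continuous (fun t => / lemniscate_speed t) t).
  { intros t; apply (ex_derive_continuous (K := R_AbsRing) (V := R_NormedModule)).
    pose proof (lemniscate_speed_bounds t).
    apply ex_derive_inv; [eexists; apply is_derive_lemniscate_speed | lra]. }
  apply (is_derive_RInt (V := R_NormedModule) (fun t => / lemniscate_speed t) lemniscate_time 0).
  - apply filter_forall; intros b; apply (RInt_correct (V := R_CompleteNormedModule)).
    apply (ex_RInt_continuous (V := R_CompleteNormedModule)); intros; apply Hc.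
  - apply Hc.
Qed.

Lemma lemniscate_time_increment (a b : R) :
  exists c, Rmin a b <= c <= Rmax a b /\
    lemniscate_time b - lemniscate_time a = / lemniscate_speed c * (b - a).
Proof.
  apply (MVT_gen lemniscate_time a b (fun t => / lemniscate_speed t)).
  - intros t _; apply is_derive_lemniscate_time.
  - intros t _; eapply is_derive_continuity_pt, is_derive_lemniscate_time.
Qed.

Lemma lemniscate_time_bounds (a b : R) :
  a <= b -> (b - a) / 2 <= lemniscate_time b - lemniscate_time a <= b - a.
Proof.
  intros Hab; destruct (lemniscate_time_increment a b) as [c [_ E]]; rewrite E.
  pose proof (lemniscate_speed_bounds c) as Hb.
  assert (/ 2 <= / lemniscate_speed c) by (apply Rinv_le_contravar; lra).
  assert (/ lemniscate_speed c <= / 1) by (apply Rinv_le_contravar; lra).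
  rewrite Rinv_1 in *; split; nra.
Qed.

Lemma lemniscate_time_0 : lemniscate_time 0 = 0.
Proof. apply (RInt_point (V := R_CompleteNormedModule)). Qed.

Lemma lemniscate_time_surjective (u : R) : {th : R | lemniscate_time th = u}.
Proof.
  destruct (IVT_gen lemniscate_time (- (2 * Rabs u)) (2 * Rabs u) u) as [th [_ H]].
  - intros t; eapply is_derive_continuity_pt, is_derive_lemniscate_time.
  - pose proof (Rabs_pos u).
    pose proof (lemniscate_time_bounds 0 (2 * Rabs u) ltac:(lra)) as H1.
    pose proof (lemniscate_time_bounds (- (2 * Rabs u)) 0 ltac:(lra)) as H2.
    rewrite lemniscate_time_0 in H1, H2.
    pose proof (Rle_abs u); pose proof (Rle_abs (- u)); rewrite Rabs_Ropp in *.
    rewrite Rmin_left, Rmax_right by lra; lra.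
  - exists th; exact H.
Qed.

Definition amplitude (u : R) : R := proj1_sig (lemniscate_time_surjective u).

Lemma time_amplitude (u : R) : lemniscate_time (amplitude u) = u.
Proof. exact (proj2_sig (lemniscate_time_surjective u)). Qed.

Lemma time_increasing (a b : R) : a < b -> lemniscate_time a < lemniscate_time b.
Proof. intros H; pose proof (lemniscate_time_bounds a b ltac:(lra)); lra. Qed.

Lemma amplitude_unique (u th : R) : lemniscate_time th = u -> amplitude u = th.
Proof.
  intros H; pose proof (time_amplitude u) as H1.
  destruct (Rtotal_order (amplitude u) th) as [Hlt|[E|Hgt]]; [|exact E|].
  - apply time_increasing in Hlt; lra.
  - apply time_increasing in Hgt; lra.
Qed.

Lemma amplitude_increasing (a b : R) : a < b -> amplitude a < amplitude b.
Proof.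
  intros H; apply Rnot_le_lt; intros Hle.
  pose proof (lemniscate_time_bounds _ _ Hle) as H1; rewrite !time_amplitude in H1; lra.
Qed.

Lemma amplitude_lipschitz (u v : R) : Rabs (amplitude v - amplitude u) <= 2 * Rabs (v - u).
Proof.
  destruct (Rle_dec (amplitude u) (amplitude v)) as [H|H].
  - pose proof (lemniscate_time_bounds _ _ H) as H1; rewrite !time_amplitude in H1.
    rewrite !Rabs_pos_eq by lra; lra.
  - pose proof (lemniscate_time_bounds (amplitude v) (amplitude u) ltac:(lra)) as H1.
    rewrite !time_amplitude in H1.
    rewrite !Rabs_left1 by lra; lra.
Qed.

Lemma is_derive_amplitude (u : R) :
  is_derive amplitude u (lemniscate_speed (amplitude u)).
Proof.
  apply is_derive_Reals; intros eps He.
  pose proof (is_derive_continuity_pt _ _ _ (is_derive_lemniscate_speed (amplitude u))) as Hc.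
  destruct (Hc eps He) as [d [Hd0 Hd]].
  assert (Hd2 : 0 < d / 3) by lra.
  exists (mkposreal _ Hd2); intros k Hk0 Hk; simpl in Hk.
  destruct (lemniscate_time_increment (amplitude u) (amplitude (u + k))) as [c [Hcb E]].
  rewrite !time_amplitude in E.
  pose proof (lemniscate_speed_bounds c) as Hb.
  assert (Hq : (amplitude (u + k) - amplitude u) / k = lemniscate_speed c).
  { apply Rmult_eq_reg_r with k; [|exact Hk0].
    replace (lemniscate_speed c * k) with (lemniscate_speed c * (u + k - u)) by ring.
    rewrite E; field; split; lra. }
  rewrite Hq.
  assert (Hcd : Rabs (c - amplitude u) < d).
  { apply Rle_lt_trans with (Rabs (amplitude (u + k) - amplitude u)).
    - destruct (Rle_dec (amplitude u) (amplitude (u + k))) as [H|H].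
      + rewrite Rmin_left, Rmax_right in Hcb by lra; rewrite !Rabs_pos_eq by lra; lra.
      + rewrite Rmin_right, Rmax_left in Hcb by lra.
        rewrite !Rabs_left1 by lra; lra.
    - pose proof (amplitude_lipschitz u (u + k)) as HL.
      replace (u + k - u) with k in HL by ring; lra. }
  destruct (Req_dec c (amplitude u)) as [->|Hne].
  - replace (lemniscate_speed (amplitude u) - lemniscate_speed (amplitude u)) with 0 by ring.
    rewrite Rabs_R0; exact He.
  - apply Hd; split; [split; [exact I | auto] | exact Hcd].
Qed.

Definition sl (u : R) : R := sin (amplitude u).
Definition sl' (u : R) : R := cos (amplitude u) * lemniscate_speed (amplitude u).

Lemma is_derive_sl (u : R) : is_derive sl u (sl' u).
Proof.
  unfold sl; evar_last.
  - apply (is_derive_comp sin amplitude); [apply is_derive_sin | apply is_derive_amplitude].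
  - unfold sl', scal; simpl; unfold mult; simpl; ring.
Qed.

Lemma is_derive_sl' (u : R) : is_derive sl' u (- 2 * sl u ^ 3).
Proof.
  unfold sl'; evar_last.
  - apply (is_derive_mult (fun u => cos (amplitude u)) (fun u => lemniscate_speed (amplitude u)));
      [| | intros; apply Rmult_comm].
    + apply (is_derive_comp cos amplitude); [apply is_derive_cos | apply is_derive_amplitude].
    + apply (is_derive_comp lemniscate_speed amplitude);
        [apply is_derive_lemniscate_speed | apply is_derive_amplitude].
  - unfold scal, plus, mult; simpl; unfold mult; simpl; fold (sl u).
    pose proof (lemniscate_speed_bounds (amplitude u)) as Hb.
    pose proof (lemniscate_speed_sq (amplitude u)) as Hq.
    pose proof (sin2_cos2 (amplitude u)) as Hsc; unfold Rsqr in Hsc.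
    fold (sl u) in Hq, Hsc |- *.
    set (q := lemniscate_speed (amplitude u)) in *; set (c := cos (amplitude u)) in *.
    set (s := sl u) in *.
    transitivity (- s * q ^ 2 + s * (c * c)); [field; lra|].
    rewrite Hq; replace (c * c) with (1 - s * s) by lra; ring.
Qed.

Lemma sl'_sq (u : R) : sl' u ^ 2 = 1 - sl u ^ 4.
Proof.
  unfold sl'; rewrite Rpow_mult_distr, lemniscate_speed_sq; unfold sl.
  pose proof (sin2_cos2 (amplitude u)) as H; unfold Rsqr in H.
  replace (cos (amplitude u) ^ 2) with (1 - sin (amplitude u) ^ 2) by (simpl; lra); ring.
Qed.

(** [lem] is [1 / wp] for the Weierstrass function of the square lattice, and
    [lem_half_deriv] is half its derivative; [(lem, lem_half_deriv)] runs on the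
    elliptic curve [y ^ 2 = x - x ^ 3]. *)
Definition lem (u : R) : R := sl u ^ 2.
Definition lem_half_deriv (u : R) : R := sl u * sl' u.

Lemma is_derive_lem (u : R) : is_derive lem u (2 * lem_half_deriv u).
Proof.
  unfold lem, lem_half_deriv; evar_last.
  - apply (is_derive_pow sl 2 u (sl' u)), is_derive_sl.
  - simpl; ring.
Qed.

Lemma is_derive_lem_half_deriv (u : R) : is_derive lem_half_deriv u (1 - 3 * lem u ^ 2).
Proof.
  unfold lem_half_deriv; evar_last.
  - apply (is_derive_mult sl sl');
      [apply is_derive_sl | apply is_derive_sl' | intros; apply Rmult_comm].
  - unfold plus, mult; simpl; unfold lem.
    transitivity (sl' u ^ 2 - 2 * sl u ^ 4); [ring | rewrite sl'_sq; ring].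
Qed.

Lemma lem_curve (u : R) : lem_half_deriv u ^ 2 = lem u - lem u ^ 3.
Proof.
  unfold lem, lem_half_deriv; rewrite Rpow_mult_distr, sl'_sq; ring.
Qed.

Lemma lem_nonneg (u : R) : 0 <= lem u.
Proof. apply pow2_ge_0. Qed.

Lemma lem_le_1 (u : R) : lem u <= 1.
Proof. unfold lem, sl; pose proof (SIN_bound (amplitude u)); nra. Qed.

Lemma amplitude_0 : amplitude 0 = 0.
Proof. apply amplitude_unique, lemniscate_time_0. Qed.

Lemma sl_0 : sl 0 = 0.
Proof. unfold sl; rewrite amplitude_0; apply sin_0. Qed.

Lemma lem_0 : lem 0 = 0.
Proof. unfold lem; rewrite sl_0; ring. Qed.

Lemma lem_half_deriv_0 : lem_half_deriv 0 = 0.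
Proof. unfold lem_half_deriv; rewrite sl_0; ring. Qed.

Lemma ex_derive_lemniscate_time (th : R) : ex_derive lemniscate_time th.
Proof. eexists; apply is_derive_lemniscate_time. Qed.

Lemma Derive_lemniscate_time (th : R) :
  Derive (fun t => lemniscate_time t) th = / lemniscate_speed th.
Proof. apply is_derive_unique, is_derive_lemniscate_time. Qed.

Lemma lemniscate_time_opp (th : R) : lemniscate_time (- th) = - lemniscate_time th.
Proof.
  set (E := fun t => lemniscate_time t + lemniscate_time (- t)).
  assert (H : E 0 = E th).
  { apply (zero_derivative_constant_R E); intros t; unfold E; auto_derive.
    - repeat split; apply ex_derive_lemniscate_time.
    - rewrite !Derive_lemniscate_time; unfold lemniscate_speed; rewrite sin_neg.
      replace ((- sin t) ^ 2) with (sin t ^ 2) by ring; ring. }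
  unfold E in H; rewrite Ropp_0, lemniscate_time_0 in H; lra.
Qed.

Definition quarter_period : R := lemniscate_time (PI / 2).

Lemma lemniscate_time_reflect (th : R) :
  lemniscate_time (PI - th) = 2 * quarter_period - lemniscate_time th.
Proof.
  set (E := fun t => lemniscate_time t + lemniscate_time (PI - t)).
  assert (H : E (PI / 2) = E th).
  { apply (zero_derivative_constant_R E); intros t; unfold E; auto_derive.
    - repeat split; apply ex_derive_lemniscate_time.
    - rewrite !Derive_lemniscate_time; unfold lemniscate_speed.
      replace (PI + - t) with (PI - t) by ring; rewrite sin_PI_x; ring. }
  unfold E in H; replace (PI - PI / 2) with (PI / 2) in H by field; unfold quarter_period; lra.
Qed.

Lemma amplitude_opp (u : R) : amplitude (- u) = - amplitude u.
Proof. apply amplitude_unique; rewrite lemniscate_time_opp, time_amplitude; reflexivity. Qed.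

Lemma lem_opp (u : R) : lem (- u) = lem u.
Proof. unfold lem, sl; rewrite amplitude_opp, sin_neg; ring. Qed.

Lemma lem_half_deriv_opp (u : R) : lem_half_deriv (- u) = - lem_half_deriv u.
Proof.
  unfold lem_half_deriv, sl', sl, lemniscate_speed; rewrite amplitude_opp, sin_neg, cos_neg.
  replace ((- sin (amplitude u)) ^ 2) with (sin (amplitude u) ^ 2) by ring; ring.
Qed.

Lemma lem_reflect (u : R) : lem (2 * quarter_period - u) = lem u.
Proof.
  unfold lem, sl; rewrite (amplitude_unique _ (PI - amplitude u)).
  - rewrite sin_PI_x; reflexivity.
  - rewrite lemniscate_time_reflect, time_amplitude; reflexivity.
Qed.

Lemma lem_Rabs (u : R) : lem (Rabs u) = lem u.
Proof. unfold Rabs; destruct (Rcase_abs u); [apply lem_opp | reflexivity]. Qed.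

Lemma quarter_period_pos : 0 < quarter_period.
Proof.
  unfold quarter_period; pose proof PI_RGT_0 as H.
  pose proof (lemniscate_time_bounds 0 (PI / 2) ltac:(lra)) as H1.
  rewrite lemniscate_time_0 in H1; lra.
Qed.

Lemma amplitude_quarter_period : amplitude quarter_period = PI / 2.
Proof. apply amplitude_unique; reflexivity. Qed.

Lemma sl_at_quarter_period : sl quarter_period = 1.
Proof. unfold sl; rewrite amplitude_quarter_period; apply sin_PI2. Qed.

Lemma lem_at_quarter_period : lem quarter_period = 1.
Proof. unfold lem; rewrite sl_at_quarter_period; ring. Qed.

Lemma amplitude_range (u : R) : 0 <= u <= quarter_period -> 0 <= amplitude u <= PI / 2.
Proof.
  intros [[H0|<-] [H1|H1]].
  - apply amplitude_increasing in H0; apply amplitude_increasing in H1.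
    rewrite amplitude_0 in H0; rewrite amplitude_quarter_period in H1; lra.
  - rewrite H1, amplitude_quarter_period; pose proof PI_RGT_0; lra.
  - rewrite amplitude_0; pose proof PI_RGT_0; lra.
  - rewrite amplitude_0; pose proof PI_RGT_0; lra.
Qed.

Lemma sl_nonneg (u : R) : 0 <= u <= quarter_period -> 0 <= sl u.
Proof.
  intros H; apply amplitude_range in H; apply sin_ge_0; pose proof PI_RGT_0; lra.
Qed.

Lemma sl'_nonneg (u : R) : 0 <= u <= quarter_period -> 0 <= sl' u.
Proof.
  intros H; apply amplitude_range in H; apply Rmult_le_pos.
  - apply cos_ge_0; lra.
  - pose proof (lemniscate_speed_bounds (amplitude u)); lra.
Qed.

Lemma lem_half_deriv_nonneg (u : R) : 0 <= u <= quarter_period -> 0 <= lem_half_deriv u.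
Proof. intros H; apply Rmult_le_pos; [apply sl_nonneg | apply sl'_nonneg]; exact H. Qed.

Lemma sl_increasing (a b : R) : 0 <= a -> a < b -> b <= quarter_period -> sl a < sl b.
Proof.
  intros Ha Hab Hb; unfold sl.
  pose proof (amplitude_range a ltac:(lra)); pose proof (amplitude_range b ltac:(lra)).
  apply sin_increasing_1; try lra; apply amplitude_increasing, Hab.
Qed.

Lemma lem_increasing (a b : R) : 0 <= a -> a < b -> b <= quarter_period -> lem a < lem b.
Proof.
  intros Ha Hab Hb; pose proof (sl_increasing a b Ha Hab Hb).
  pose proof (sl_nonneg a ltac:(lra)); unfold lem; nra.
Qed.

Lemma lem_monotone (a b : R) : 0 <= a -> a <= b -> b <= quarter_period -> lem a <= lem b.
Proof.
  intros Ha [Hab| ->] Hb; [apply Rlt_le, lem_increasing; assumption | lra].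
Qed.

Lemma lem_pos (u : R) : 0 < u -> u <= quarter_period -> 0 < lem u.
Proof. intros H0 H1; rewrite <- lem_0; apply lem_increasing; lra. Qed.

Lemma lem_lt_1 (u : R) : 0 <= u < quarter_period -> lem u < 1.
Proof. intros H; rewrite <- lem_at_quarter_period; apply lem_increasing; lra. Qed.

Lemma lem_half_deriv_pos (u : R) : 0 < u < quarter_period -> 0 < lem_half_deriv u.
Proof.
  intros H; pose proof (lem_half_deriv_nonneg u ltac:(lra)) as H0.
  pose proof (lem_curve u) as Hc; pose proof (lem_pos u ltac:(lra) ltac:(lra)) as Hp.
  pose proof (lem_lt_1 u ltac:(lra)) as H1.
  assert (0 < lem u - lem u ^ 3).
  { replace (lem u - lem u ^ 3) with (lem u * ((1 - lem u) * (1 + lem u))) by ring.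
    apply Rmult_lt_0_compat; [lra | apply Rmult_lt_0_compat; lra]. }
  nra.
Qed.

Lemma sl_le_id (u : R) : 0 <= u -> sl u <= u.
Proof.
  intros Hu.
  assert (H : (fun t => t - sl t) 0 <= (fun t => t - sl t) u).
  { apply (nonneg_derivative_increasing (fun t => t - sl t) (fun t => 1 - sl' t)); [exact Hu| |].
    - intros t _; apply (is_derive_minus (fun t => t) sl); [apply is_derive_id_R | apply is_derive_sl].
    - intros t _; pose proof (sl'_sq t); assert (0 <= sl t ^ 4) by
        (replace (sl t ^ 4) with ((sl t ^ 2) ^ 2) by ring; apply pow2_ge_0).
      nra. }
  simpl in H; rewrite sl_0 in H; lra.
Qed.

Lemma lem_le_sq (u : R) : 0 <= u <= quarter_period -> lem u <= u ^ 2.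
Proof.
  intros H; apply pow_incr; split; [apply sl_nonneg, H | apply sl_le_id; lra].
Qed.

(** Concavity: [sl'' = - 2 sl ^ 3 <= 0], so the tangents meet the vertical axis
    above the origin, and [sl u / u] decreases. *)
Lemma sl_tangent (u : R) : 0 <= u <= quarter_period -> u * sl' u <= sl u.
Proof.
  intros Hu.
  assert (H : (fun t => sl t - t * sl' t) 0 <= (fun t => sl t - t * sl' t) u).
  { apply (nonneg_derivative_increasing (fun t => sl t - t * sl' t) (fun t => 2 * t * sl t ^ 3)); [lra| |].
    - intros t _; evar_last.
      + apply (is_derive_minus sl (fun t => t * sl' t)); [apply is_derive_sl|].
        apply (is_derive_mult (fun t => t) sl');
          [apply is_derive_id_R | apply is_derive_sl' | intros; apply Rmult_comm].
      + unfold minus, plus, opp, mult, one; simpl; ring.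
    - intros t Ht; apply Rmult_le_pos; [lra|]; apply pow_le, sl_nonneg; lra. }
  simpl in H; rewrite sl_0, Rmult_0_l in H; lra.
Qed.

Lemma sl_ratio_decreasing (u v : R) : 0 < u -> u <= v -> v <= quarter_period ->
  sl v * u <= sl u * v.
Proof.
  intros Hu Huv Hv.
  assert (H : (fun t => - (sl t / t)) u <= (fun t => - (sl t / t)) v).
  { apply (nonneg_derivative_increasing (fun t => - (sl t / t)) (fun t => (sl t - t * sl' t) / t ^ 2)); [lra| |].
    - intros t Ht; evar_last.
      + apply (is_derive_opp (fun t => sl t / t)).
        apply (is_derive_div sl (fun t => t)); [apply is_derive_sl | apply is_derive_id_R | lra].
      + unfold opp, one; simpl; field; lra.
    - intros t Ht; apply Rdiv_le_0_compat; [|apply pow_lt; lra].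
      pose proof (sl_tangent t ltac:(lra)); lra. }
  simpl in H; apply Ropp_le_cancel in H.
  apply Rmult_le_compat_r with (r := u * v) in H; [|nra].
  replace (sl v / v * (u * v)) with (sl v * u) in H by (field; lra).
  replace (sl u / u * (u * v)) with (sl u * v) in H by (field; lra).
  exact H.
Qed.

Lemma lem_ratio_decreasing (u v : R) : 0 < u -> u <= v -> v <= quarter_period ->
  lem v * u ^ 2 <= lem u * v ^ 2.
Proof.
  intros Hu Huv Hv; pose proof (sl_ratio_decreasing u v Hu Huv Hv) as H.
  pose proof (sl_nonneg v ltac:(lra)).
  unfold lem; rewrite <- !Rpow_mult_distr; apply pow_incr; split; [nra | exact H].
Qed.

Lemma sq_le_lem (u : R) : 0 <= u <= quarter_period -> u ^ 2 <= quarter_period ^ 2 * lem u.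
Proof.
  intros [[H0| <-] H1].
  - pose proof (lem_ratio_decreasing u quarter_period H0 H1 ltac:(lra)) as H.
    rewrite lem_at_quarter_period in H; lra.
  - rewrite lem_0; simpl; lra.
Qed.

Lemma lem_tangent (u : R) : 0 <= u <= quarter_period -> u * lem_half_deriv u <= lem u.
Proof.
  intros H; pose proof (sl_tangent u H); pose proof (sl_nonneg u H).
  unfold lem, lem_half_deriv; nra.
Qed.

Lemma sq_le_lem_ratio (u : R) : 0 <= u <= quarter_period -> u ^ 2 * (1 - lem u) <= lem u.
Proof.
  intros H; pose proof (sl_tangent u H) as Ht; pose proof (sl_nonneg u H) as Hs.
  pose proof (sl'_nonneg u H) as Hs'; pose proof (sl'_sq u) as Hq; pose proof (lem_nonneg u) as Hl.
  assert (Hsq : (u * sl' u) ^ 2 <= sl u ^ 2) by (apply pow_incr; split; [nra | exact Ht]).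
  rewrite Rpow_mult_distr, Hq in Hsq.
  replace (1 - sl u ^ 4) with ((1 - lem u) * (1 + lem u)) in Hsq by (unfold lem; ring).
  fold (lem u) in Hsq; pose proof (lem_le_1 u).
  pose proof (pow2_ge_0 u).
  assert (0 <= u ^ 2 * (1 - lem u) * lem u) by (apply Rmult_le_pos; [apply Rmult_le_pos|]; lra).
  lra.
Qed.

Lemma lem_half_deriv_le_id (u : R) : 0 <= u -> lem_half_deriv u <= u.
Proof.
  intros Hu.
  assert (H : (fun t => t - lem_half_deriv t) 0 <= (fun t => t - lem_half_deriv t) u).
  { apply (nonneg_derivative_increasing (fun t => t - lem_half_deriv t) (fun t => 1 - (1 - 3 * lem t ^ 2))); [exact Hu| |].
    - intros t _; apply (is_derive_minus (fun t => t) lem_half_deriv);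
        [apply is_derive_id_R | apply is_derive_lem_half_deriv].
    - intros t _; pose proof (pow2_ge_0 (lem t)); lra. }
  simpl in H; rewrite lem_half_deriv_0 in H; lra.
Qed.

(** Along [u + v = const] the right-hand side has derivative zero. *)
Theorem lem_addition (u v : R) :
  lem (u + v) = ((lem u + lem v) * (1 - lem u * lem v)
                 + 2 * lem_half_deriv u * lem_half_deriv v) / (1 + lem u * lem v) ^ 2.
Proof.
  set (E := fun t => ((lem (u + v - t) + lem t) * (1 - lem (u + v - t) * lem t)
     + 2 * lem_half_deriv (u + v - t) * lem_half_deriv t) / (1 + lem (u + v - t) * lem t) ^ 2).
  assert (H : E 0 = E v).
  { apply (zero_derivative_constant_R E); intros t.
    pose proof (lem_nonneg (u + v - t)) as H1; pose proof (lem_nonneg t) as H2.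
    assert (Hpos : 0 < 1 + lem (u + v - t) * lem t) by nra.
    assert (Hf : forall s, ex_derive lem s) by (intros s; eexists; apply is_derive_lem).
    assert (Hh : forall s, ex_derive lem_half_deriv s)
      by (intros s; eexists; apply is_derive_lem_half_deriv).
    unfold E; auto_derive.
    - unfold Rminus in *; repeat split; auto; nra.
    - change (Derive (fun x => lem x)) with (Derive lem).
      change (Derive (fun x => lem_half_deriv x)) with (Derive lem_half_deriv).
      rewrite !(is_derive_unique lem _ _ (is_derive_lem _)),
        !(is_derive_unique lem_half_deriv _ _ (is_derive_lem_half_deriv _)).
      pose proof (lem_curve (u + v - t)) as C1; pose proof (lem_curve t) as C2.
      unfold Rminus in *.
      set (p := lem (u + v + - t)) in *; set (q := lem t) in *.
      set (m := lem_half_deriv (u + v + - t)) in *; set (n := lem_half_deriv t) in *.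
      match goal with |- ?L = 0 => replace L with
        ((8 * n * q * (m ^ 2 - (p - p ^ 3)) - 8 * m * p * (n ^ 2 - (q - q ^ 3))) / (1 + p * q) ^ 3)
        by (field; lra) end.
      rewrite C1, C2; field; lra. }
  unfold E in H; rewrite lem_0, lem_half_deriv_0, !Rminus_0_r in H.
  replace (u + v - v) with u in H by ring; rewrite <- H; field.
Qed.

Lemma lem_at_half_quarter_period : lem (quarter_period / 2) = sqrt 2 - 1.
Proof.
  set (f := lem (quarter_period / 2)).
  assert (H0 : 0 <= f) by apply lem_nonneg.
  pose proof (lem_addition (quarter_period / 2) (quarter_period / 2)) as H.
  replace (quarter_period / 2 + quarter_period / 2) with quarter_period in H by field.
  rewrite lem_at_quarter_period in H; fold f in H.
  pose proof (lem_curve (quarter_period / 2)) as Hc; fold f in Hc.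
  assert (Hp : 0 < 1 + f * f) by nra.
  assert (E : (f ^ 2 + 2 * f - 1) ^ 2 = 0).
  { replace ((f + f) * (1 - f * f) + 2 * lem_half_deriv (quarter_period / 2) * lem_half_deriv (quarter_period / 2))
      with ((f + f) * (1 - f * f) + 2 * lem_half_deriv (quarter_period / 2) ^ 2) in H by ring.
    rewrite Hc in H.
    apply (f_equal (fun x => x * (1 + f * f) ^ 2)) in H.
    unfold Rdiv in H; rewrite Rmult_assoc, Rinv_l, Rmult_1_l, Rmult_1_r in H
      by (apply pow_nonzero; lra).
    transitivity ((1 + f * f) ^ 2 - ((f + f) * (1 - f * f) + 2 * (f - f ^ 3))); [ring | lra]. }
  assert (E1 : f ^ 2 + 2 * f - 1 = 0).
  { apply Rsqr_0_uniq; unfold Rsqr; lra. }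
  assert (E2 : (f + 1) ^ 2 = 2) by lra.
  rewrite <- E2, sqrt_pow2 by lra; ring.
Qed.

(** * The cross-ratio and its comparison with the Euclidean one *)

Lemma Rdiv_le_cross (a b c d : R) : 0 < b -> 0 < d -> a / b <= c / d <-> a * d <= c * b.
Proof.
  intros Hb Hd; split; intros H.
  - apply Rmult_le_compat_r with (r := b * d) in H; [|nra].
    replace (a / b * (b * d)) with (a * d) in H by (field; lra).
    replace (c / d * (b * d)) with (c * b) in H by (field; lra); exact H.
  - apply Rmult_le_reg_r with (b * d); [nra|].
    replace (a / b * (b * d)) with (a * d) by (field; lra).
    replace (c / d * (b * d)) with (c * b) by (field; lra); exact H.
Qed.

(** The cross-ratio of [lem a], [lem P] and [- lem b], [- lem Q], the last two
    being the values at [i b] and [i Q] of the extension of [lem] to the plane. *)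
Definition lem_cross_ratio (a b P Q : R) : R :=
  (lem a + lem b) * (lem P + lem Q) / ((lem P + lem b) * (lem a + lem Q)).

Lemma lem_cross_ratio_sym (a b P Q : R) : lem_cross_ratio a b P Q = lem_cross_ratio b a Q P.
Proof.
  unfold lem_cross_ratio; f_equal; ring.
Qed.

(** As [lem Q <= 1], replacing it by [1] decreases the cross-ratio to
    [(F a + G) / (F P + G)] with [F = lem / (1 + lem)] and
    [G = lem b / (1 - lem b)]; and [(F u + G) / (u ^ 2 + b ^ 2)] decreases in [u],
    because [F' u / (2 u)] is at most both [F u / u ^ 2] and [G / b ^ 2]. *)
Lemma lem_cross_ratio_ge (a b P Q : R) :
  0 <= a < P -> P <= quarter_period -> 0 <= b < Q -> Q <= quarter_period ->
  (a ^ 2 + b ^ 2) / (P ^ 2 + b ^ 2) <= lem_cross_ratio a b P Q.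
Proof.
  intros Ha HP Hb HQ.
  pose proof (lem_nonneg a) as Fa; pose proof (lem_nonneg b) as Fb.
  assert (FP : 0 < lem P) by (apply lem_pos; lra).
  assert (FQ : 0 < lem Q) by (apply lem_pos; lra).
  assert (FaP : lem a < lem P) by (apply lem_increasing; lra).
  assert (Fb1 : lem b < 1) by (apply lem_lt_1; lra).
  pose proof (lem_le_1 Q) as FQ1.
  set (F := fun u => lem u / (1 + lem u)); set (G := lem b / (1 - lem b)).
  assert (HG : b ^ 2 <= G).
  { unfold G; apply (Rle_div_r (b ^ 2) (lem b)); [lra|]; apply sq_le_lem_ratio; lra. }
  assert (Hpow : 0 <= b ^ 2) by apply pow2_ge_0.
  assert (HF0 : forall u, 0 <= F u).
  { intros u; apply Rdiv_le_0_compat; pose proof (lem_nonneg u); lra. }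
  assert (H1 : (F P + G) * (a ^ 2 + b ^ 2) <= (F a + G) * (P ^ 2 + b ^ 2)).
  { assert (Hnn : 0 <= a ^ 2 + b ^ 2) by (pose proof (pow2_ge_0 a); lra).
    destruct Hnn as [Hpos|Hz].
    2:{ rewrite <- Hz, Rmult_0_r; pose proof (HF0 a); pose proof (pow2_ge_0 P).
        apply Rmult_le_pos; lra. }
    assert (Hden : forall u, a <= u -> 0 < u ^ 2 + b ^ 2) by (intros u Hu; nra).
    assert (Hd : forall u, a <= u <= P -> is_derive (fun u => - ((F u + G) / (u ^ 2 + b ^ 2))) u
       (- ((2 * lem_half_deriv u / (1 + lem u) ^ 2 * (u ^ 2 + b ^ 2) - (F u + G) * (2 * u))
            / (u ^ 2 + b ^ 2) ^ 2))).
    { intros u Hu; specialize (Hden u ltac:(lra)); pose proof (lem_nonneg u).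
      assert (Hne : u * (u * 1) + b * (b * 1) <> 0) by (simpl in Hden; lra).
      assert (ex_derive lem u) by (eexists; apply is_derive_lem).
      unfold F; auto_derive.
      - simpl in Hden; repeat split; auto; lra.
      - change (Derive (fun x => lem x) u) with (Derive lem u).
        rewrite (is_derive_unique lem _ _ (is_derive_lem u)).
        field; split; [lra | simpl; lra]. }
    assert (Hmono : - ((F a + G) / (a ^ 2 + b ^ 2)) <= - ((F P + G) / (P ^ 2 + b ^ 2))).
    { apply (nonneg_derivative_increasing _ _ a P ltac:(lra) Hd).
      intros u Hu; specialize (Hden u ltac:(lra)); pose proof (lem_nonneg u) as Fu.
      match goal with |- 0 <= - (?N / ?D) => replace (- (N / D)) with ((- N) / D) by (field; nra) end.
      apply Rdiv_le_0_compat; [|nra].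
      pose proof (lem_tangent u ltac:(lra)) as Ht.
      pose proof (lem_half_deriv_nonneg u ltac:(lra)) as Hh.
      pose proof (lem_half_deriv_le_id u ltac:(lra)) as Hhu.
      assert (Hinv : 0 < / (1 + lem u) <= 1).
      { split; [apply Rinv_0_lt_compat; lra|].
        rewrite <- Rinv_1; apply Rinv_le_contravar; lra. }
      set (i := / (1 + lem u)) in *.
      assert (HFu : F u = lem u * i) by reflexivity.
      assert (Hd2 : 2 * lem_half_deriv u / (1 + lem u) ^ 2 = 2 * lem_half_deriv u * i ^ 2)
        by (unfold i; field; lra).
      rewrite Hd2, HFu.
      set (h := lem_half_deriv u) in *.
      assert (A1 : u * h * i ^ 2 <= lem u * i).
      { apply Rle_trans with (lem u * i ^ 2); [apply Rmult_le_compat_r; [nra | exact Ht]|].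
        apply Rmult_le_compat_l; nra. }
      assert (A2 : h * i ^ 2 * b ^ 2 <= u * G).
      { apply Rle_trans with (h * 1 * b ^ 2).
        - apply Rmult_le_compat_r; [exact Hpow|]; apply Rmult_le_compat_l; nra.
        - rewrite Rmult_1_r; apply Rmult_le_compat; lra. }
      assert (A3 : u * (u * h * i ^ 2) <= u * (lem u * i)) by (apply Rmult_le_compat_l; lra).
      nra. }
    apply Ropp_le_cancel in Hmono.
    apply (proj1 (Rdiv_le_cross _ _ _ _ (Hden P ltac:(lra)) (Hden a ltac:(lra)))) in Hmono.
    exact Hmono. }
  assert (HPb : 0 < P ^ 2 + b ^ 2) by nra.
  apply Rle_trans with ((lem a + lem b) * (lem P + 1) / ((lem P + lem b) * (lem a + 1))).
  - apply Rdiv_le_cross; [exact HPb | nra|].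
    apply Rmult_le_compat_r with (r := (1 + lem P) * (1 + lem a) * (1 - lem b)) in H1;
      [|apply Rmult_le_pos; [nra | lra]].
    replace ((F P + G) * (a ^ 2 + b ^ 2) * ((1 + lem P) * (1 + lem a) * (1 - lem b)))
      with ((a ^ 2 + b ^ 2) * ((lem P + lem b) * (lem a + 1))) in H1
      by (unfold F, G; field; lra).
    replace ((F a + G) * (P ^ 2 + b ^ 2) * ((1 + lem P) * (1 + lem a) * (1 - lem b)))
      with ((lem a + lem b) * (lem P + 1) * (P ^ 2 + b ^ 2)) in H1
      by (unfold F, G; field; lra).
    exact H1.
  - unfold lem_cross_ratio.
    replace ((lem a + lem b) * (lem P + 1) / ((lem P + lem b) * (lem a + 1)))
      with ((lem a + lem b) / (lem P + lem b) * ((lem P + 1) / (lem a + 1))) by (field; lra).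
    replace ((lem a + lem b) * (lem P + lem Q) / ((lem P + lem b) * (lem a + lem Q)))
      with ((lem a + lem b) / (lem P + lem b) * ((lem P + lem Q) / (lem a + lem Q))) by (field; lra).
    apply Rmult_le_compat_l; [apply Rdiv_le_0_compat; lra|].
    apply Rdiv_le_cross; [lra | lra | nra].
Qed.

(** [lem u / u ^ 2] decreases from [1] to [1 / quarter_period ^ 2], which bounds two
    of the factors; it also makes [lem] subadditive in [u ^ 2], whence
    [lem P <= lem Q + lem a], and the remaining factor is at most [2]. *)
Lemma lem_cross_ratio_le (a b P Q : R) :
  0 <= a < P -> P <= quarter_period -> 0 <= b < Q -> Q <= quarter_period ->
  P ^ 2 + b ^ 2 <= a ^ 2 + Q ^ 2 ->
  lem_cross_ratio a b P Q * (P ^ 2 + b ^ 2) <= 2 * quarter_period ^ 2 * (a ^ 2 + b ^ 2).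
Proof.
  intros Ha HP Hb HQ Hle.
  pose proof (lem_nonneg a) as Fa; pose proof (lem_nonneg b) as Fb.
  assert (FP : 0 < lem P) by (apply lem_pos; lra).
  assert (FQ : 0 < lem Q) by (apply lem_pos; lra).
  pose proof quarter_period_pos as Hw.
  assert (X1 : lem a + lem b <= a ^ 2 + b ^ 2).
  { pose proof (lem_le_sq a ltac:(lra)); pose proof (lem_le_sq b ltac:(lra)); lra. }
  assert (X2 : P ^ 2 + b ^ 2 <= quarter_period ^ 2 * (lem P + lem b)).
  { pose proof (sq_le_lem P ltac:(lra)); pose proof (sq_le_lem b ltac:(lra)); lra. }
  assert (X3 : lem P <= 2 * lem a + lem Q).
  { destruct (Rle_lt_dec P Q) as [HPQ|HQP].
    - pose proof (lem_monotone P Q ltac:(lra) HPQ HQ); lra.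
    - pose proof (lem_ratio_decreasing Q P ltac:(lra) ltac:(lra) HP) as B1.
      assert (B2 : lem P * a ^ 2 <= lem a * P ^ 2).
      { destruct (proj1 Ha) as [H0| <-].
        - apply lem_ratio_decreasing; lra.
        - simpl; nra. }
      assert (B3 : (lem a + lem Q) * P ^ 2 <= (lem a + lem Q) * (a ^ 2 + Q ^ 2)).
      { apply Rmult_le_compat_l; [lra|]; pose proof (pow2_ge_0 b); lra. }
      assert (B4 : lem P * (a ^ 2 + Q ^ 2) <= (lem a + lem Q) * (a ^ 2 + Q ^ 2)) by lra.
      assert (0 < a ^ 2 + Q ^ 2) by nra.
      apply Rmult_le_reg_r in B4; lra. }
  assert (Y1 : (lem P + lem Q) / (lem a + lem Q) <= 2) by (apply Rle_div_l; lra).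
  assert (Y2 : (P ^ 2 + b ^ 2) / (lem P + lem b) <= quarter_period ^ 2) by (apply Rle_div_l; lra).
  assert (Z1 : 0 <= (lem P + lem Q) / (lem a + lem Q)) by (apply Rdiv_le_0_compat; lra).
  assert (Z2 : 0 <= (P ^ 2 + b ^ 2) / (lem P + lem b)) by (apply Rdiv_le_0_compat; nra).
  replace (lem_cross_ratio a b P Q * (P ^ 2 + b ^ 2))
    with ((lem P + lem Q) / (lem a + lem Q) * ((P ^ 2 + b ^ 2) / (lem P + lem b)) * (lem a + lem b))
    by (unfold lem_cross_ratio; field; lra).
  apply Rmult_le_compat; [apply Rmult_le_pos; assumption | lra | | exact X1].
  apply Rmult_le_compat; assumption.
Qed.

(** * The conformal map of the square *)

(** Real and imaginary part of [1 / wp (s + i t)], in terms of the values on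
    the real line; this function maps the open square with corners [0] and
    [(1 + i) quarter_period] onto the upper half plane. *)
Definition lem_re (s t : R) : R :=
  (lem s - lem t) * (1 + lem s * lem t) / (1 - lem s * lem t) ^ 2.
Definition lem_im (s t : R) : R :=
  2 * lem_half_deriv s * lem_half_deriv t / (1 - lem s * lem t) ^ 2.

Lemma lem_cross_ratio_algebra (p q r t m k n l : R) :
  let Dx := 1 - p * q in let Dy := 1 - r * t in
  let E1 := 1 + p * r in let E2 := 1 + q * t in
  let S1 := (p + r) * (1 - p * r) in let S2 := (q + t) * (1 - q * t) in
  m ^ 2 = p - p ^ 3 -> k ^ 2 = q - q ^ 3 -> n ^ 2 = r - r ^ 3 -> l ^ 2 = t - t ^ 3 ->
  Dx <> 0 -> Dy <> 0 -> E1 <> 0 -> E2 <> 0 ->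
  let re_x := (p - q) * (1 + p * q) / Dx ^ 2 in let im_x := 2 * m * k / Dx ^ 2 in
  let re_y := (r - t) * (1 + r * t) / Dy ^ 2 in let im_y := 2 * n * l / Dy ^ 2 in
  let fa := (S1 - 2 * m * n) / E1 ^ 2 in let fP := (S1 + 2 * m * n) / E1 ^ 2 in
  let fb := (S2 - 2 * k * l) / E2 ^ 2 in let fQ := (S2 + 2 * k * l) / E2 ^ 2 in
  ((re_x - re_y) ^ 2 + (im_x - im_y) ^ 2) * ((fP + fb) * (fa + fQ))
  = ((re_x - re_y) ^ 2 + (im_x + im_y) ^ 2) * ((fa + fb) * (fP + fQ)).
Proof.
  intros Dx Dy E1 E2 S1 S2 Hm Hk Hn Hl D1 D2 D3 D4 re_x im_x re_y im_y fa fP fb fQ.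
  (* Both sides are [(U -+ 8 V T) / ...] with [T = m k n l]; that the two pairs
     [(U, V)] are proportional is a polynomial identity in [p, q, r, t]. *)
  set (U1 := ((p - q) * (1 + p * q) * Dy ^ 2 - (r - t) * (1 + r * t) * Dx ^ 2) ^ 2
   + 4 * (p - p ^ 3) * (q - q ^ 3) * Dy ^ 4 + 4 * (r - r ^ 3) * (t - t ^ 3) * Dx ^ 4).
  set (U2 := (S1 * E2 ^ 2 + S2 * E1 ^ 2) ^ 2 - 4 * (p - p ^ 3) * (r - r ^ 3) * E2 ^ 4
   - 4 * (q - q ^ 3) * (t - t ^ 3) * E1 ^ 4).
  assert (HU : U1 * (E1 ^ 2 * E2 ^ 2) = U2 * (Dx ^ 2 * Dy ^ 2)).
  { unfold U1, U2, Dx, Dy, E1, E2, S1, S2; ring. }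
  set (T := m * k * n * l).
  assert (HLR : (re_x - re_y) ^ 2 + (im_x - im_y) ^ 2
                = (U1 - 8 * (Dx ^ 2 * Dy ^ 2) * T) / (Dx ^ 4 * Dy ^ 4)
    /\ (re_x - re_y) ^ 2 + (im_x + im_y) ^ 2
       = (U1 + 8 * (Dx ^ 2 * Dy ^ 2) * T) / (Dx ^ 4 * Dy ^ 4)
    /\ (fP + fb) * (fa + fQ) = (U2 + 8 * (E1 ^ 2 * E2 ^ 2) * T) / (E1 ^ 4 * E2 ^ 4)
    /\ (fa + fb) * (fP + fQ) = (U2 - 8 * (E1 ^ 2 * E2 ^ 2) * T) / (E1 ^ 4 * E2 ^ 4)).
  { unfold U1, U2; rewrite <- Hm, <- Hk, <- Hn, <- Hl.
    split; [|split; [|split]]; unfold re_x, re_y, im_x, im_y, fa, fb, fP, fQ, T;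
      field; split; assumption. }
  destruct HLR as [L1 [L2 [R1 R2]]].
  rewrite L1, L2, R1, R2.
  assert (HE : (U1 - 8 * (Dx ^ 2 * Dy ^ 2) * T) * (U2 + 8 * (E1 ^ 2 * E2 ^ 2) * T)
    = (U1 + 8 * (Dx ^ 2 * Dy ^ 2) * T) * (U2 - 8 * (E1 ^ 2 * E2 ^ 2) * T)).
  { transitivity (U1 * U2 + 8 * T * (U1 * (E1 ^ 2 * E2 ^ 2)) - 8 * T * (U2 * (Dx ^ 2 * Dy ^ 2))
      - 64 * (Dx ^ 2 * Dy ^ 2) * (E1 ^ 2 * E2 ^ 2) * T ^ 2); [ring|].
    transitivity (U1 * U2 - 8 * T * (U1 * (E1 ^ 2 * E2 ^ 2)) + 8 * T * (U2 * (Dx ^ 2 * Dy ^ 2))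
      - 64 * (Dx ^ 2 * Dy ^ 2) * (E1 ^ 2 * E2 ^ 2) * T ^ 2); [rewrite HU; ring | ring]. }
  unfold Rdiv.
  match goal with |- ?A * ?i * (?B * ?j) = ?C * ?i * (?D * ?j) =>
    replace (A * i * (B * j)) with (A * B * (i * j)) by ring;
    replace (C * i * (D * j)) with (C * D * (i * j)) by ring end.
  rewrite HE; reflexivity.
Qed.

(** The pseudo-hyperbolic distance in the half plane as a cross-ratio: insert the
    addition theorem and eliminate the squares of [lem_half_deriv] by [lem_curve]. *)
Lemma lem_cross_ratio_identity (x1 x2 y1 y2 : R) :
  0 < x1 < quarter_period -> 0 < x2 < quarter_period -> 0 < y1 < quarter_period -> 0 < y2 < quarter_period ->
  ((lem_re x1 x2 - lem_re y1 y2) ^ 2 + (lem_im x1 x2 - lem_im y1 y2) ^ 2)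
    * ((lem (x1 + y1) + lem (x2 - y2)) * (lem (x1 - y1) + lem (x2 + y2)))
  = ((lem_re x1 x2 - lem_re y1 y2) ^ 2 + (lem_im x1 x2 + lem_im y1 y2) ^ 2)
    * ((lem (x1 - y1) + lem (x2 - y2)) * (lem (x1 + y1) + lem (x2 + y2))).
Proof.
  intros H1 H2 H3 H4.
  assert (Hsub : forall u v, lem (u - v) = ((lem u + lem v) * (1 - lem u * lem v)
                 - 2 * lem_half_deriv u * lem_half_deriv v) / (1 + lem u * lem v) ^ 2).
  { intros u v; unfold Rminus at 1; rewrite lem_addition, lem_opp, lem_half_deriv_opp.
    f_equal; ring. }
  rewrite !Hsub, !lem_addition.
  pose proof (lem_lt_1 x1 ltac:(lra)); pose proof (lem_lt_1 x2 ltac:(lra)).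
  pose proof (lem_lt_1 y1 ltac:(lra)); pose proof (lem_lt_1 y2 ltac:(lra)).
  pose proof (lem_nonneg x1); pose proof (lem_nonneg x2).
  pose proof (lem_nonneg y1); pose proof (lem_nonneg y2).
  unfold lem_re, lem_im.
  apply lem_cross_ratio_algebra; try apply lem_curve; nra.
Qed.

Lemma lem_product_lt_1 (s t : R) :
  0 < s < quarter_period -> 0 < t < quarter_period -> 0 < 1 - lem s * lem t.
Proof.
  intros Hs Ht.
  pose proof (lem_lt_1 s ltac:(lra)); pose proof (lem_lt_1 t ltac:(lra)).
  pose proof (lem_nonneg s); pose proof (lem_nonneg t); nra.
Qed.

Lemma lem_im_pos (s t : R) : 0 < s < quarter_period -> 0 < t < quarter_period -> 0 < lem_im s t.
Proof.
  intros Hs Ht; pose proof (lem_product_lt_1 s t Hs Ht).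
  apply Rdiv_lt_0_compat; [|apply pow_lt; assumption].
  pose proof (lem_half_deriv_pos s Hs); pose proof (lem_half_deriv_pos t Ht).
  apply Rmult_lt_0_compat; lra.
Qed.

Lemma locally_2d_open_square (w s t : R) (A : R -> R -> Prop) :
  0 < s < w -> 0 < t < w ->
  (forall s' t', 0 < s' < w -> 0 < t' < w -> A s' t') -> locally_2d A s t.
Proof.
  intros Hs Ht H.
  assert (Hd : 0 < Rmin (Rmin s (w - s)) (Rmin t (w - t))) by (repeat apply Rmin_glb_lt; lra).
  exists (mkposreal _ Hd); simpl; intros s' t' H1 H2.
  pose proof (Rmin_l (Rmin s (w - s)) (Rmin t (w - t))).
  pose proof (Rmin_r (Rmin s (w - s)) (Rmin t (w - t))).
  pose proof (Rmin_l s (w - s)); pose proof (Rmin_r s (w - s)).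
  pose proof (Rmin_l t (w - t)); pose proof (Rmin_r t (w - t)).
  apply Rabs_lt_between in H1; apply Rabs_lt_between in H2; apply H; lra.
Qed.

(** Real part of the complex derivative; by the symmetry of [1 / wp] the imaginary
    part is the same expression with the variables exchanged. *)
Definition lem_dre (s t : R) : R :=
  2 * lem_half_deriv s * (1 + 3 * (lem s * lem t) - 3 * (lem t * lem t)
     - lem s * (lem t * (lem t * lem t)))
  * / ((1 - lem s * lem t) * ((1 - lem s * lem t) * (1 - lem s * lem t))).

Lemma continuity_2d_lem_dre (s t : R) :
  0 < 1 - lem s * lem t -> continuity_2d_pt lem_dre s t.
Proof.
  intros H; unfold lem_dre.
  assert (Hl : forall u, continuity_pt lem u)
    by (intros u; eapply is_derive_continuity_pt, is_derive_lem).
  assert (Hh : forall u, continuity_pt lem_half_deriv u)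
    by (intros u; eapply is_derive_continuity_pt, is_derive_lem_half_deriv).
  repeat first
    [ apply (continuity_2d_pt_fst lem), Hl | apply (continuity_2d_pt_snd lem), Hl
    | apply (continuity_2d_pt_fst lem_half_deriv), Hh | apply continuity_2d_pt_const
    | apply continuity_2d_pt_mult | apply continuity_2d_pt_plus
    | apply continuity_2d_pt_opp | apply continuity_2d_pt_inv ].
  assert (0 < (1 - lem s * lem t) * ((1 - lem s * lem t) * (1 - lem s * lem t)))
    by (repeat apply Rmult_lt_0_compat; exact H); lra.
Qed.

Lemma continuity_2d_pt_swap (u : R -> R -> R) (s t : R) :
  continuity_2d_pt u t s -> continuity_2d_pt (fun a b => u b a) s t.
Proof.
  intros H eps; destruct (H eps) as [d Hd]; exists d; intros a b Ha Hb; apply Hd; assumption.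
Qed.

Lemma is_derive_lem_re_1 (s t : R) : 0 < 1 - lem s * lem t ->
  is_derive (fun s => lem_re s t) s (lem_dre s t).
Proof.
  intros H; assert (ex_derive lem s) by (eexists; apply is_derive_lem).
  unfold lem_re, lem_dre; auto_derive.
  - repeat split; auto; nra.
  - change (Derive (fun x => lem x) s) with (Derive lem s).
    rewrite (is_derive_unique lem _ _ (is_derive_lem s)); field; lra.
Qed.

Lemma is_derive_lem_re_2 (s t : R) : 0 < 1 - lem s * lem t ->
  is_derive (fun t => lem_re s t) t (- lem_dre t s).
Proof.
  intros H; apply (is_derive_ext (fun t => - lem_re t s)).
  - intros u; change (- lem_re u s = lem_re s u); unfold lem_re; rewrite (Rmult_comm (lem u) (lem s)); unfold Rdiv; ring.
  - apply (is_derive_opp (fun t => lem_re t s)), is_derive_lem_re_1; lra.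
Qed.

Lemma is_derive_lem_im_1 (s t : R) : 0 < 1 - lem s * lem t ->
  is_derive (fun s => lem_im s t) s (lem_dre t s).
Proof.
  intros H; assert (ex_derive lem s) by (eexists; apply is_derive_lem).
  assert (ex_derive lem_half_deriv s) by (eexists; apply is_derive_lem_half_deriv).
  unfold lem_im, lem_dre; auto_derive.
  - repeat split; auto; nra.
  - change (Derive (fun x => lem x) s) with (Derive lem s).
    change (Derive (fun x => lem_half_deriv x) s) with (Derive lem_half_deriv s).
    rewrite (is_derive_unique lem _ _ (is_derive_lem s)),
      (is_derive_unique lem_half_deriv _ _ (is_derive_lem_half_deriv s)).
    pose proof (lem_curve s) as Hc.
    replace (2 * lem_half_deriv t * (1 + 3 * (lem t * lem s) - 3 * (lem s * lem s)
       - lem t * (lem s * (lem s * lem s))) *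
       / ((1 - lem t * lem s) * ((1 - lem t * lem s) * (1 - lem t * lem s))))
    with (2 * lem_half_deriv t * ((1 - 3 * lem s ^ 2) * (1 - lem s * lem t)
       + 4 * lem t * (lem s - lem s ^ 3))
       / (1 - lem s * lem t) ^ 3) by (field; lra).
    rewrite <- Hc; field; lra.
Qed.

Lemma is_derive_lem_im_2 (s t : R) : 0 < 1 - lem s * lem t ->
  is_derive (fun t => lem_im s t) t (lem_dre s t).
Proof.
  intros H; apply (is_derive_ext (fun t => lem_im t s)).
  - intros u; change (lem_im u s = lem_im s u); unfold lem_im; rewrite (Rmult_comm (lem u) (lem s)); unfold Rdiv; ring.
  - apply is_derive_lem_im_1; lra.
Qed.

Definition half_plane_map (z : C) : C := (lem_re (Re z) (Im z), lem_im (Re z) (Im z)).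

Lemma half_plane_map_holomorphic (z : C) :
  0 < Re z < quarter_period -> 0 < Im z < quarter_period ->
  complex_derivative half_plane_map z (lem_dre (Re z) (Im z), lem_dre (Im z) (Re z)).
Proof.
  destruct z as [s t]; simpl; intros Hs Ht.
  pose proof (lem_product_lt_1 s t Hs Ht) as Hp.
  apply (cauchy_riemann_complex_derivative lem_re lem_im).
  - apply (differentiable_pt_lim_partials lem_re lem_dre).
    + apply (locally_2d_open_square quarter_period); auto.
      intros s' t' Hs' Ht'; apply is_derive_lem_re_1, lem_product_lt_1; assumption.
    + apply is_derive_lem_re_2, Hp.
    + apply continuity_2d_lem_dre, Hp.
  - apply (differentiable_pt_lim_partials lem_im (fun s t => lem_dre t s)).
    + apply (locally_2d_open_square quarter_period); auto.
      intros s' t' Hs' Ht'; apply is_derive_lem_im_1, lem_product_lt_1; assumption.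
    + apply is_derive_lem_im_2, Hp.
    + apply continuity_2d_pt_swap, continuity_2d_lem_dre; lra.
Qed.

Definition cayley (w : C) : C := ((w - Ci) / (w + Ci))%C.

Lemma cayley_denominator (w : C) : 0 < Im w -> (w + Ci)%C <> 0.
Proof.
  intros H E; apply (f_equal Im) in E; simpl in E; unfold Im in H; lra.
Qed.

Lemma Cmod_cayley_lt_1 (w : C) : 0 < Im w -> Cmod (cayley w) < 1.
Proof.
  intros H; pose proof (cayley_denominator w H) as Hn.
  unfold cayley; rewrite Cmod_div by exact Hn.
  assert (Hp : 0 < Cmod (w + Ci)) by (apply Cmod_gt_0, Hn).
  apply Rlt_div_l; [exact Hp|]; rewrite Rmult_1_l.
  assert (H1 : Cmod (w - Ci) ^ 2 < Cmod (w + Ci) ^ 2).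
  { rewrite !Cmod_sq; destruct w as [a b]; simpl in *; nra. }
  pose proof (Cmod_ge_0 (w - Ci)); nra.
Qed.

Lemma disc_ratio_cayley (w v : C) : 0 < Im w -> 0 < Im v ->
  disc_ratio (cayley w) (cayley v) = Cmod (w - v) / Cmod (w - Cconj v).
Proof.
  intros Hw Hv.
  pose proof (cayley_denominator w Hw) as Nw; pose proof (cayley_denominator v Hv) as Nv.
  assert (Hi : Cconj Ci = (- Ci)%C) by (unfold Cconj, Ci; simpl; apply injective_projections; simpl; ring).
  assert (Nc : (Cconj v - Ci)%C <> 0).
  { apply Cmod_gt_0; replace (Cconj v - Ci)%C with (Cconj (v + Ci)).
    - rewrite Cmod_conj; apply Cmod_gt_0, Nv.
    - rewrite Cplus_conj, Hi; ring. }
  assert (N2 : (w - Cconj v)%C <> 0).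
  { intros E; apply (f_equal Im) in E; simpl in E; unfold Im in *; lra. }
  unfold disc_ratio.
  replace (cayley w - cayley v)%C with (2 * Ci * (w - v) / ((w + Ci) * (v + Ci)))%C
    by (unfold cayley; field; split; assumption).
  replace (1 - cayley w * Cconj (cayley v))%C
    with (- (2 * Ci * (w - Cconj v) / ((w + Ci) * (Cconj v - Ci))))%C.
  2:{ unfold cayley; rewrite Cdiv_conj, Cminus_conj, Cplus_conj, Hi by exact Nv.
      field; repeat split; try assumption. }
  rewrite Cmod_opp, !Cmod_div by (apply Cmult_neq_0; assumption).
  rewrite !Cmod_mult.
  replace (Cmod (Cconj v - Ci)) with (Cmod (v + Ci)).
  2:{ rewrite <- Cmod_conj, Cplus_conj, Hi; f_equal; ring. }
  rewrite Cmod_Ci, Cmod_R, Rabs_pos_eq by lra.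
  assert (0 < Cmod (w + Ci)) by (apply Cmod_gt_0, Nw).
  assert (0 < Cmod (v + Ci)) by (apply Cmod_gt_0, Nv).
  assert (0 < Cmod (w - Cconj v)) by (apply Cmod_gt_0, N2).
  field; repeat split; lra.
Qed.

Definition square_to_quadrant (z : C) : C :=
  ((Re z + 1) * (quarter_period / 2), (Im z + 1) * (quarter_period / 2)).

Definition square_map (z : C) : C := cayley (half_plane_map (square_to_quadrant z)).

Lemma square_to_quadrant_range (z : C) : square z ->
  0 < Re (square_to_quadrant z) < quarter_period /\ 0 < Im (square_to_quadrant z) < quarter_period.
Proof.
  intros Hz; apply square_iff in Hz; pose proof quarter_period_pos as Hw.
  change (0 < (Re z + 1) * (quarter_period / 2) < quarter_period
    /\ 0 < (Im z + 1) * (quarter_period / 2) < quarter_period).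
  repeat split; nra.
Qed.

Lemma half_plane_map_Im_pos (z : C) : square z -> 0 < Im (half_plane_map (square_to_quadrant z)).
Proof.
  intros Hz; destruct (square_to_quadrant_range z Hz) as [H1 H2]; apply (lem_im_pos _ _ H1 H2).
Qed.

Lemma square_map_to_disc : holomorphic_to_disc square_map.
Proof.
  split; intros z Hz; [|apply Cmod_cayley_lt_1, half_plane_map_Im_pos, Hz].
  destruct (square_to_quadrant_range z Hz) as [H1 H2].
  assert (Ha : complex_derivative square_to_quadrant z
                 (0 + (0 * z + RtoC (quarter_period / 2) * 1))%C).
  { apply (complex_derivative_ext_loc
      (fun w => ((quarter_period / 2)%R, (quarter_period / 2)%R)
                + RtoC (quarter_period / 2) * w)%C _ _ _ 1 Rlt_0_1).
    - intros [a b] _; apply injective_projections; simpl; ring.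
    - apply complex_derivative_plus; [apply complex_derivative_const|].
      apply (complex_derivative_mult (fun _ => RtoC (quarter_period / 2)) (fun w => w));
        [apply complex_derivative_const | apply complex_derivative_id]. }
  pose proof (complex_derivative_comp _ _ _ _ _ Ha (half_plane_map_holomorphic _ H1 H2)) as Hd.
  eapply (complex_derivative_div (fun z => half_plane_map (square_to_quadrant z) - Ci)%C
    (fun z => half_plane_map (square_to_quadrant z) + Ci)%C).
  - apply complex_derivative_minus; [exact Hd | apply complex_derivative_const].
  - apply complex_derivative_plus; [exact Hd | apply complex_derivative_const].
  - apply cayley_denominator, half_plane_map_Im_pos, Hz.
Qed.

(** Distances along one coordinate, between the two points and from one point
    to the reflection of the other in the nearer side, scaled to [quarter_period]. *)
Definition scaled_gap (a b : R) : R := Rabs (a - b) * (quarter_period / 2).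
Definition scaled_reflected_gap (a b : R) : R := (2 - Rabs (a + b)) * (quarter_period / 2).

Lemma scaled_gap_range (a b : R) : -1 < a < 1 -> -1 < b < 1 ->
  0 <= scaled_gap a b < scaled_reflected_gap a b /\ scaled_reflected_gap a b <= quarter_period.
Proof.
  intros Ha Hb; pose proof quarter_period_pos as Hw.
  assert (H : Rabs (a - b) < 2 - Rabs (a + b)) by (unfold Rabs; repeat destruct Rcase_abs; lra).
  pose proof (Rabs_pos (a - b)); pose proof (Rabs_pos (a + b)).
  unfold scaled_gap, scaled_reflected_gap; split; [split|]; nra.
Qed.

Lemma lem_scaled_gap (a b : R) :
  lem ((a + 1) * (quarter_period / 2) - (b + 1) * (quarter_period / 2)) = lem (scaled_gap a b).
Proof.
  rewrite <- (lem_Rabs (_ - _)); f_equal; unfold scaled_gap.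
  replace ((a + 1) * (quarter_period / 2) - (b + 1) * (quarter_period / 2))
    with ((a - b) * (quarter_period / 2)) by ring.
  pose proof quarter_period_pos; rewrite Rabs_mult, (Rabs_pos_eq (quarter_period / 2)) by lra; reflexivity.
Qed.

Lemma lem_scaled_reflected_gap (a b : R) :
  lem ((a + 1) * (quarter_period / 2) + (b + 1) * (quarter_period / 2)) = lem (scaled_reflected_gap a b).
Proof.
  unfold scaled_reflected_gap, Rabs; destruct (Rcase_abs (a + b)) as [H|H].
  - f_equal; field.
  - rewrite <- lem_reflect; f_equal; field.
Qed.

Lemma disc_ratio_square_map (x y : C) : square x -> square y ->
  disc_ratio (square_map x) (square_map y) ^ 2
  = lem_cross_ratio (scaled_gap (Re x) (Re y)) (scaled_gap (Im x) (Im y))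
      (scaled_reflected_gap (Re x) (Re y)) (scaled_reflected_gap (Im x) (Im y)).
Proof.
  intros Hx Hy.
  pose proof (half_plane_map_Im_pos x Hx) as Ix; pose proof (half_plane_map_Im_pos y Hy) as Iy.
  destruct (square_to_quadrant_range x Hx) as [Rx1 Rx2].
  destruct (square_to_quadrant_range y Hy) as [Ry1 Ry2].
  pose proof (lem_cross_ratio_identity _ _ _ _ Rx1 Rx2 Ry1 Ry2) as HI.
  unfold square_map; rewrite disc_ratio_cayley by assumption.
  unfold Rdiv at 1; rewrite Rpow_mult_distr, pow_inv.
  set (W := half_plane_map (square_to_quadrant x)) in *.
  set (V := half_plane_map (square_to_quadrant y)) in *.
  assert (E1 : Cmod (W - V) ^ 2 = (Re W - Re V) ^ 2 + (Im W - Im V) ^ 2) by (rewrite Cmod_sq; reflexivity).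
  assert (E2 : Cmod (W - Cconj V) ^ 2 = (Re W - Re V) ^ 2 + (Im W + Im V) ^ 2).
  { rewrite Cmod_sq; change ((Re W - Re V) ^ 2 + (Im W - - Im V) ^ 2
      = (Re W - Re V) ^ 2 + (Im W + Im V) ^ 2); ring. }
  rewrite E1, E2.
  assert (Hden : 0 < (Re W - Re V) ^ 2 + (Im W + Im V) ^ 2).
  { pose proof (pow2_ge_0 (Re W - Re V)); nra. }
  apply square_iff in Hx; apply square_iff in Hy.
  destruct (scaled_gap_range (Re x) (Re y)) as [A1 A2]; try tauto.
  destruct (scaled_gap_range (Im x) (Im y)) as [B1 B2]; try tauto.
  change (Re (square_to_quadrant x)) with ((Re x + 1) * (quarter_period / 2)) in HI.
  change (Im (square_to_quadrant x)) with ((Im x + 1) * (quarter_period / 2)) in HI.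
  change (Re (square_to_quadrant y)) with ((Re y + 1) * (quarter_period / 2)) in HI.
  change (Im (square_to_quadrant y)) with ((Im y + 1) * (quarter_period / 2)) in HI.
  rewrite !lem_scaled_gap, !lem_scaled_reflected_gap in HI.
  change (((Re W - Re V) ^ 2 + (Im W - Im V) ^ 2) *
    ((lem (scaled_reflected_gap (Re x) (Re y)) + lem (scaled_gap (Im x) (Im y))) *
     (lem (scaled_gap (Re x) (Re y)) + lem (scaled_reflected_gap (Im x) (Im y))))
    = ((Re W - Re V) ^ 2 + (Im W + Im V) ^ 2) *
    ((lem (scaled_gap (Re x) (Re y)) + lem (scaled_gap (Im x) (Im y))) *
     (lem (scaled_reflected_gap (Re x) (Re y)) + lem (scaled_reflected_gap (Im x) (Im y))))) in HI.
  unfold lem_cross_ratio.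
  set (a := scaled_gap (Re x) (Re y)) in *; set (b := scaled_gap (Im x) (Im y)) in *.
  set (P := scaled_reflected_gap (Re x) (Re y)) in *; set (Q := scaled_reflected_gap (Im x) (Im y)) in *.
  assert (0 < lem P) by (apply lem_pos; lra); assert (0 < lem Q) by (apply lem_pos; lra).
  pose proof (lem_nonneg a); pose proof (lem_nonneg b).
  assert (Hd2 : 0 < (lem P + lem b) * (lem a + lem Q)) by (apply Rmult_lt_0_compat; lra).
  apply Rmult_eq_reg_r with (((Re W - Re V) ^ 2 + (Im W + Im V) ^ 2)
    * ((lem P + lem b) * (lem a + lem Q))); [|apply Rgt_not_eq, Rmult_lt_0_compat; lra].
  transitivity (((Re W - Re V) ^ 2 + (Im W - Im V) ^ 2) * ((lem P + lem b) * (lem a + lem Q)));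
    [field; lra|].
  rewrite HI; field; split; lra.
Qed.

(** The squared distance from [x] to the nearest reflection of [y] in a side. *)
Definition reflected_distance_sq (x y : C) : R :=
  Rmin ((2 - Rabs (Re x + Re y)) ^ 2 + (Im x - Im y) ^ 2)
       ((Re x - Re y) ^ 2 + (2 - Rabs (Im x + Im y)) ^ 2).

Lemma reflected_distance_sq_pos (x y : C) : square x -> square y -> 0 < reflected_distance_sq x y.
Proof.
  intros Hx Hy; apply square_iff in Hx; apply square_iff in Hy.
  assert (0 < 2 - Rabs (Re x + Re y)) by (unfold Rabs; destruct Rcase_abs; lra).
  assert (0 < 2 - Rabs (Im x + Im y)) by (unfold Rabs; destruct Rcase_abs; lra).
  pose proof (pow2_ge_0 (Re x - Re y)); pose proof (pow2_ge_0 (Im x - Im y)).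
  apply Rmin_glb_lt; nra.
Qed.

(** In these inequalities, scaled by [quarter_period / 2], the symmetric form of the
    cross-ratio covers the case in which a horizontal side is the nearer one. *)
Lemma square_map_bounds (x y : C) : square x -> square y ->
  Cmod (x - y) ^ 2 / reflected_distance_sq x y <= disc_ratio (square_map x) (square_map y) ^ 2
  <= 2 * quarter_period ^ 2 * (Cmod (x - y) ^ 2 / reflected_distance_sq x y).
Proof.
  intros Hx Hy; pose proof (reflected_distance_sq_pos x y Hx Hy) as HM.
  rewrite disc_ratio_square_map by assumption.
  apply square_iff in Hx; apply square_iff in Hy.
  destruct (scaled_gap_range (Re x) (Re y)) as [A1 A2]; try tauto.
  destruct (scaled_gap_range (Im x) (Im y)) as [B1 B2]; try tauto.
  pose proof quarter_period_pos as Hw.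
  set (a := scaled_gap (Re x) (Re y)) in *; set (b := scaled_gap (Im x) (Im y)) in *.
  set (P := scaled_reflected_gap (Re x) (Re y)) in *; set (Q := scaled_reflected_gap (Im x) (Im y)) in *.
  set (k := (quarter_period / 2) ^ 2); assert (Hk : 0 < k) by (apply pow_lt; lra).
  assert (Ea : a ^ 2 = k * (Re x - Re y) ^ 2).
  { unfold a, scaled_gap, k; rewrite Rpow_mult_distr, pow2_abs; ring. }
  assert (Eb : b ^ 2 = k * (Im x - Im y) ^ 2).
  { unfold b, scaled_gap, k; rewrite Rpow_mult_distr, pow2_abs; ring. }
  assert (EP : P ^ 2 = k * (2 - Rabs (Re x + Re y)) ^ 2).
  { unfold P, scaled_reflected_gap, k; ring. }
  assert (EQ : Q ^ 2 = k * (2 - Rabs (Im x + Im y)) ^ 2).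
  { unfold Q, scaled_reflected_gap, k; ring. }
  assert (Ed : Cmod (x - y) ^ 2 = (Re x - Re y) ^ 2 + (Im x - Im y) ^ 2)
    by (rewrite Cmod_sq; reflexivity).
  rewrite Ed; unfold reflected_distance_sq in *.
  set (M1 := (2 - Rabs (Re x + Re y)) ^ 2 + (Im x - Im y) ^ 2) in *.
  set (M2 := (Re x - Re y) ^ 2 + (2 - Rabs (Im x + Im y)) ^ 2) in *.
  set (D := (Re x - Re y) ^ 2 + (Im x - Im y) ^ 2) in *.
  assert (S0 : a ^ 2 + b ^ 2 = k * D) by (rewrite Ea, Eb; unfold D; ring).
  assert (S1 : P ^ 2 + b ^ 2 = k * M1) by (rewrite EP, Eb; unfold M1; ring).
  assert (S2 : a ^ 2 + Q ^ 2 = k * M2) by (rewrite EQ, Ea; unfold M2; ring).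
  destruct (Rle_dec M1 M2) as [Hle|Hgt].
  - rewrite Rmin_left in * by exact Hle; split.
    + replace (D / M1) with ((a ^ 2 + b ^ 2) / (P ^ 2 + b ^ 2)) by (rewrite S0, S1; field; lra).
      apply lem_cross_ratio_ge; tauto.
    + pose proof (lem_cross_ratio_le a b P Q A1 A2 B1 B2) as H.
      rewrite S1, S2, S0 in H; specialize (H ltac:(nra)).
      apply Rmult_le_reg_r with (k * M1); [nra|].
      replace (2 * quarter_period ^ 2 * (D / M1) * (k * M1)) with (2 * quarter_period ^ 2 * (k * D))
        by (field; lra).
      exact H.
  - rewrite Rmin_right in * by lra; rewrite lem_cross_ratio_sym; split.
    + replace (D / M2) with ((b ^ 2 + a ^ 2) / (Q ^ 2 + a ^ 2))
        by (rewrite (Rplus_comm (Q ^ 2)), (Rplus_comm (b ^ 2)), S0, S2; field; lra).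
      apply lem_cross_ratio_ge; tauto.
    + pose proof (lem_cross_ratio_le b a Q P B1 B2 A1 A2) as H.
      rewrite (Rplus_comm (Q ^ 2)), (Rplus_comm (b ^ 2) (P ^ 2)), (Rplus_comm (b ^ 2)), S1, S2, S0 in H.
      specialize (H ltac:(nra)).
      apply Rmult_le_reg_r with (k * M2); [nra|].
      replace (2 * quarter_period ^ 2 * (D / M2) * (k * M2)) with (2 * quarter_period ^ 2 * (k * D))
        by (field; lra).
      exact H.
Qed.

Lemma square_0 : square 0.
Proof. split; simpl; rewrite Rabs_R0; lra. Qed.

Lemma square_map_0 : square_map 0 = 0.
Proof.
  pose proof quarter_period_pos as Hw.
  assert (E : half_plane_map (square_to_quadrant 0) = Ci).
  { unfold half_plane_map, square_to_quadrant; simpl.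
    replace ((0 + 1) * (quarter_period / 2)) with (quarter_period / 2) by ring.
    pose proof (lem_product_lt_1 (quarter_period / 2) (quarter_period / 2) ltac:(lra) ltac:(lra)) as Hp.
    pose proof lem_at_half_quarter_period as Hf; pose proof (lem_curve (quarter_period / 2)) as Hc.
    pose proof (pow2_sqrt 2 ltac:(lra)) as Hr.
    unfold Ci; apply injective_projections; simpl.
    - unfold lem_re; field; lra.
    - unfold lem_im; set (f := lem (quarter_period / 2)) in *.
      replace (2 * lem_half_deriv (quarter_period / 2) * lem_half_deriv (quarter_period / 2))
        with (2 * lem_half_deriv (quarter_period / 2) ^ 2) by ring.
      rewrite Hc.
      assert (Hf2 : f * f = 1 - 2 * f).
      { rewrite Hf; transitivity (sqrt 2 ^ 2 - 2 * sqrt 2 + 1); [ring | lra]. }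
      replace (2 * (f - f ^ 3)) with (2 * f * (1 - f * f)) by ring.
      replace (2 * f) with (1 - f * f) by lra; field; lra. }
  unfold square_map, cayley; rewrite E; unfold Cdiv; ring.
Qed.

Lemma square_map_injective (z w : C) :
  square z -> square w -> square_map z = square_map w -> z = w.
Proof.
  intros Hz Hw E; destruct (square_map_bounds z w Hz Hw) as [H _].
  pose proof (reflected_distance_sq_pos z w Hz Hw) as HM.
  rewrite E in H; unfold disc_ratio in H.
  replace (square_map w - square_map w)%C with (RtoC 0) in H by ring.
  rewrite Cmod_0 in H; unfold Rdiv at 2 in H; rewrite Rmult_0_l in H.
  assert (H0 : Cmod (z - w) ^ 2 <= 0).
  { apply Rmult_le_reg_r with (/ reflected_distance_sq z w); [apply Rinv_0_lt_compat, HM|].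
    unfold Rdiv in H; simpl in H |- *; lra. }
  pose proof (Cmod_ge_0 (z - w)).
  assert (Hzw : Cmod (z - w) = 0) by nra.
  apply Cmod_eq_0 in Hzw; replace z with (z - w + w)%C by ring; rewrite Hzw; ring.
Qed.

(** [|square_map z|] is the pseudo-hyperbolic distance to the centre, and thus at
    least the triangular ratio, which tends to [1] at the boundary. *)
Lemma square_map_exhausts : exhausts_square square_map.
Proof.
  intros rho Hrho.
  destruct (Rlt_le_dec rho 0) as [Hneg|Hpos].
  { exists 0; split; [lra|]; intros z _ H; pose proof (Cmod_ge_0 (square_map z)); lra. }
  exists (2 * rho / (1 + rho)); split; [apply Rlt_div_l; lra|].
  intros z Hz Hr.
  destruct (square_map_bounds z 0 Hz square_0) as [H _].
  pose proof (reflected_distance_sq_pos z 0 Hz square_0) as HM.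
  assert (E : disc_ratio (square_map z) (square_map 0) = Cmod (square_map z)).
  { unfold disc_ratio; rewrite square_map_0.
    replace (square_map z - 0)%C with (square_map z) by ring.
    replace (1 - square_map z * Cconj 0)%C with (RtoC 1).
    - rewrite Cmod_1; field.
    - replace (Cconj 0) with (RtoC 0) by (apply injective_projections; simpl; ring); ring. }
  rewrite E in H.
  assert (H1 : Cmod (square_map z) ^ 2 <= rho ^ 2) by (apply pow_incr; split; [apply Cmod_ge_0 | exact Hr]).
  assert (H2 : Cmod (z - 0) ^ 2 <= rho ^ 2 * reflected_distance_sq z 0).
  { apply Rmult_le_reg_r with (/ reflected_distance_sq z 0); [apply Rinv_0_lt_compat, HM|].
    rewrite Rmult_assoc, Rinv_r, Rmult_1_r by lra; unfold Rdiv in H; lra. }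
  replace (z - 0)%C with z in H2 by ring; rewrite Cmod_sq in H2.
  unfold reflected_distance_sq in H2; change (Re 0) with 0 in H2; change (Im 0) with 0 in H2.
  rewrite !Rplus_0_r, !Rminus_0_r in H2.
  set (M1 := (2 - Rabs (Re z)) ^ 2 + Im z ^ 2) in *; set (M2 := Re z ^ 2 + (2 - Rabs (Im z)) ^ 2) in *.
  pose proof (Rmin_l M1 M2) as L1; pose proof (Rmin_r M1 M2) as L2.
  assert (Hr2 : rho ^ 2 <= 1) by nra.
  assert (Hcoord : forall u v, 0 <= u < 1 -> u ^ 2 + v ^ 2 <= rho ^ 2 * ((2 - u) ^ 2 + v ^ 2) ->
            u <= 2 * rho / (1 + rho)).
  { intros u v Hu Huv; apply Rle_div_r; [lra|].
    pose proof (pow2_ge_0 v); pose proof (pow2_ge_0 rho).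
    assert (Hs : u ^ 2 <= (rho * (2 - u)) ^ 2) by nra.
    assert (u <= rho * (2 - u)).
    { apply Rnot_lt_le; intros Hlt; assert (0 <= rho * (2 - u)) by nra; nra. }
    lra. }
  destruct Hz as [Hz1 Hz2].
  split.
  - apply (Hcoord (Rabs (Re z)) (Im z)); [pose proof (Rabs_pos (Re z)); lra|].
    rewrite pow2_abs; eapply Rle_trans; [exact H2|]; apply Rmult_le_compat_l; [nra | exact L1].
  - apply (Hcoord (Rabs (Im z)) (Re z)); [pose proof (Rabs_pos (Im z)); lra|].
    rewrite pow2_abs, Rplus_comm; eapply Rle_trans; [exact H2|].
    apply Rmult_le_compat_l; [nra|]; rewrite Rplus_comm; exact L2.
Qed.

Theorem square_map_conformal : conformal_bijection square unit_disc square_map.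
Proof.
  apply conformal_bijection_square; split; [apply square_map_to_disc|].
  split; [apply square_map_injective|].
  apply exhausting_map_surjective; [apply square_map_to_disc | apply square_map_exhausts].
Qed.


(** * The complete elliptic integral *)

Lemma is_derive_acos (t : R) : -1 < t < 1 -> is_derive acos t (- / sqrt (1 - t ^ 2)).
Proof.
  intros Ht; apply is_derive_Reals.
  pose proof (derive_pt_acos t Ht) as H.
  replace (- / sqrt (1 - t ^ 2)) with (derive_pt acos t (derivable_pt_acos t Ht)).
  - apply derive_pt_eq_1 with (derivable_pt_acos t Ht); reflexivity.
  - rewrite H; replace (1 - t²) with (1 - t ^ 2) by (unfold Rsqr; ring); unfold Rdiv; ring.
Qed.

Lemma acos_filterlim_1 : filterlim (fun t => lemniscate_time (acos t)) (at_left 1) (locally 0).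
Proof.
  apply filterlim_locally; intros eps.
  pose proof PI_RGT_0 as Hpi.
  set (e := Rmin eps 1).
  assert (He : 0 < e) by (apply Rmin_glb_lt; [apply cond_pos | lra]).
  assert (He1 : e <= 1) by apply Rmin_r.
  assert (Hee : e <= eps) by apply Rmin_l.
  assert (Hc : cos e < 1).
  { rewrite <- cos_0; apply cos_decreasing_1; pose proof PI2_1; lra. }
  assert (Hd : 0 < 1 - cos e) by lra.
  exists (mkposreal _ Hd); intros t Ht Ht1.
  change (Rabs (t - 1) < 1 - cos e) in Ht; apply Rabs_lt_between in Ht.
  change (Rabs (lemniscate_time (acos t) - 0) < eps).
  pose proof (COS_bound e).
  destruct (acos_bound t) as [A0 A1].
  assert (Hlt : acos t < e).
  { apply Rnot_le_lt; intros Hle.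
    assert (Hcos : cos (acos t) <= cos e).
    { destruct Hle as [Hle| <-]; [|lra].
      apply Rlt_le, cos_decreasing_1; pose proof PI2_1; lra. }
    rewrite cos_acos in Hcos by lra; lra. }
  pose proof (lemniscate_time_bounds 0 (acos t) A0) as B.
  rewrite lemniscate_time_0 in B; rewrite Rabs_pos_eq; lra.
Qed.

(** Substitute [t = cos th]: the modulus [sqrt 2 / 2] is that of the lemniscate. *)
Lemma ellipticK_lemniscate : ellipticK (sqrt 2 / 2) = sqrt 2 * quarter_period.
Proof.
  unfold ellipticK; apply is_RInt_gen_unique.
  set (psi := fun t => sqrt 2 * (quarter_period - lemniscate_time (acos t))).
  set (g := fun t => / sqrt ((1 - t ^ 2) * (1 - (sqrt 2 / 2) ^ 2 * t ^ 2))).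
  assert (Hg : forall t, g t = / sqrt ((1 - t ^ 2) * (1 - / 2 * t ^ 2))).
  { intros t; unfold g; do 4 f_equal; f_equal.
    replace ((sqrt 2 / 2) ^ 2) with (sqrt 2 ^ 2 / 4) by field.
    rewrite pow2_sqrt by lra; f_equal; field. }
  assert (Hpos : forall t, -1 < t < 1 -> 0 < (1 - t ^ 2) * (1 - / 2 * t ^ 2)).
  { intros t Ht; apply Rmult_lt_0_compat; nra. }
  assert (Hd : forall t, -1 < t < 1 -> is_derive psi t (g t)).
  { intros t Ht; unfold psi; evar_last.
    - apply (is_derive_scal (fun t => quarter_period - lemniscate_time (acos t))).
      apply (is_derive_minus (fun _ => quarter_period) (fun t => lemniscate_time (acos t)));
        [apply is_derive_const|].
      apply (is_derive_comp lemniscate_time acos);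
        [apply is_derive_lemniscate_time | apply is_derive_acos, Ht].
    - change (sqrt 2 * (0 - - / sqrt (1 - t ^ 2) * / lemniscate_speed (acos t)) = g t).
      rewrite Hg; unfold lemniscate_speed; rewrite sin_acos by lra.
      replace (1 - t²) with (1 - t ^ 2) by (unfold Rsqr; ring).
      rewrite pow2_sqrt by nra.
      replace (1 - / 2 * t ^ 2) with ((1 + (1 - t ^ 2)) * / 2) by field.
      rewrite !sqrt_mult_alt by nra.
      rewrite sqrt_inv.
      assert (0 < sqrt 2) by (apply sqrt_lt_R0; lra).
      assert (0 < sqrt (1 - t ^ 2)) by (apply sqrt_lt_R0; nra).
      assert (0 < sqrt (1 + (1 - t ^ 2))) by (apply sqrt_lt_R0; nra).
      field; lra. }
  assert (Hgc : forall t, -1 < t < 1 -> continuous g t).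
  { intros t Ht; apply (ex_derive_continuous (K := R_AbsRing) (V := R_NormedModule)).
    apply (ex_derive_ext (fun t => / sqrt ((1 - t ^ 2) * (1 - / 2 * t ^ 2)))).
    - intros u; symmetry; apply Hg.
    - specialize (Hpos t Ht).
      assert (0 < sqrt ((1 - t ^ 2) * (1 - / 2 * t ^ 2))) by (apply sqrt_lt_R0, Hpos).
      auto_derive; split; [exact Hpos | split; [apply Rgt_not_eq; exact H | exact I]]. }
  assert (Hrange : forall b t : R, 0 < b < 1 -> Rmin 0 b <= t <= Rmax 0 b -> -1 < t < 1).
  { intros b t Hb Ht; rewrite Rmin_left, Rmax_right in Ht by lra; lra. }
  assert (Hnear : at_left 1 (fun b => 0 < b < 1)).
  { exists posreal_one; intros b Hb Hb1.
    change (Rabs (b - 1) < 1) in Hb; apply Rabs_lt_between in Hb; lra. }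
  assert (Hext : is_RInt_gen (Derive psi) (at_point 0) (at_left 1) (sqrt 2 * quarter_period - 0)).
  { apply is_RInt_gen_Derive.
    - exists (fun a => a = 0) (fun b => 0 < b < 1); [reflexivity | exact Hnear|].
      intros a b -> Hb t Ht; eexists; apply Hd, (Hrange b t Hb Ht).
    - exists (fun a => a = 0) (fun b => 0 < b < 1); [reflexivity | exact Hnear|].
      intros a b -> Hb t Ht; pose proof (Hrange b t Hb Ht) as Ht1.
      apply (continuous_ext_loc _ g); [|apply Hgc, Ht1].
      assert (Hdl : 0 < Rmin (t + 1) (1 - t)) by (apply Rmin_glb_lt; lra).
      exists (mkposreal _ Hdl); intros s Hs; change (Rabs (s - t) < Rmin (t + 1) (1 - t)) in Hs.
      pose proof (Rmin_l (t + 1) (1 - t)); pose proof (Rmin_r (t + 1) (1 - t)).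
      apply Rabs_lt_between in Hs; symmetry; apply is_derive_unique, Hd; lra.
    - assert (E : psi 0 = 0).
      { unfold psi; rewrite acos_0; fold quarter_period; ring. }
      rewrite <- E at 2; intros A HA; unfold filtermap, at_point.
      apply locally_singleton, HA.
    - unfold psi.
      replace (sqrt 2 * quarter_period) with (sqrt 2 * (quarter_period - 0)) by ring.
      apply (filterlim_comp _ _ _ (fun t => lemniscate_time (acos t))
        (fun v => sqrt 2 * (quarter_period - v)) (at_left 1) (locally 0)); [apply acos_filterlim_1|].
      apply (ex_derive_continuous (K := R_AbsRing) (V := R_NormedModule)
        (fun v => sqrt 2 * (quarter_period - v)) 0).
      auto_derive; exact I. }
  rewrite Rminus_0_r in Hext.
  refine (is_RInt_gen_ext _ _ _ _ Hext).
  exists (fun a => a = 0) (fun b => 0 < b < 1); [reflexivity | exact Hnear|].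
  intros a b -> Hb t Ht.
  apply is_derive_unique, Hd, (Hrange b t Hb); simpl in Ht; lra.
Qed.

(** * The value of the elliptic integral *)

(** Coefficients [binomial (2 k) k / 4 ^ k] of [1 / sqrt (1 - y)]. *)
Fixpoint inv_sqrt_coef (k : nat) : R :=
  match k with
  | O => 1
  | S j => inv_sqrt_coef j * (INR j + / 2) / (INR j + 1)
  end.

Fixpoint inv_sqrt_poly (n : nat) (y : R) : R :=
  match n with
  | O => 1
  | S j => inv_sqrt_poly j y + inv_sqrt_coef (S j) * y ^ S j
  end.

Fixpoint inv_sqrt_poly' (n : nat) (y : R) : R :=
  match n with
  | O => 0
  | S j => inv_sqrt_poly' j y + inv_sqrt_coef (S j) * (INR (S j) * y ^ j)
  end.

(** [s * arcsl_poly n (s ^ 4)] is the Taylor polynomial of the inverse of [sl]. *)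
Fixpoint arcsl_poly (n : nat) (y : R) : R :=
  match n with
  | O => 1
  | S j => arcsl_poly j y + inv_sqrt_coef (S j) / (4 * INR (S j) + 1) * y ^ S j
  end.

Lemma inv_sqrt_coef_pos (k : nat) : 0 < inv_sqrt_coef k.
Proof.
  induction k as [|k IH]; simpl inv_sqrt_coef; [lra|].
  pose proof (pos_INR k); apply Rdiv_lt_0_compat; nra.
Qed.

Lemma is_derive_inv_sqrt_poly (n : nat) (y : R) :
  is_derive (inv_sqrt_poly n) y (inv_sqrt_poly' n y).
Proof.
  induction n as [|n IH].
  - apply (is_derive_const (K := R_AbsRing) (V := R_NormedModule) 1 y).
  - apply (is_derive_plus (inv_sqrt_poly n) (fun y => inv_sqrt_coef (S n) * y ^ S n)); [exact IH|].
    apply is_derive_scal; evar_last; [apply (is_derive_pow (fun y => y)), is_derive_id_R|].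
    simpl pred; ring.
Qed.

Lemma inv_sqrt_poly_ode (n : nat) (y : R) :
  (1 - y) * inv_sqrt_poly' n y - inv_sqrt_poly n y / 2
  = - (INR n + / 2) * inv_sqrt_coef n * y ^ n.
Proof.
  induction n as [|n IH]; [simpl; field|].
  change ((1 - y) * (inv_sqrt_poly' n y + inv_sqrt_coef (S n) * (INR (S n) * y ^ n))
    - (inv_sqrt_poly n y + inv_sqrt_coef (S n) * (y * y ^ n)) / 2
    = - (INR (S n) + / 2) * inv_sqrt_coef (S n) * (y * y ^ n)).
  replace ((1 - y) * (inv_sqrt_poly' n y + inv_sqrt_coef (S n) * (INR (S n) * y ^ n))
    - (inv_sqrt_poly n y + inv_sqrt_coef (S n) * (y * y ^ n)) / 2)
    with (((1 - y) * inv_sqrt_poly' n y - inv_sqrt_poly n y / 2)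
      + inv_sqrt_coef (S n) * ((1 - y) * (INR (S n) * y ^ n) - (y * y ^ n) / 2)) by field.
  rewrite IH, S_INR; simpl inv_sqrt_coef; pose proof (pos_INR n); field; lra.
Qed.

Definition arcsl_speed (n : nat) (u : R) : R := sl' u * inv_sqrt_poly n (sl u ^ 4).

Lemma is_derive_arcsl_poly_sl (n : nat) (u : R) :
  is_derive (fun u => sl u * arcsl_poly n (sl u ^ 4)) u (arcsl_speed n u).
Proof.
  induction n as [|n IH].
  - unfold arcsl_speed; simpl arcsl_poly; simpl inv_sqrt_poly.
    apply (is_derive_ext sl); [intros t; symmetry; apply Rmult_1_r|].
    rewrite Rmult_1_r; apply is_derive_sl.
  - apply (is_derive_ext (fun u => sl u * arcsl_poly n (sl u ^ 4)
      + inv_sqrt_coef (S n) / (4 * INR (S n) + 1) * sl u ^ (4 * S n + 1))).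
    { intros t; change (sl t * arcsl_poly n (sl t ^ 4)
        + inv_sqrt_coef (S n) / (4 * INR (S n) + 1) * sl t ^ (4 * S n + 1)
        = sl t * (arcsl_poly n (sl t ^ 4)
          + inv_sqrt_coef (S n) / (4 * INR (S n) + 1) * (sl t ^ 4) ^ S n)).
      rewrite pow_add, pow_mult, pow_1; ring. }
    replace (arcsl_speed (S n) u) with (arcsl_speed n u
      + inv_sqrt_coef (S n) / (4 * INR (S n) + 1)
        * (INR (4 * S n + 1) * sl' u * sl u ^ pred (4 * S n + 1))).
    { apply (is_derive_plus (fun u => sl u * arcsl_poly n (sl u ^ 4))
        (fun u => inv_sqrt_coef (S n) / (4 * INR (S n) + 1) * sl u ^ (4 * S n + 1))); [exact IH|].
      apply (is_derive_scal (fun u => sl u ^ (4 * S n + 1))).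
      apply is_derive_pow, is_derive_sl. }
    rewrite plus_INR, mult_INR.
    replace (pred (4 * S n + 1)) with (4 * S n)%nat by lia.
    rewrite pow_mult; unfold arcsl_speed.
    change (inv_sqrt_poly (S n) (sl u ^ 4))
      with (inv_sqrt_poly n (sl u ^ 4) + inv_sqrt_coef (S n) * (sl u ^ 4) ^ S n).
    pose proof (pos_INR (S n)).
    replace (INR 4) with 4 by (simpl; ring); replace (INR 1) with 1 by reflexivity.
    field; lra.
Qed.

(** [arcsl_speed] is [sqrt (1 - y) * inv_sqrt_poly n y] at [y = sl u ^ 4], whose
    derivative in [y] is negative by [inv_sqrt_poly_ode]. *)
Lemma arcsl_speed_decreasing (n : nat) (a b : R) :
  0 <= a <= b -> b <= quarter_period -> arcsl_speed n b <= arcsl_speed n a.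
Proof.
  intros Ha Hb; apply Ropp_le_cancel.
  apply (nonneg_derivative_increasing (fun u => - arcsl_speed n u)
    (fun u => 4 * sl u ^ 3 * ((INR n + / 2) * inv_sqrt_coef n * (sl u ^ 4) ^ n))); [lra| |].
  - intros u Hu; unfold arcsl_speed; evar_last.
    + apply (is_derive_opp (fun u => sl' u * inv_sqrt_poly n (sl u ^ 4))).
      apply (is_derive_mult sl' (fun u => inv_sqrt_poly n (sl u ^ 4)));
        [apply is_derive_sl' | | intros; apply Rmult_comm].
      apply (is_derive_comp (inv_sqrt_poly n) (fun u => sl u ^ 4));
        [apply is_derive_inv_sqrt_poly | apply is_derive_pow, is_derive_sl].
    + pose proof (inv_sqrt_poly_ode n (sl u ^ 4)) as Ho.
      change (- (- 2 * sl u ^ 3 * inv_sqrt_poly n (sl u ^ 4)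
        + sl' u * (INR 4 * sl' u * sl u ^ 3 * inv_sqrt_poly' n (sl u ^ 4)))
        = 4 * sl u ^ 3 * ((INR n + / 2) * inv_sqrt_coef n * (sl u ^ 4) ^ n)).
      replace (INR 4) with 4 by (simpl; ring).
      transitivity (- (4 * sl u ^ 3 * (sl' u ^ 2 * inv_sqrt_poly' n (sl u ^ 4)
        - inv_sqrt_poly n (sl u ^ 4) / 2))); [field|].
      rewrite sl'_sq, Ho; ring.
  - intros u Hu; pose proof (sl_nonneg u ltac:(lra)) as Hs.
    pose proof (inv_sqrt_coef_pos n); pose proof (pos_INR n).
    repeat apply Rmult_le_pos; try lra; try (apply pow_le; assumption).
    apply pow_le, pow_le, Hs.
Qed.

Lemma arcsl_speed_0 (n : nat) : arcsl_speed n 0 = 1.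
Proof.
  unfold arcsl_speed; rewrite sl_0.
  assert (Hs : sl' 0 = 1).
  { unfold sl', lemniscate_speed; rewrite amplitude_0, cos_0, sin_0.
    replace (1 + 0 ^ 2) with 1 by ring; rewrite sqrt_1; ring. }
  assert (Hp : inv_sqrt_poly n (0 ^ 4) = 1).
  { replace (0 ^ 4) with 0 by ring.
    induction n as [|n IH]; [reflexivity|].
    change (inv_sqrt_poly n 0 + inv_sqrt_coef (S n) * 0 ^ S n = 1).
    rewrite IH, pow_i by lia; ring. }
  rewrite Hs, Hp; ring.
Qed.

(** The speed [d / du] of the Taylor polynomial along [sl] decreases from [1],
    so its value at the end of [[0, u]] controls the error from both sides. *)
Lemma arcsl_poly_bounds (n : nat) (u : R) :
  0 <= u <= quarter_period ->
  u * arcsl_speed n u <= sl u * arcsl_poly n (sl u ^ 4) <= u.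
Proof.
  intros Hu.
  destruct (mean_value_theorem (fun u => sl u * arcsl_poly n (sl u ^ 4)) (arcsl_speed n) 0 u)
    as [c [Hc E]]; [lra | intros t _; apply is_derive_arcsl_poly_sl|].
  simpl in E; rewrite sl_0, Rmult_0_l, !Rminus_0_r in E.
  pose proof (arcsl_speed_decreasing n 0 c ltac:(lra) ltac:(lra)) as H1.
  pose proof (arcsl_speed_decreasing n c u ltac:(lra) ltac:(lra)) as H2.
  rewrite arcsl_speed_0 in H1.
  change (sl u * arcsl_poly n (sl u ^ 4) = arcsl_speed n c * u) in E.
  rewrite E; split; [rewrite Rmult_comm|]; nra.
Qed.

Lemma arcsl_poly_monotone (n : nat) (x y : R) :
  0 <= x <= y -> arcsl_poly n x <= arcsl_poly n y.
Proof.
  intros H; induction n as [|n IH]; [simpl; lra|].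
  change (arcsl_poly n x + inv_sqrt_coef (S n) / (4 * INR (S n) + 1) * x ^ S n
    <= arcsl_poly n y + inv_sqrt_coef (S n) / (4 * INR (S n) + 1) * y ^ S n).
  apply Rplus_le_compat; [exact IH|]; apply Rmult_le_compat_l; [|apply pow_incr; lra].
  pose proof (inv_sqrt_coef_pos (S n)); pose proof (pos_INR (S n)).
  apply Rdiv_le_0_compat; lra.
Qed.

Lemma inv_sqrt_poly_monotone (n : nat) (x y : R) :
  0 <= x <= y -> inv_sqrt_poly n x <= inv_sqrt_poly n y.
Proof.
  intros H; induction n as [|n IH]; [simpl; lra|].
  change (inv_sqrt_poly n x + inv_sqrt_coef (S n) * x ^ S n
    <= inv_sqrt_poly n y + inv_sqrt_coef (S n) * y ^ S n).
  apply Rplus_le_compat; [exact IH|]; apply Rmult_le_compat_l; [|apply pow_incr; lra].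
  apply Rlt_le, inv_sqrt_coef_pos.
Qed.

Lemma sqrt2_bounds : 1.4142135623730 < sqrt 2 < 1.4142135623731.
Proof.
  split.
  - rewrite <- (sqrt_pow2 1.4142135623730) by lra; apply sqrt_lt_1; lra.
  - rewrite <- (sqrt_pow2 1.4142135623731) by lra; apply sqrt_lt_1; lra.
Qed.

(** Half of [quarter_period] is [arcsl (sqrt (sqrt 2 - 1))], where the fourth
    power of the argument is [3 - 2 sqrt 2 < 0.18], and thirteen terms of the Taylor
    series determine ten decimals. *)
Lemma ellipticK_bounds : 1.854074677 <= ellipticK (sqrt 2 / 2) < 1.854074678.
Proof.
  rewrite ellipticK_lemniscate.
  pose proof sqrt2_bounds as Hr; pose proof (pow2_sqrt 2 ltac:(lra)) as Hr2.
  pose proof quarter_period_pos as Hw.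
  pose proof (arcsl_poly_bounds 12 (quarter_period / 2) ltac:(lra)) as Hb.
  unfold arcsl_speed in Hb.
  pose proof (sl_nonneg (quarter_period / 2) ltac:(lra)) as Hs0.
  pose proof (sl'_nonneg (quarter_period / 2) ltac:(lra)) as Hs'0.
  pose proof (sl'_sq (quarter_period / 2)) as Hs'.
  pose proof lem_at_half_quarter_period as Hf; unfold lem in Hf.
  set (s := sl (quarter_period / 2)) in *; set (s' := sl' (quarter_period / 2)) in *.
  set (r := sqrt 2) in *; set (w := quarter_period) in *.
  assert (Hy : s ^ 4 = 3 - 2 * r).
  { replace (s ^ 4) with ((s ^ 2) ^ 2) by ring; rewrite Hf.
    replace ((r - 1) ^ 2) with (r ^ 2 - 2 * r + 1) by ring; rewrite Hr2; ring. }
  rewrite Hy in *; set (y := 3 - 2 * r) in *.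
  assert (Hyb : 0.1715728752538 <= y <= 0.1715728752540) by (unfold y; lra).
  assert (A1 : 1.0185211965665 <= arcsl_poly 12 y).
  { apply Rle_trans with (arcsl_poly 12 0.1715728752538); [|apply arcsl_poly_monotone; lra].
    simpl; lra. }
  assert (A2 : arcsl_poly 12 y <= 1.0185211965667).
  { apply Rle_trans with (arcsl_poly 12 0.1715728752540); [apply arcsl_poly_monotone; lra|].
    simpl; lra. }
  assert (A3 : 1.0986841134470 <= inv_sqrt_poly 12 y).
  { apply Rle_trans with (inv_sqrt_poly 12 0.1715728752538); [|apply inv_sqrt_poly_monotone; lra].
    simpl; lra. }
  set (A := arcsl_poly 12 y) in *; set (T := inv_sqrt_poly 12 y) in *.
  assert (HrS : 0.4142135623730 <= s ^ 2 <= 0.4142135623731) by lra.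
  assert (HT2 : 1.0986841134470 ^ 2 * (1 - 0.1715728752540) <= (s' * T) ^ 2).
  { rewrite Rpow_mult_distr, Hs', Rmult_comm.
    apply Rmult_le_compat; [lra | nra | lra | apply pow_incr; lra]. }
  assert (HA1 : 1.0185211965665 ^ 2 <= A ^ 2) by (apply pow_incr; lra).
  assert (HA2 : A ^ 2 <= 1.0185211965667 ^ 2) by (apply pow_incr; lra).
  assert (HsA1 : 0.4142135623730 * 1.0185211965665 ^ 2 <= (s * A) ^ 2).
  { rewrite Rpow_mult_distr; apply Rmult_le_compat; lra. }
  assert (HsA2 : (s * A) ^ 2 <= 0.4142135623731 * 1.0185211965667 ^ 2).
  { rewrite Rpow_mult_distr; apply Rmult_le_compat; try lra; apply pow2_ge_0. }
  assert (Hrw : (r * w) ^ 2 = 8 * (w / 2) ^ 2).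
  { rewrite Rpow_mult_distr, Hr2; field. }
  assert (HrwP : 0 < r * w) by (apply Rmult_lt_0_compat; lra).
  split.
  - assert (H : (s * A) ^ 2 <= (w / 2) ^ 2).
    { apply pow_incr; split; [apply Rmult_le_pos; lra | lra]. }
    apply Rnot_lt_le; intros Hlt; nra.
  - assert (H : (w / 2 * (s' * T)) ^ 2 <= (s * A) ^ 2).
    { apply pow_incr; split; [|lra].
      apply Rmult_le_pos; [lra | apply Rmult_le_pos; lra]. }
    rewrite Rpow_mult_distr in H.
    apply Rnot_le_lt; intros Hle.
    assert (H1 : 1.854074678 ^ 2 <= 8 * (w / 2) ^ 2) by (rewrite <- Hrw; apply pow_incr; lra).
    assert (H2 : (w / 2) ^ 2 * (1.0986841134470 ^ 2 * (1 - 0.1715728752540)) <= (s * A) ^ 2).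
    { eapply Rle_trans; [|exact H]; apply Rmult_le_compat_l; [apply pow2_ge_0 | exact HT2]. }
    lra.
Qed.

(** * The two metrics *)

Lemma tanh_artanh (t : R) : 0 <= t < 1 -> tanh (2 * artanh t / 2) = t.
Proof.
  intros Ht; unfold artanh.
  assert (Hq : 0 < (1 + t) / (1 - t)) by (apply Rdiv_lt_0_compat; lra).
  set (v := ln ((1 + t) / (1 - t)) / 2).
  assert (Ev : exp v * exp v = (1 + t) / (1 - t)).
  { rewrite <- exp_plus; unfold v.
    replace (ln ((1 + t) / (1 - t)) / 2 + ln ((1 + t) / (1 - t)) / 2)
      with (ln ((1 + t) / (1 - t))) by field.
    apply exp_ln, Hq. }
  replace (2 * v / 2) with v by field.
  pose proof (exp_pos v) as Hp.
  unfold tanh, sinh, cosh; rewrite exp_Ropp.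
  replace ((exp v - / exp v) / 2 / ((exp v + / exp v) / 2))
    with ((exp v * exp v - 1) / (exp v * exp v + 1)) by (field; repeat split; nra).
  rewrite Ev; field; lra.
Qed.

Lemma tanh_hyperbolic_dist (x y : C) : square x -> square y ->
  tanh (hyperbolic_dist square x y / 2) = disc_ratio (square_map x) (square_map y).
Proof.
  intros Hx Hy.
  assert (Hh : conformal_bijection square unit_disc (riemann_map square)).
  { unfold riemann_map; apply epsilon_spec; exists square_map; apply square_map_conformal. }
  rewrite <- (disc_ratio_conformally_invariant square_map (riemann_map square)
    square_map_conformal Hh x y Hx Hy).
  apply conformal_bijection_square in Hh; destruct Hh as [[_ Hd] _].
  unfold hyperbolic_dist, disc_dist.
  apply tanh_artanh; split; [apply disc_ratio_nonneg | apply disc_ratio_lt_1]; auto.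
Qed.

Lemma boundary_square_on_side (z : C) : boundary square z -> Rabs (Re z) = 1 \/ Rabs (Im z) = 1.
Proof.
  intros [H1 H2].
  assert (Hout : Rabs (Re z) <= 1 /\ Rabs (Im z) <= 1).
  { split; apply Rnot_lt_le; intros Hgt; apply H2.
    - assert (Hd : 0 < Rabs (Re z) - 1) by lra.
      exists (mkposreal _ Hd); intros w Hw [Hs _].
      destruct Hw as [Hw _]; change (Rabs (Re w - Re z) < Rabs (Re z) - 1) in Hw.
      pose proof (Rabs_triang_inv (Re z) (Re w)); rewrite Rabs_minus_sym in Hw; lra.
    - assert (Hd : 0 < Rabs (Im z) - 1) by lra.
      exists (mkposreal _ Hd); intros w Hw [_ Hs].
      destruct Hw as [_ Hw]; change (Rabs (Im w - Im z) < Rabs (Im z) - 1) in Hw.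
      pose proof (Rabs_triang_inv (Im z) (Im w)); rewrite Rabs_minus_sym in Hw; lra. }
  destruct (Rlt_dec (Rabs (Re z)) 1) as [A|A]; [|left; lra].
  destruct (Rlt_dec (Rabs (Im z)) 1) as [B|B]; [|right; lra].
  exfalso; apply H1.
  assert (Hd : 0 < Rmin (1 - Rabs (Re z)) (1 - Rabs (Im z))) by (apply Rmin_glb_lt; lra).
  exists (mkposreal _ Hd); intros w [Hw1 Hw2].
  change (Rabs (Re w - Re z) < Rmin (1 - Rabs (Re z)) (1 - Rabs (Im z))) in Hw1.
  change (Rabs (Im w - Im z) < Rmin (1 - Rabs (Re z)) (1 - Rabs (Im z))) in Hw2.
  pose proof (Rmin_l (1 - Rabs (Re z)) (1 - Rabs (Im z))).
  pose proof (Rmin_r (1 - Rabs (Re z)) (1 - Rabs (Im z))).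
  pose proof (Rabs_triang_inv (Re w) (Re z)); pose proof (Rabs_triang_inv (Im w) (Im z)).
  split; lra.
Qed.

Lemma side_in_boundary (z : C) :
  Rabs (Re z) <= 1 -> Rabs (Im z) <= 1 -> ~ square z -> boundary square z.
Proof.
  intros Hr Hi Hn; split; [intros H; apply Hn, locally_singleton, H|].
  intros [d H]; pose proof (cond_pos d) as Hd.
  set (k := Rmin (d / 2) 1).
  assert (Hk : 0 < k) by (apply Rmin_glb_lt; lra).
  assert (Hk1 : k <= d / 2) by apply Rmin_l; assert (Hk2 : k <= 1) by apply Rmin_r.
  (* Shrinking [z] towards the centre leads into the square. *)
  assert (Hs : forall u, Rabs u <= 1 ->
            Rabs ((1 - k) * u - u) < d /\ Rabs ((1 - k) * u) < 1).
  { intros u Hu; replace ((1 - k) * u - u) with (- (k * u)) by ring.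
    rewrite Rabs_Ropp, !Rabs_mult, (Rabs_pos_eq k), (Rabs_pos_eq (1 - k)) by lra.
    pose proof (Rabs_pos u); split; nra. }
  apply (H ((1 - k) * Re z, (1 - k) * Im z)); split; apply Hs; assumption.
Qed.

Lemma Rabs_sign (e : R) : e = 1 \/ e = -1 -> Rabs e = 1.
Proof. intros [-> | ->]; [apply Rabs_R1 | rewrite Rabs_left; lra]. Qed.

(** Heron's reflection argument, in coordinates [(s, t)] along and across:
    for a path from [(a, c)] to [(b, d)] touching the line [s = e]. *)
Lemma reflected_path_ge (a b c d e t : R) : -1 < a < 1 -> -1 < b < 1 -> Rabs e = 1 ->
  sqrt ((2 - Rabs (a + b)) ^ 2 + (c - d) ^ 2)
    <= Cmod (e - a, t - c) + Cmod (e - b, d - t).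
Proof.
  intros Ha Hb He.
  eapply Rle_trans; [|apply Cmod_triangle].
  replace (((e - a)%R, (t - c)%R) + ((e - b)%R, (d - t)%R))%C with ((2 * e - (a + b), d - c) : C)
    by (apply injective_projections; simpl; ring).
  change (Cmod (2 * e - (a + b), d - c)) with (sqrt ((2 * e - (a + b)) ^ 2 + (d - c) ^ 2)).
  apply sqrt_le_1_alt; apply Rplus_le_compat; [|right; ring].
  unfold Rabs in *; destruct (Rcase_abs e), (Rcase_abs (a + b)); nra.
Qed.

Lemma reflected_path_attained (a b c d : R) : -1 < a < 1 -> -1 < b < 1 -> -1 < c < 1 -> -1 < d < 1 ->
  exists e t, (e = 1 \/ e = -1) /\ -1 < t < 1 /\
    Cmod (e - a, t - c) + Cmod (e - b, d - t) = sqrt ((2 - Rabs (a + b)) ^ 2 + (c - d) ^ 2).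
Proof.
  intros Ha Hb Hc Hd.
  assert (He : exists e, (e = 1 \/ e = -1) /\ Rabs (a + b) = e * (a + b)).
  { unfold Rabs; destruct (Rcase_abs (a + b)); [exists (-1) | exists 1]; split; auto; ring. }
  destruct He as [e [He Hab]].
  assert (He2 : e * e = 1) by (destruct He; subst; ring).
  assert (Hea : -1 < e * a < 1 /\ -1 < e * b < 1) by (destruct He; subst; lra).
  set (q := 2 - e * (a + b)).
  assert (Hq : 0 < q) by (unfold q; lra).
  set (l := (1 - e * a) / q).
  assert (Hlq : l * q = 1 - e * a) by (unfold l; field; lra).
  assert (Hl0 : 0 < l) by (apply Rdiv_lt_0_compat; lra).
  assert (Hl1 : l < 1) by (apply Rlt_div_l; [exact Hq|]; unfold q; lra).
  exists e, (c + l * (d - c)); split; [exact He|]; split; [split; nra|].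
  set (N := sqrt (q ^ 2 + (c - d) ^ 2)).
  assert (Hscale : forall k u v, 0 <= k -> u ^ 2 = (k * q) ^ 2 -> v ^ 2 = (k * (c - d)) ^ 2 ->
            Cmod (u, v) = k * N).
  { intros k u v Hk Hu Hv.
    change (sqrt (u ^ 2 + v ^ 2) = k * N); rewrite Hu, Hv.
    replace ((k * q) ^ 2 + (k * (c - d)) ^ 2) with (k ^ 2 * (q ^ 2 + (c - d) ^ 2)) by ring.
    rewrite sqrt_mult_alt by apply pow2_ge_0; rewrite sqrt_pow2 by exact Hk; reflexivity. }
  rewrite (Hscale l), (Hscale (1 - l)).
  - rewrite Hab; fold q; fold N; ring.
  - lra.
  - replace ((1 - l) * q) with (e * (e - b)) by (rewrite Rmult_minus_distr_r, Hlq; unfold q; nra).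
    rewrite Rpow_mult_distr; replace (e ^ 2) with 1 by lra; ring.
  - ring.
  - lra.
  - rewrite Hlq; replace (1 - e * a) with (e * (e - a)) by lra.
    rewrite Rpow_mult_distr; replace (e ^ 2) with 1 by lra; ring.
  - ring.
Qed.

Lemma Cmod_swap (a b : R) : Cmod (a, b) = Cmod (b, a).
Proof.
  change (sqrt (a ^ 2 + b ^ 2) = sqrt (b ^ 2 + a ^ 2)); f_equal; ring.
Qed.

Lemma Cmod_sub_pair (x z : C) : Cmod (x - z) = Cmod (Re z - Re x, Im z - Im x).
Proof. rewrite Cmod_minus_sym; reflexivity. Qed.

Lemma sqrt_Rmin (a b : R) : sqrt (Rmin a b) = Rmin (sqrt a) (sqrt b).
Proof.
  destruct (Rle_dec a b) as [H|H].
  - rewrite !Rmin_left; [reflexivity | apply sqrt_le_1_alt, H | exact H].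
  - rewrite !Rmin_right; [reflexivity | apply sqrt_le_1_alt; lra | lra].
Qed.

Lemma triangular_ratio_square (x y : C) : square x -> square y ->
  triangular_ratio square x y = Cmod (x - y) / sqrt (reflected_distance_sq x y).
Proof.
  intros Hx Hy; unfold triangular_ratio; f_equal.
  apply square_iff in Hx; apply square_iff in Hy.
  destruct Hx as [Hx1 Hx2]; destruct Hy as [Hy1 Hy2].
  set (E := fun r => exists z, boundary square z /\ r = Cmod (x - z) + Cmod (z - y)).
  set (N1 := sqrt ((2 - Rabs (Re x + Re y)) ^ 2 + (Im x - Im y) ^ 2)).
  set (N2 := sqrt ((Re x - Re y) ^ 2 + (2 - Rabs (Im x + Im y)) ^ 2)).
  assert (EN2 : N2 = sqrt ((2 - Rabs (Im x + Im y)) ^ 2 + (Re x - Re y) ^ 2))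
    by (unfold N2; f_equal; ring).
  assert (Hm : sqrt (reflected_distance_sq x y) = Rmin N1 N2) by apply sqrt_Rmin.
  rewrite Hm.
  assert (Hglb : is_glb_Rbar E (Finite (Rmin N1 N2))).
  { split.
    - intros r [z [Hz ->]]; simpl.
      rewrite (Cmod_sub_pair x z), (Cmod_minus_sym z y), (Cmod_sub_pair y z).
      destruct (boundary_square_on_side z Hz) as [Hs|Hs].
      + eapply Rle_trans; [apply Rmin_l|].
        pose proof (reflected_path_ge (Re x) (Re y) (Im x) (Im y) (Re z) (Im z) Hx1 Hy1 Hs) as H.
        replace (Cmod (Re z - Re y, Im z - Im y)) with (Cmod (Re z - Re y, Im y - Im z));
          [exact H|].
        change (sqrt ((Re z - Re y) ^ 2 + (Im y - Im z) ^ 2)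
          = sqrt ((Re z - Re y) ^ 2 + (Im z - Im y) ^ 2)); f_equal; ring.
      + eapply Rle_trans; [apply Rmin_r|]; rewrite EN2.
        pose proof (reflected_path_ge (Im x) (Im y) (Re x) (Re y) (Im z) (Re z) Hx2 Hy2 Hs) as H.
        rewrite (Cmod_swap (Im z - Im x)), (Cmod_swap (Im z - Im y)) in H.
        replace (Cmod (Re z - Re y, Im z - Im y)) with (Cmod (Re y - Re z, Im z - Im y));
          [exact H|].
        change (sqrt ((Re y - Re z) ^ 2 + (Im z - Im y) ^ 2)
          = sqrt ((Re z - Re y) ^ 2 + (Im z - Im y) ^ 2)); f_equal; ring.
    - intros b Hb; apply Hb.
      destruct (Rle_dec N1 N2) as [H|H].
      + rewrite Rmin_left by exact H.
        destruct (reflected_path_attained (Re x) (Re y) (Im x) (Im y) Hx1 Hy1 Hx2 Hy2)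
          as [e [t [He [Ht Et]]]].
        exists (e, t); split.
        { apply Rabs_sign in He; apply Rabs_lt_between in Ht.
          apply side_in_boundary; simpl; [lra | lra | intros [H1 _]; simpl in H1; lra]. }
        rewrite (Cmod_sub_pair x (e, t)); unfold N1; rewrite <- Et; f_equal.
        change (sqrt ((e - Re y) ^ 2 + (Im y - t) ^ 2) = sqrt ((e - Re y) ^ 2 + (t - Im y) ^ 2)).
        f_equal; ring.
      + rewrite Rmin_right by lra.
        destruct (reflected_path_attained (Im x) (Im y) (Re x) (Re y) Hx2 Hy2 Hx1 Hy1)
          as [e [t [He [Ht Et]]]].
        exists (t, e); split.
        { apply Rabs_sign in He; apply Rabs_lt_between in Ht.
          apply side_in_boundary; simpl; [lra | lra | intros [_ H1]; simpl in H1; lra]. }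
        rewrite (Cmod_sub_pair x (t, e)), EN2, <- Et.
        rewrite (Cmod_swap (e - Im x)); f_equal.
        rewrite Cmod_swap.
        change (sqrt ((Re y - t) ^ 2 + (e - Im y) ^ 2) = sqrt ((t - Re y) ^ 2 + (e - Im y) ^ 2)).
        f_equal; ring. }
  rewrite (is_glb_Rbar_unique _ _ Hglb); reflexivity.
Qed.

Lemma triangular_ratio_nonneg (x y : C) : square x -> square y -> 0 <= triangular_ratio square x y.
Proof.
  intros Hx Hy; rewrite triangular_ratio_square by assumption.
  apply Rdiv_le_0_compat; [apply Cmod_ge_0 | apply sqrt_lt_R0, reflected_distance_sq_pos; assumption].
Qed.

Lemma triangular_ratio_sq (x y : C) : square x -> square y ->
  triangular_ratio square x y ^ 2 = Cmod (x - y) ^ 2 / reflected_distance_sq x y.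
Proof.
  intros Hx Hy; rewrite triangular_ratio_square by assumption.
  pose proof (reflected_distance_sq_pos x y Hx Hy) as H.
  unfold Rdiv; rewrite Rpow_mult_distr, pow_inv, pow2_sqrt by lra; reflexivity.
Qed.

Theorem theorem1 :
  (forall x y : C, square x -> square y ->
     triangular_ratio square x y <= tanh (hyperbolic_dist square x y / 2) /\
     tanh (hyperbolic_dist square x y / 2)
       <= ellipticK (sqrt 2 / 2) * triangular_ratio square x y) /\
  1.854074677 <= ellipticK (sqrt 2 / 2) < 1.854074678 /\
  (forall c : R,
     (forall x y : C, square x -> square y ->
        c * triangular_ratio square x y
          <= tanh (hyperbolic_dist square x y / 2)) ->
     c <= 1) /\
  (forall c : R,
     (forall x y : C, square x -> square y ->
        tanh (hyperbolic_dist square x y / 2)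
          <= c * triangular_ratio square x y) ->
     ellipticK (sqrt 2 / 2) <= c).
Proof.
  pose proof quarter_period_pos as Hw.
  assert (HK : ellipticK (sqrt 2 / 2) ^ 2 = 2 * quarter_period ^ 2).
  { rewrite ellipticK_lemniscate, Rpow_mult_distr, pow2_sqrt by lra; reflexivity. }
  pose proof ellipticK_bounds as HKb.
  assert (Hratio : forall x y, square x -> square y ->
            0 <= disc_ratio (square_map x) (square_map y) < 1).
  { intros x y Hx Hy; pose proof (proj2 square_map_to_disc x Hx);
      pose proof (proj2 square_map_to_disc y Hy).
    split; [apply disc_ratio_nonneg | apply disc_ratio_lt_1]; assumption. }
  split; [|split; [exact HKb|split]].
  - intros x y Hx Hy; rewrite tanh_hyperbolic_dist by assumption.
    destruct (square_map_bounds x y Hx Hy) as [H1 H2].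
    rewrite <- triangular_ratio_sq in H1, H2 by assumption.
    pose proof (triangular_ratio_nonneg x y Hx Hy) as Hs.
    pose proof (Hratio x y Hx Hy) as Hr.
    split; apply Rnot_lt_le; intros Hlt.
    + nra.
    + rewrite <- HK, <- Rpow_mult_distr in H2.
      assert (0 <= ellipticK (sqrt 2 / 2) * triangular_ratio square x y) by nra.
      nra.
  - (* Against the centre, [s] tends to [1] at the boundary, while [tanh < 1]. *)
    intros c Hc; apply Rnot_lt_le; intros Hc1.
    set (t := 2 / (1 + c)).
    assert (Ht : 0 < t < 1).
    { unfold t; split; [apply Rdiv_lt_0_compat; lra | apply Rlt_div_l; lra]. }
    assert (Hy : square (t, 0)) by (apply square_iff; simpl; lra).
    specialize (Hc 0 (t, 0) square_0 Hy).
    rewrite tanh_hyperbolic_dist in Hc by (exact Hy || exact square_0).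
    pose proof (Hratio 0 (t, 0) square_0 Hy) as Hr.
    pose proof (triangular_ratio_nonneg 0 (t, 0) square_0 Hy) as Hs0.
    pose proof (triangular_ratio_sq 0 (t, 0) square_0 Hy) as Hs.
    pose proof (reflected_distance_sq_pos 0 (t, 0) square_0 Hy) as HM.
    assert (HM1 : reflected_distance_sq 0 (t, 0) <= (2 - t) ^ 2).
    { unfold reflected_distance_sq; eapply Rle_trans; [apply Rmin_l|]; simpl Re; simpl Im.
      rewrite Rplus_0_l, (Rabs_pos_eq t) by lra; right; ring. }
    assert (Hd : Cmod (0 - (t, 0)) ^ 2 = t ^ 2).
    { rewrite Cmod_sq; simpl Re; simpl Im; ring. }
    rewrite Hd in Hs.
    assert (Hge : (t / (2 - t)) ^ 2 <= triangular_ratio square 0 (t, 0) ^ 2).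
    { rewrite Hs; unfold Rdiv; rewrite Rpow_mult_distr, pow_inv.
      apply Rmult_le_compat_l; [apply pow2_ge_0|]; apply Rinv_le_contravar; assumption. }
    assert (Hct : t / (2 - t) = / c) by (unfold t; field; lra).
    rewrite Hct in Hge.
    assert (Hci : 0 < / c) by (apply Rinv_0_lt_compat; lra).
    assert (/ c <= triangular_ratio square 0 (t, 0)) by nra.
    assert (c * / c <= c * triangular_ratio square 0 (t, 0)) by (apply Rmult_le_compat_l; lra).
    rewrite Rinv_r in H0 by lra; lra.
  - (* Two points symmetric about the centre, tending to it. *)
    intros c Hc; apply Rnot_lt_le; intros HcK.
    assert (Hbound : forall a, 0 < a < quarter_period / 2 ->
              0 <= c /\ 2 * quarter_period ^ 2 * (1 - a ^ 2) <= c ^ 2 * (1 + a ^ 2)).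
    { intros a Ha; set (t := a / quarter_period).
      assert (Et : t * quarter_period = a) by (unfold t; field; lra).
      assert (Ht : 0 < t < / 2).
      { unfold t; split; [apply Rdiv_lt_0_compat; lra | apply Rlt_div_l; lra]. }
      assert (Hx : square (t, 0)) by (apply square_iff; simpl; lra).
      assert (Hy : square (- t, 0)) by (apply square_iff; simpl; lra).
      specialize (Hc (t, 0) (- t, 0) Hx Hy).
      rewrite tanh_hyperbolic_dist in Hc by assumption.
      pose proof (Hratio _ _ Hx Hy) as Hr.
      pose proof (disc_ratio_square_map _ _ Hx Hy) as Hf.
      assert (HM : reflected_distance_sq (t, 0) (- t, 0) = 4).
      { unfold reflected_distance_sq; simpl Re; simpl Im.
        replace (t + - t) with 0 by ring; replace (0 + 0) with 0 by ring.
        rewrite Rabs_R0, Rmin_left; [ring|].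
        pose proof (pow2_ge_0 (t - - t)); lra. }
      assert (Hs : triangular_ratio square (t, 0) (- t, 0) = t).
      { rewrite triangular_ratio_square, HM by assumption.
        replace (Cmod ((t, 0) - (- t, 0))) with (2 * t).
        - replace 4 with (2 ^ 2) by ring; rewrite sqrt_pow2 by lra; field.
        - rewrite Cmod_sub_pair; simpl Re; simpl Im.
          change (2 * t = sqrt ((- t - t) ^ 2 + (0 - 0) ^ 2)).
          replace ((- t - t) ^ 2 + (0 - 0) ^ 2) with ((2 * t) ^ 2) by ring.
          rewrite sqrt_pow2 by lra; reflexivity. }
      rewrite Hs in Hc.
      simpl Re in Hf; simpl Im in Hf.
      assert (G1 : scaled_gap t (- t) = a).
      { unfold scaled_gap; rewrite Rabs_pos_eq by lra; lra. }
      assert (G2 : scaled_gap 0 0 = 0).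
      { unfold scaled_gap; rewrite Rminus_0_r, Rabs_R0; ring. }
      assert (G3 : scaled_reflected_gap t (- t) = quarter_period).
      { unfold scaled_reflected_gap; replace (t + - t) with 0 by ring; rewrite Rabs_R0; field. }
      assert (G4 : scaled_reflected_gap 0 0 = quarter_period).
      { unfold scaled_reflected_gap; rewrite Rplus_0_r, Rabs_R0; field. }
      rewrite G1, G2, G3, G4 in Hf; unfold lem_cross_ratio in Hf.
      rewrite lem_0, lem_at_quarter_period in Hf.
      pose proof (lem_nonneg a) as La.
      pose proof (lem_le_sq a ltac:(lra)) as L1.
      pose proof (sq_le_lem_ratio a ltac:(lra)) as L2.
      set (d := disc_ratio (square_map (t, 0)) (square_map (- t, 0))) in *.
      assert (Hf2 : d ^ 2 * (1 + lem a) = 2 * lem a) by (rewrite Hf; field; lra).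
      assert (Hct : 0 <= c * t) by lra.
      assert (Hc0 : 0 <= c) by nra.
      split; [exact Hc0|].
      assert (Hd2 : d ^ 2 <= (c * t) ^ 2) by (apply pow_incr; lra).
      assert (Ha2 : 0 < a ^ 2) by nra.
      apply Rmult_le_reg_r with (a ^ 2); [exact Ha2|].
      assert (Hla : a ^ 2 * (1 - a ^ 2) <= lem a) by nra.
      assert (H1 : 2 * lem a <= (c * t) ^ 2 * (1 + a ^ 2)).
      { rewrite <- Hf2; apply Rmult_le_compat; try lra; apply pow2_ge_0. }
      assert (Hsc : quarter_period ^ 2 * (c * t) ^ 2 = c ^ 2 * a ^ 2) by (rewrite <- Et; ring).
      assert (H2 : quarter_period ^ 2 * (2 * lem a) <= quarter_period ^ 2 * ((c * t) ^ 2 * (1 + a ^ 2)))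
        by (apply Rmult_le_compat_l; [apply pow2_ge_0 | exact H1]).
      assert (H3 : quarter_period ^ 2 * (a ^ 2 * (1 - a ^ 2)) <= quarter_period ^ 2 * lem a)
        by (apply Rmult_le_compat_l; [apply pow2_ge_0 | exact Hla]).
      nra. }
    assert (Hc0 : 0 <= c) by (apply (Hbound (quarter_period / 4)); lra).
    set (delta := 2 * quarter_period ^ 2 - c ^ 2).
    assert (Hdelta : 0 < delta) by (unfold delta; rewrite <- HK; nra).
    set (N := 2 * quarter_period ^ 2 + c ^ 2).
    assert (HN : 0 < N) by (unfold N; nra).
    set (a := Rmin (quarter_period / 4) (Rmin 1 (delta / (2 * N)))).
    assert (Hq : 0 < delta / (2 * N)) by (apply Rdiv_lt_0_compat; lra).
    assert (Ha : 0 < a) by (repeat apply Rmin_glb_lt; lra).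
    assert (Ha1 : a <= quarter_period / 4) by apply Rmin_l.
    assert (Ha' : a <= Rmin 1 (delta / (2 * N))) by apply Rmin_r.
    assert (Ha2 : a <= 1) by (eapply Rle_trans; [exact Ha' | apply Rmin_l]).
    assert (Ha3 : a <= delta / (2 * N)) by (eapply Rle_trans; [exact Ha' | apply Rmin_r]).
    destruct (Hbound a) as [_ H]; [lra|].
    assert (HaN : a ^ 2 * N <= delta / 2).
    { apply Rle_trans with (delta / (2 * N) * N); [|right; field; lra].
      apply Rmult_le_compat_r; [lra|]; nra. }
    unfold delta, N in *; lra.
Qed.
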